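(* Let $\omega_{\rm o}>0$, $c_0,c_1>0$, $0<z_{\rm int}<z_{\rm obs}$, $z_{\rm i}>0$, $s_j=1/c_j$, $\Delta k=\omega_{\rm o}|s_0-s_1|$, and $\tilde z_{\rm obs}=z_{\rm int}\frac{c_0}{c_1}+(z_{\rm obs}-z_{\rm int})$. Let $V$ be a random field on $\mathbb{R}^2$ that is mean-zero, stationary, isotropic, bounded, rapidly mixing, and smooth with bounded second-order derivatives, and let $\Psi:\mathbb{R}^2\to\mathbb{C}$ be smooth and rapidly decaying. Let the optical image $\mathcal{I}_{\rm opt}$ (depending on $\varepsilon>0$ and $\gamma$), $\phi_V$ and $\kappa$ be as defined in the context. Then for every $\mathbf{y}\in\mathbb{R}^2$: (i) if $\gamma=1/2$, $$\mathbb{E}\big[\mathcal{I}_{\rm opt}(\mathbf{y})\big]=\left(\frac{\tilde z_{\rm obs}}{z_{\rm i}}\right)^2\int\kappa(\Delta k,\mathbf{k})\left|\Psi\left(-\frac{\tilde z_{\rm obs}}{z_{\rm i}}\mathbf{y}+\frac{c_0z_{\rm int}}{\omega_{\rm o}}\mathbf{k}\right)\right|^2d\mathbf{k};$$ (ii) if $\gamma<1/2$, $$\lim_{\varepsilon\to0}\mathbb{E}\big[\mathcal{I}_{\rm opt}(\mathbf{y})\big]=\left(\frac{\tilde z_{\rm obs}}{z_{\rm i}}\right)^2\left|\Psi\left(-\frac{\tilde z_{\rm obs}}{z_{\rm i}}\mathbf{y}\right)\right|^2;$$ (iii) if $\gamma>1/2$, $$\lim_{\varepsilon\to0}\mathbb{E}\big[\mathcal{I}_{\rm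 opt}(\mathbf{y})\big]=\big|\phi_V(\Delta k)\big|^2\left(\frac{\tilde z_{\rm obs}}{z_{\rm i}}\right)^2\left|\Psi\left(-\frac{\tilde z_{\rm obs}}{z_{\rm i}}\mathbf{y}\right)\right|^2.$$
   Context: Parameters: $\omega_{\rm o}>0$ (frequency), $c_0,c_1>0$ (wave speeds to the left and right of the interface), $s_j=c_j^{-1}$, $0<z_{\rm int}<z_{\rm obs}$, $z_{\rm i}>0$ (distance from lens to detector). Integrals are over $\mathbb{R}^2$ for each vector variable. Fourier transform: $\hat f(\mathbf{k})=\int f(\mathbf{x})e^{-i\mathbf{k}\cdot\mathbf{x}}d\mathbf{x}$. ''Smooth and rapidly decaying'' means Schwartz class. The random field $V:\mathbb{R}^2\to\mathbb{R}$: stationary means its law is translation invariant, isotropic means its law is rotation invariant, rapidly mixing means that its restrictions to two regions become asymptotically independent, rapidly, as the distance between the regions tends to infinity. Characteristic functions: $\phi_V(\tau)=\mathbb{E}[e^{i\tau V(\mathbf{0})}]$ and $\phi_{\Delta V}(\tau,\mathbf{x})=\mathbb{E}[e^{i\tau(V(\mathbf{x}+\mathbf{x}')-V(\mathbf{x}'))}]$ (independent of $\mathbf{x}'$ by stationarity). Scattering kernel: $$\kappa(\tau,\mathbf{k})=\frac{1}{(2\pi)^2}\int e^{-i\mathbf{r}\cdot\mathbf{k}}\phi_{\Delta V}(\tau,\mathbf{r})\,d\mathbf{r},$$ understood in the sense of tempered distributions (it is a finite positive measure in $\mathbf{k}$, and $\int\kappa(\tau,\mathbf{k})f(\mathbf{k})d\mathbf{k}$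 denotes integration against it). Paraxial propagators: $\hat G_j(\omega,\mathbf{k},z)=\exp\left(-i\frac{z c_j|\mathbf{k}|^2}{2\omega}\right)$, $j=0,1$. Scattering operator (kernel understood in the sense of distributions): $$\mathfrak{K}^\varepsilon(\tau,\mathbf{k},\mathbf{k}')=\frac{1}{(2\pi)^2}\int e^{i(\mathbf{k}'-\mathbf{k})\cdot\mathbf{x}}e^{i\tau V(\mathbf{x}/\varepsilon^{\gamma-1/2})}d\mathbf{x},$$ so that $\int\mathfrak{K}^\varepsilon(\tau,\mathbf{k},\mathbf{k}')\hat f(\mathbf{k}')d\mathbf{k}'$ is the Fourier transform of $\mathbf{x}\mapsto e^{i\tau V(\mathbf{x}/\varepsilon^{\gamma-1/2})}f(\mathbf{x})$. Observed field: $$U^\varepsilon_{\rm obs}(\mathbf{x})=\frac{1}{(2\pi)^2}\iint e^{i\mathbf{k}\cdot\mathbf{x}}\,\mathfrak{K}^\varepsilon\big(\omega_{\rm o}(s_0-s_1),\mathbf{k},\mathbf{k}'\big)\hat G_1(\omega_{\rm o},\mathbf{k},z_{\rm obs}-z_{\rm int})\hat G_0(\omega_{\rm o},\mathbf{k}',z_{\rm int})\hat\Psi(\mathbf{k}')\,d\mathbf{k}'d\mathbf{k}.$$ Lens: the focal length $L$ is given by $\frac1L=\frac1{\tilde z_{\rm obs}}+\frac1{z_{\rm i}}$ with $\tilde z_{\rm obs}=z_{\rm int}\frac{c_0}{c_1}+(z_{\rm obs}-z_{\rm int})$, and the lens transmission function is $\tau(\mathbf{x})=\exp\left(-i\frac{\omega_{\rm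 o}|\mathbf{x}|^2}{2c_1L}\right)$. Optical image: $$\mathcal{I}_{\rm opt}(\mathbf{y})=\left|\frac{\omega_{\rm o}}{2\pi i c_1z_{\rm i}}\int U^\varepsilon_{\rm obs}(\mathbf{x})\,\tau(\mathbf{x})\exp\left(i\frac{\omega_{\rm o}|\mathbf{y}-\mathbf{x}|^2}{2z_{\rm i}c_1}\right)d\mathbf{x}\right|^2.$$ *)

(* Defs.v *)
From HB Require Import structures.
From mathcomp Require Export all_boot all_order all_algebra.
From mathcomp Require Export all_classical all_reals all_analysis.
From mathcomp.real_closed Require Export complex.

Set Implicit Arguments.
Unset Strict Implicit.
Unset Printing Implicit Defensive.

Export Order.TTheory GRing.Theory Num.Theory.
Export numFieldNormedType.Exports.

Local Open Scope classical_set_scope.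
Local Open Scope ring_scope.
Local Open Scope complex_scope.

(* The plane is [R * R].  Its library norm is the sup norm, so the Euclidean
   structure is written out here. *)
Section Plane.
Variable R : realType.
Implicit Types x y : R * R.

Definition dot2 x y : R := x.1 * y.1 + x.2 * y.2.
Definition sqnorm2 x : R := dot2 x x.
Definition enorm2 x : R := Num.sqrt (sqnorm2 x).
Definition scale2 (a : R) x : R * R := (a * x.1, a * x.2).
Definition rotate2 (theta : R) x : R * R :=
  (cos theta * x.1 - sin theta * x.2, sin theta * x.1 + cos theta * x.2).

Definition lebesgue2 :
    {measure set (measurableTypeR R * measurableTypeR R) -> \bar R} :=
  (@lebesgue_measure R \x @lebesgue_measure R)%E.

End Plane.

Section Complex.
Variable R : realType.

Definition cis (t : R) : R[i] := cos t +i* sin t.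

Definition sqmod (z : R[i]) : R := complex.Re z ^+ 2 + complex.Im z ^+ 2.

(* Lebesgue integral of a complex function, componentwise. *)
Definition cintegral d (T : measurableType d) (mu : {measure set T -> \bar R})
    (f : T -> R[i]) : R[i] :=
  (\int[mu]_x complex.Re (f x)) +i* (\int[mu]_x complex.Im (f x)).

Definition fourier (f : R * R -> R[i]) (k : R * R) : R[i] :=
  cintegral (@lebesgue2 R) (fun x => cis (- dot2 k x) * f x).

Definition inv_fourier (g : R * R -> R[i]) (x : R * R) : R[i] :=
  (((2 * pi) ^+ 2)^-1)%:C *
  cintegral (@lebesgue2 R) (fun k => cis (dot2 k x) * g k).

End Complex.

Section Smooth.
Variable R : realType.

Definition partial (b : bool) (f : R * R -> R) (x : R * R) : R :=
  'D_(if b then (0, 1) else (1, 0)) f x.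

(* [false] in [s] stands for d/dx1 and [true] for d/dx2. *)
Definition partials (s : seq bool) (f : R * R -> R) : R * R -> R :=
  foldr partial f s.

Definition smooth2 (f : R * R -> R) : Prop :=
  forall s x, differentiable (partials s f) x.

Definition bounded_second_derivatives (f : R * R -> R) : Prop :=
  exists M : R, forall s x, size s = 2%N -> `|partials s f x| <= M.

Definition real_schwartz (f : R * R -> R) : Prop :=
  smooth2 f /\
  forall s (n : nat), exists C : R, forall x,
    (1 + enorm2 x) ^+ n * `|partials s f x| <= C.

Definition schwartz (f : R * R -> R[i]) : Prop :=
  real_schwartz (fun x => complex.Re (f x)) /\
  real_schwartz (fun x => complex.Im (f x)).

End Smooth.

Section RandomField.
Context d (Omega : measurableType d) (R : realType) (P : probability Omega R).

(* A random field is a family of real random variables; [V x w] is the value at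
   the point [x] for the outcome [w]. *)
Variable V : R * R -> {RV P >-> R}.

(* The sigma-algebra on the space of all functions R^2 -> R that is generated by
   the evaluations at points of [A]. *)
Definition cylinder (A : set (R * R)) : set (set (R * R -> R)) :=
  <<s [set C | exists x (B : set R),
         [/\ A x, measurable B & C = [set f | B (f x)]] ]>>.

(* The law of the field whose value at [x] is [V (g x)]. *)
Definition law (g : R * R -> R * R) (C : set (R * R -> R)) : \bar R :=
  P [set w | C (fun x => V (g x) w)].

Definition mean_zero : Prop := forall x, ('E_P[V x] = 0)%E.

Definition stationary : Prop :=
  forall (h : R * R) C, cylinder setT C -> law (fun x => x + h) C = law id C.

Definition isotropic : Prop :=
  forall (theta : R) C, cylinder setT C -> law (rotate2 theta) C = law id C.

Definition bounded_field : Prop :=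
  exists M : R, {ae P, forall w, forall x, `|V x w| <= M}.

Definition smooth_field : Prop :=
  {ae P, forall w, smooth2 (fun x => V x w) /\
                   bounded_second_derivatives (fun x => V x w)}.

(* Strong (alpha-)mixing: events of the restrictions of the field to two regions
   at distance at least rho are independent up to an error that decays faster
   than any power of rho.  The rate may depend on a bound D for the diameters of
   the regions. *)
Definition rapidly_mixing : Prop :=
  forall (D : R) (n : nat), exists C : R,
  forall (A B : set (R * R)) (rho : R), 0 <= rho ->
    (forall a a', A a -> A a' -> enorm2 (a - a') <= D) ->
    (forall b b', B b -> B b' -> enorm2 (b - b') <= D) ->
    (forall a b, A a -> B b -> rho <= enorm2 (a - b)) ->
  forall E F, cylinder A E -> cylinder B F ->
    (1 + rho) ^+ n *
    `| fine (law id (E `&` F)) - fine (law id E) * fine (law id F) | <= C.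

Definition char_fun (tau : R) : R[i] :=
  cintegral P (fun w => cis (tau * V (0, 0) w)).

(* The increments are taken from the origin, which loses nothing when [V] is
   stationary. *)
Definition char_fun_incr (tau : R) (x : R * R) : R[i] :=
  cintegral P (fun w => cis (tau * (V x w - V (0, 0) w))).

(* [kappa] is (2 pi)^-2 times the Fourier transform of
   [char_fun_incr tau] as a tempered distribution. *)
Definition is_scattering_kernel (tau : R)
    (kappa : {finite_measure set (R * R)%type -> \bar R}) : Prop :=
  forall f : R * R -> R[i], schwartz f ->
    cintegral kappa f =
    (((2 * pi) ^+ 2)^-1)%:C *
    cintegral (@lebesgue2 R) (fun r => char_fun_incr tau r * fourier f r).

(* The finite positive measure satisfying the above; the zero measure is a dummy
   value for the case where there is none. *)
Definition scattering_kernel (tau : R) :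
    {finite_measure set (R * R)%type -> \bar R} :=
  if pselect (exists kappa, is_scattering_kernel tau kappa) is left h
  then sval (cid h) else mzero.

End RandomField.

Section Imaging.
Variable R : realType.
Variables omega c0 c1 zint zobs zi : R.

Definition wavenumber_gap : R := omega * `|c0^-1 - c1^-1|.

Definition propagator (c : R) (k : R * R) (z : R) : R[i] :=
  cis (- (z * c * sqnorm2 k / (2 * omega))).

(* Action of the scattering operator on [g]: since its kernel is a distribution,
   the integral over k' is performed before the one over x, so that the image of
   the Fourier transform of f is the Fourier transform of
   x |-> exp(i tau v(x / eps^(gamma - 1/2))) f(x). *)
Definition scattering_operator (v : R * R -> R) (eps gamma tau : R)
    (g : R * R -> R[i]) : R * R -> R[i] :=
  fourier (fun x =>
    cis (tau * v (scale2 (eps `^ (gamma - 2^-1))^-1 x)) * inv_fourier g x).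

Definition observed_field (v : R * R -> R) (eps gamma : R)
    (Psi : R * R -> R[i]) : R * R -> R[i] :=
  inv_fourier (fun k =>
    propagator c1 k (zobs - zint) *
    scattering_operator v eps gamma (omega * (c0^-1 - c1^-1))
      (fun k' => propagator c0 k' zint * fourier Psi k') k).

Definition eff_distance : R := zint * (c0 / c1) + (zobs - zint).

Definition focal_length : R := (eff_distance^-1 + zi^-1)^-1.

Definition lens (x : R * R) : R[i] :=
  cis (- (omega * sqnorm2 x / (2 * c1 * focal_length))).

Definition optical_image (v : R * R -> R) (eps gamma : R)
    (Psi : R * R -> R[i]) (y : R * R) : R :=
  sqmod (omega%:C / (2 * pi%:C * 'i%C * c1%:C * zi%:C) *
    cintegral (@lebesgue2 R) (fun x =>
      observed_field v eps gamma Psi x * lens x *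
      cis (omega * sqnorm2 (y - x) / (2 * zi * c1)))).

End Imaging.

(* Main.v *)
(* Writing the two propagators and the lens as Fresnel integrals, all quadratic phases cancel
   pathwise: up to a constant the image is the squared modulus of the integral of
   [exp(i tau V(x / eps^(gamma - 1/2)))] against the Fourier transform of a Schwartz window
   [S], whose squared modulus [f] is the rescaled profile of [Psi].  Taking expectations,
   stationarity turns this into the integral of [phi_incr(r / eps^(gamma - 1/2))] against the
   Fourier transform of [f].  For [gamma = 1/2] this is the integral of [f] against the
   scattering kernel; for [gamma < 1/2] the argument of [phi_incr] tends to 0, and for
   [gamma > 1/2] it leaves every bounded set, where mixing replaces [phi_incr] by
   [|phi_V|^2]; Fourier inversion at 0 concludes in both cases.

   The kernel exists as a finite measure: it is [|phi_V|^2] times a unit mass at 0 plus the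
   Fourier transform of the centered covariance [phi_incr - |phi_V|^2].  The latter is
   integrable by mixing, so its transform is continuous; it is nonnegative as a limit of
   second moments of Gaussian windows, hence integrable.  Isotropy makes [phi_incr] even in
   [tau], so that only [|tau|] matters. *)

Require Import Defs.
From HB Require Import structures.
From mathcomp Require Import ring lra measurable_realfun.

Set Implicit Arguments.
Unset Strict Implicit.
Unset Printing Implicit Defensive.

Local Open Scope classical_set_scope.
Local Open Scope ring_scope.
Local Open Scope complex_scope.

(** The obstacle is the regularity of a realization. Its derivatives are bounded only up to order
    two, so multiplication by the phase factor leaves the Schwartz class. The Fresnel formula is
    therefore proved for every function that is integrable together with its Fourier transform; for
    the product in question an L2 bound on the transform and the mixed derivative d1 d2 give this.
    Gaussians with a complex parameter [p] are the common tool: [p] tending to the imaginary axis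
    gives the Fresnel formula, [p] tending to 0 gives inversion, the L2 bound and the integrability
    of the spectral density. Two Schwartz classes occur. The kernel is known only through its
    pairing with [schwartz] functions, so the profile of the image must be placed in that class;
    [schw] is stable by construction, which makes closure under transforms and chirps formal. The
    expectation is an extended integral of a function of the outcome whose measurability is not
    given; a closed form valid off a null set replaces it. *)

Local Notation re := complex.Re.
Local Notation im := complex.Im.

(** * Complex arithmetic and integrals *)

Section ComplexArith.
Variable R : realType.
Implicit Types z w : R[i].

Lemma complex_eqP z w : re z = re w -> im z = im w -> z = w.
Proof. by case: z => a b; case: w => c d /= -> ->. Qed.

Lemma reD z w : re (z + w) = re z + re w.
Proof. by case: z => a b; case: w. Qed.
Lemma imD z w : im (z + w) = im z + im w.
Proof. by case: z => a b; case: w. Qed.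
Lemma reN z : re (- z) = - re z.
Proof. by case: z. Qed.
Lemma imN z : im (- z) = - im z.
Proof. by case: z. Qed.
Lemma reM z w : re (z * w) = re z * re w - im z * im w.
Proof. by case: z => a b; case: w. Qed.
Lemma imM z w : im (z * w) = re z * im w + im z * re w.
Proof. by case: z => a b; case: w => c d /=. Qed.
Lemma reJ z : re (conjc z) = re z.
Proof. by case: z. Qed.
Lemma imJ z : im (conjc z) = - im z.
Proof. by case: z. Qed.

Definition reimE := (reD, imD, reN, imN, reM, imM, reJ, imJ).

Lemma conjcM z w : conjc (z * w) = conjc z * conjc w.
Proof. by apply: complex_eqP; rewrite !reimE; ring. Qed.

Lemma mulc_conj z : z * conjc z = (sqmod z)%:C.
Proof. by apply: complex_eqP; rewrite !reimE /= /sqmod; ring. Qed.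

Lemma sqmodM z w : sqmod (z * w) = sqmod z * sqmod w.
Proof. by rewrite /sqmod !reimE; ring. Qed.

Lemma sqmod_ge0 z : 0 <= sqmod z.
Proof. by rewrite addr_ge0// sqr_ge0. Qed.

Lemma sqmodJ z : sqmod (conjc z) = sqmod z.
Proof. by rewrite /sqmod !reimE sqrrN. Qed.

Lemma sqmod_real (a : R) : sqmod a%:C = a ^+ 2.
Proof. by rewrite /sqmod /= expr0n addr0. Qed.

(* Replaces the modulus in all dominations: it is submultiplicative and controls the
   componentwise integrals without square roots. *)
Definition n1 z : R := `|re z| + `|im z|.

Lemma n1_ge0 z : 0 <= n1 z. Proof. by rewrite addr_ge0. Qed.
Lemma re_le_n1 z : `|re z| <= n1 z. Proof. by rewrite lerDl. Qed.
Lemma im_le_n1 z : `|im z| <= n1 z. Proof. by rewrite lerDr. Qed.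
Lemma n1D z w : n1 (z + w) <= n1 z + n1 w.
Proof. by rewrite /n1 !reimE addrACA lerD// ler_normD. Qed.
Lemma n1N z : n1 (- z) = n1 z.
Proof. by rewrite /n1 !reimE !normrN. Qed.
Lemma n1J z : n1 (conjc z) = n1 z.
Proof. by rewrite /n1 !reimE !normrN. Qed.
Lemma n1M z w : n1 (z * w) <= n1 z * n1 w.
Proof.
rewrite /n1 !reimE mulrDl !mulrDr -!normrM.
have h1 := ler_normB (re z * re w) (im z * im w).
have h2 := ler_normD (re z * im w) (im z * re w).
by rewrite (le_trans (lerD h1 h2))//; lra.
Qed.
Lemma n1_real (a : R) : n1 a%:C = `|a|.
Proof. by rewrite /n1 /= normr0 addr0. Qed.

Lemma n1_cis (t : R) : n1 (cis t) <= 2.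
Proof. by rewrite /n1 /= (_ : 2 = 1 + 1 :> R)// lerD// ler_norml ?sin_geN1 ?sin_le1 ?cos_geN1 ?cos_le1. Qed.
Lemma n1_cisM (t : R) z : n1 (cis t * z) <= 2 * n1 z.
Proof. by rewrite (le_trans (n1M _ _))// ler_wpM2r ?n1_ge0 ?n1_cis. Qed.
Lemma sqmod_le_n1 z : sqmod z <= n1 z ^+ 2.
Proof.
rewrite /sqmod /n1 -(real_normK (num_real (re z))) -(real_normK (num_real (im z))).
have := normr_ge0 (re z); have := normr_ge0 (im z); nra.
Qed.
Lemma n1_le_sqmod z : n1 z ^+ 2 <= 2 * sqmod z.
Proof.
rewrite /sqmod /n1 -(real_normK (num_real (re z))) -(real_normK (num_real (im z))).
have := sqr_ge0 (`|re z| - `|im z|); nra.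
Qed.

Lemma cisD (s t : R) : cis (s + t) = cis s * cis t.
Proof. by apply: complex_eqP; rewrite !reimE /= ?cosD ?sinD; ring. Qed.
Lemma cis0 : cis 0 = 1 :> R[i].
Proof. by rewrite /cis cos0 sin0. Qed.
Lemma cisN (t : R) : cis (- t) = conjc (cis t).
Proof. by rewrite /cis cosN sinN. Qed.
Lemma sqmod_cis (t : R) : sqmod (cis t) = 1.
Proof. by rewrite /sqmod /= cos2Dsin2. Qed.

Definition cexp z : R[i] := (expR (re z))%:C * cis (im z).

Lemma cexpD z w : cexp (z + w) = cexp z * cexp w.
Proof. by rewrite /cexp !reimE expRD cisD rmorphM /= mulrACA. Qed.
Lemma cexp0 : cexp 0 = 1.
Proof. by rewrite /cexp /= expR0 cis0 mulr1. Qed.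
Lemma cexp_real (a : R) : cexp a%:C = (expR a)%:C.
Proof. by rewrite /cexp /= cis0 mulr1. Qed.
Lemma n1_cexp z : n1 (cexp z) <= 2 * expR (re z).
Proof. by rewrite /cexp mulrC (le_trans (n1_cisM _ _))// n1_real ger0_norm ?expR_ge0. Qed.

End ComplexArith.

Section RealIntegrals.
Context d (T : measurableType d) (R : realType) (mu : {measure set T -> \bar R}).
Implicit Types f g : T -> R.

Definition rintble f := mu.-integrable setT (EFin \o f).

Lemma rintble_meas f : rintble f -> measurable_fun setT f.
Proof. by move=> /measurable_int/measurable_EFinP. Qed.

Lemma rintble_le f g : measurable_fun setT f -> rintble g ->
  (forall x, `|f x| <= g x) -> rintble f.
Proof.
move=> mf ig fg; apply: (le_integrable _ _ _ ig) => //; first exact/measurable_EFinP.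
by move=> x _ /=; rewrite lee_fin (le_trans (fg x))// ler_norm.
Qed.

Lemma rintbleD f g : rintble f -> rintble g -> rintble (fun x => f x + g x).
Proof. by move=> hf hg; exact: (integrableD _ hf hg). Qed.

Lemma rintbleB f g : rintble f -> rintble g -> rintble (fun x => f x - g x).
Proof. by move=> hf hg; exact: (integrableB _ hf hg). Qed.

Lemma rintbleZ (a : R) f : rintble f -> rintble (fun x => a * f x).
Proof. by move=> hf; exact: (integrableZl _ _ hf). Qed.

Lemma rintble_norm f : rintble f -> rintble (fun x => `|f x|).
Proof. by move=> hf; exact: (integrable_norm hf). Qed.

Lemma rint_cvg (f_ : nat -> T -> R) f g :
  (forall n, measurable_fun setT (f_ n)) ->
  (forall x, f_ n x @[n --> \oo] --> f x) ->
  rintble g -> (forall n x, `|f_ n x| <= g x) ->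
  rintble f /\ (\int[mu]_x f_ n x) @[n --> \oo] --> \int[mu]_x f x.
Proof.
move=> mf_ cf ig fg.
have mf : measurable_fun setT f by apply: (measurable_fun_cvg mf_) => x _; exact: cf.
have cE x : [set: T] x -> (f_ n x)%:E @[n --> \oo] --> (f x)%:E.
  by move=> _; apply/cvg_EFin; [exact: nearW|exact: cf].
have [h1 _ h3] := @dominated_convergence _ _ _ mu setT measurableT
  (fun n => EFin \o f_ n) (EFin \o f) (EFin \o g)
  (fun n => (measurable_EFinP _ _).2 (mf_ n)) ((measurable_EFinP _ _).2 mf)
  (aeW _ cE) ig (aeW _ (fun x n _ => fg n x)).
split => //.
have e : (\int[mu]_x (EFin \o f) x)%E = (\int[mu]_x f x)%:E.
  by rewrite fineK//; exact: integrable_fin_num.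
by rewrite e in h3; exact: (fine_cvg h3).
Qed.

End RealIntegrals.

Section ComplexIntegrals.
Context d (T : measurableType d) (R : realType).
Implicit Types f g : T -> R[i].

Definition cmeas f :=
  measurable_fun setT (fun x => re (f x)) /\ measurable_fun setT (fun x => im (f x)).

Lemma cmeas_cst (c : R[i]) : cmeas (fun=> c).
Proof. by split; exact: measurable_cst. Qed.

Lemma cmeasD f g : cmeas f -> cmeas g -> cmeas (fun x => f x + g x).
Proof.
move=> [f1 f2] [g1 g2]; split.
  by under eq_fun do rewrite reD; exact: measurable_funD.
by under eq_fun do rewrite imD; exact: measurable_funD.
Qed.

Lemma cmeasN f : cmeas f -> cmeas (fun x => - f x).
Proof.
move=> [f1 f2]; split.
  by under eq_fun do rewrite reN; exact: measurableT_comp.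
by under eq_fun do rewrite imN; exact: measurableT_comp.
Qed.

Lemma cmeasM f g : cmeas f -> cmeas g -> cmeas (fun x => f x * g x).
Proof.
move=> [f1 f2] [g1 g2]; split.
  by under eq_fun do rewrite reM; apply: measurable_funB; exact: measurable_funM.
by under eq_fun do rewrite imM; apply: measurable_funD; exact: measurable_funM.
Qed.

Lemma cmeasJ f : cmeas f -> cmeas (fun x => conjc (f x)).
Proof.
move=> [f1 f2]; split.
  by under eq_fun do rewrite reJ.
by under eq_fun do rewrite imJ; exact: measurableT_comp.
Qed.

Lemma cmeas_real (a : T -> R) : measurable_fun setT a -> cmeas (fun x => (a x)%:C).
Proof. by move=> ma; split => //=; exact: measurable_cst. Qed.

Lemma cmeas_cis (a : T -> R) : measurable_fun setT a -> cmeas (fun x => cis (a x)).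
Proof.
move=> ma; split; rewrite /cis /=; apply: measurableT_comp => //;
  apply: continuous_measurable_fun; [exact: continuous_cos|exact: continuous_sin].
Qed.

Lemma cmeas_cexp f : cmeas f -> cmeas (fun x => cexp (f x)).
Proof.
move=> [f1 f2]; apply: cmeasM; last exact: cmeas_cis.
by apply: cmeas_real; apply: measurableT_comp.
Qed.

Lemma cmeas_sqmod f : cmeas f -> measurable_fun setT (fun x => sqmod (f x)).
Proof.
by move=> [f1 f2]; apply: measurable_funD;
  apply: (measurableT_comp (@exprn_measurable _ _ _)).
Qed.

Variable mu : {measure set T -> \bar R}.

Definition cintble f :=
  rintble mu (fun x => re (f x)) /\ rintble mu (fun x => im (f x)).

Lemma cintble_meas f : cintble f -> cmeas f.
Proof. by move=> [/rintble_meas ? /rintble_meas ?]. Qed.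

Lemma cintble_le f (g : T -> R) : cmeas f -> rintble mu g ->
  (forall x, n1 (f x) <= g x) -> cintble f.
Proof.
move=> [m1 m2] ig fg; split; apply: rintble_le ig _ => // x.
  by rewrite (le_trans (re_le_n1 _)).
by rewrite (le_trans (im_le_n1 _)).
Qed.

Lemma cintble_n1 f : cintble f -> rintble mu (fun x => n1 (f x)).
Proof. by move=> [i1 i2]; apply: rintbleD; exact: rintble_norm. Qed.

Lemma cintbleD f g : cintble f -> cintble g -> cintble (fun x => f x + g x).
Proof.
move=> [f1 f2] [g1 g2]; split.
  by under eq_fun do rewrite reD; exact: rintbleD.
by under eq_fun do rewrite imD; exact: rintbleD.
Qed.

Lemma cintbleZ c f : cintble f -> cintble (fun x => c * f x).
Proof.
move=> [f1 f2]; split.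
  by under eq_fun do rewrite reM; apply: rintbleB; exact: rintbleZ.
by under eq_fun do rewrite imM; apply: rintbleD; exact: rintbleZ.
Qed.

Lemma cintbleJ f : cintble f -> cintble (fun x => conjc (f x)).
Proof.
move=> [f1 f2]; split; first by under eq_fun do rewrite reJ.
under eq_fun do rewrite imJ -mulN1r; exact: rintbleZ.
Qed.

Lemma cintbleMb f g (C : R) : cintble f -> cmeas g -> (forall x, n1 (g x) <= C) ->
  cintble (fun x => g x * f x).
Proof.
move=> hf mg gC.
apply: (@cintble_le _ (fun x => C * n1 (f x))).
- by apply: cmeasM => //; exact: cintble_meas.
- by apply: rintbleZ; exact: cintble_n1.
- by move=> x; rewrite (le_trans (n1M _ _))// ler_wpM2r// n1_ge0.
Qed.

Lemma cintegralD f g : cintble f -> cintble g ->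
  cintegral mu (fun x => f x + g x) = cintegral mu f + cintegral mu g.
Proof.
move=> [f1 f2] [g1 g2]; apply: complex_eqP => /=.
  by under eq_fun do rewrite reD; rewrite RintegralD.
by under eq_fun do rewrite imD; rewrite RintegralD.
Qed.

Lemma cintegralZ c f : cintble f ->
  cintegral mu (fun x => c * f x) = c * cintegral mu f.
Proof.
move=> [f1 f2]; apply: complex_eqP; rewrite !reimE /=.
  by under eq_fun do rewrite reM; rewrite RintegralB ?RintegralZl//; exact: rintbleZ.
by under eq_fun do rewrite imM; rewrite RintegralD ?RintegralZl//; exact: rintbleZ.
Qed.

Lemma cintegralJ f : cintble f ->
  cintegral mu (fun x => conjc (f x)) = conjc (cintegral mu f).
Proof.
move=> [f1 f2]; apply: complex_eqP; rewrite !reimE /=.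
  by under eq_fun do rewrite reJ.
under eq_fun do rewrite imJ -mulN1r; rewrite RintegralZl//; lra.
Qed.

Lemma cintegral_real (a : T -> R) :
  cintegral mu (fun x => (a x)%:C) = (\int[mu]_x a x)%:C.
Proof. by apply: complex_eqP => //=; rewrite Rintegral_cst// mul0r. Qed.

Lemma eq_cintegral f g : f =1 g -> cintegral mu f = cintegral mu g.
Proof. by move=> /funext ->. Qed.

Lemma n1_cintegral f (g : T -> R) : cintble f -> rintble mu g ->
  (forall x, n1 (f x) <= g x) -> n1 (cintegral mu f) <= \int[mu]_x g x.
Proof.
move=> [f1 f2] ig fg; rewrite /n1 /=.
rewrite (le_trans (lerD (le_normr_Rintegral measurableT f1) (le_normr_Rintegral measurableT f2)))//.
rewrite -RintegralD//; [|exact: rintble_norm|exact: rintble_norm].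
apply: le_Rintegral => //; first by apply: rintbleD; exact: rintble_norm.
by move=> x _; exact: fg.
Qed.

(** Componentwise, to match [cintegral]; no topology on [R[i]] is involved. *)
Definition ccvg (u : nat -> R[i]) (l : R[i]) :=
  re (u n) @[n --> \oo] --> re l /\ im (u n) @[n --> \oo] --> im l.

Lemma cint_cvg (f_ : nat -> T -> R[i]) f (g : T -> R) :
  (forall n, cmeas (f_ n)) -> (forall x, ccvg (f_ ^~ x) (f x)) ->
  rintble mu g -> (forall n x, n1 (f_ n x) <= g x) ->
  cintble f /\ ccvg (fun n => cintegral mu (f_ n)) (cintegral mu f).
Proof.
move=> mf cf ig fg.
have [i1 c1] := @rint_cvg _ _ _ mu (fun n x => re (f_ n x)) (fun x => re (f x)) g
  (fun n => (mf n).1) (fun x => (cf x).1) ig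
  (fun n x => le_trans (re_le_n1 _) (fg n x)).
have [i2 c2] := @rint_cvg _ _ _ mu (fun n x => im (f_ n x)) (fun x => im (f x)) g
  (fun n => (mf n).2) (fun x => (cf x).2) ig
  (fun n x => le_trans (im_le_n1 _) (fg n x)).
by [].
Qed.

End ComplexIntegrals.

Section ComplexCvg.
Variable R : realType.
Implicit Types (u v : nat -> R[i]) (a b : R[i]).

Lemma ccvg_unique u a b : ccvg u a -> ccvg u b -> a = b.
Proof.
move=> [a1 a2] [b1 b2]; apply: complex_eqP.
  exact: (cvg_unique _ a1 b1).
exact: (cvg_unique _ a2 b2).
Qed.

Lemma ccvg_cst a : ccvg (fun=> a) a.
Proof. by split; exact: cvg_cst. Qed.

Lemma ccvgM u v a b : ccvg u a -> ccvg v b -> ccvg (fun n => u n * v n) (a * b).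
Proof.
move=> [u1 u2] [v1 v2]; split; rewrite reimE; under eq_fun do rewrite reimE.
  by apply: cvgB; exact: cvgM.
by apply: cvgD; exact: cvgM.
Qed.

Lemma ccvgD u v a b : ccvg u a -> ccvg v b -> ccvg (fun n => u n + v n) (a + b).
Proof.
by move=> [u1 u2] [v1 v2]; split; rewrite reimE; under eq_fun do rewrite reimE;
  exact: cvgD.
Qed.

Lemma ccvgJ u a : ccvg u a -> ccvg (fun n => conjc (u n)) (conjc a).
Proof.
move=> [u1 u2]; split; first by rewrite reJ; under eq_fun do rewrite reJ.
by rewrite imJ; under eq_fun do rewrite imJ; exact: cvgN.
Qed.

Lemma ccvg_real (r : nat -> R) (l : R) : r n @[n --> \oo] --> l ->
  ccvg (fun n => (r n)%:C) l%:C.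
Proof. by split => //=; exact: cvg_cst. Qed.

Lemma ccvg_cis (r : nat -> R) (l : R) : r n @[n --> \oo] --> l ->
  ccvg (fun n => cis (r n)) (cis l).
Proof.
move=> rl; split => /=; apply: continuous_cvg => //;
  [exact: continuous_cos|exact: continuous_sin].
Qed.

Lemma ccvg_cexp u a : ccvg u a -> ccvg (fun n => cexp (u n)) (cexp a).
Proof.
move=> [u1 u2]; apply: ccvgM; last exact: ccvg_cis.
by apply: ccvg_real; apply: continuous_cvg => //; exact: continuous_expR.
Qed.

Lemma ccvg_sqmod u a : ccvg u a -> sqmod (u n) @[n --> \oo] --> sqmod a.
Proof. by move=> [u1 u2]; apply: cvgD; rewrite expr2; under eq_fun do rewrite expr2; exact: cvgM. Qed.

End ComplexCvg.

(** * Dominated Fubini and Lebesgue measure on the plane *)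

Section DominatedFubini.
Context d1 d2 (T1 : measurableType d1) (T2 : measurableType d2) (R : realType).
Variables (m1 : {sigma_finite_measure set T1 -> \bar R})
  (m2 : {sigma_finite_measure set T2 -> \bar R}) (a : T1 -> R) (b : T2 -> R).
Hypotheses (ia : rintble m1 a) (ib : rintble m2 b).
Hypotheses (a0 : forall x, 0 <= a x) (b0 : forall y, 0 <= b y).

Lemma rintble_prod : (m1 \x m2)%E.-integrable setT (fun z => (a z.1 * b z.2)%:E).
Proof.
have ma := rintble_meas ia; have mb := rintble_meas ib.
apply/integrable12ltyP.
  apply/measurable_EFinP; apply: measurable_funM.
    exact: (measurableT_comp ma (@measurable_fst _ _ T1 T2)).
  exact: (measurableT_comp mb (@measurable_snd _ _ T1 T2)).
have -> : (\int[m1]_x \int[m2]_y `|(a (x, y).1 * b (x, y).2)%:E| =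
           \int[m1]_x (\int[m2]_y b y * a x)%:E)%E.
  apply: eq_integral => x _ /=; rewrite EFinM fineK; last exact: integrable_fin_num.
  rewrite -integralZr//; apply: eq_integral => y _ /=.
  by rewrite -EFinM ger0_norm ?mulr_ge0// mulrC.
rewrite -[X in (X < _)%E]fineK ?ltry//.
by apply: integrable_fin_num => //; exact: (rintbleZ _ ia).
Qed.

(** A majorant in product form makes every section integrable, not just almost every one, so no
    exceptional null set enters later computations. *)
Lemma rfubini (f : T1 * T2 -> R) : measurable_fun setT f ->
  (forall x y, `|f (x, y)| <= a x * b y) ->
  [/\ forall x, rintble m2 (fun y => f (x, y)), forall y, rintble m1 (fun x => f (x, y)),
   rintble m1 (fun x => \int[m2]_y f (x, y)), rintble m2 (fun y => \int[m1]_x f (x, y))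
   & \int[m1]_x \int[m2]_y f (x, y) = \int[m2]_y \int[m1]_x f (x, y)].
Proof.
move=> mf fab.
have i2 x : rintble m2 (fun y => f (x, y)).
  apply: (@rintble_le _ _ _ _ _ (fun y => a x * b y)) => //.
    exact: measurable_fun_pair2.
  exact: rintbleZ.
have i1 y : rintble m1 (fun x => f (x, y)).
  apply: (@rintble_le _ _ _ _ _ (fun x => b y * a x)) => //.
  - exact: measurable_fun_pair1.
  - exact: rintbleZ.
  - by move=> x; rewrite mulrC.
have fi : (m1 \x m2)%E.-integrable setT (EFin \o f).
  apply: (le_integrable _ _ _ rintble_prod) => //; first exact/measurable_EFinP.
  by move=> [x y] _ /=; rewrite lee_fin [leRHS]ger0_norm ?mulr_ge0.
have E1 : fubini_F m2 (EFin \o f) = EFin \o (fun x => \int[m2]_y f (x, y)).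
  by apply/funext => x; rewrite /= fineK//; exact: integrable_fin_num (i2 x).
have E2 : fubini_G m1 (EFin \o f) = EFin \o (fun y => \int[m1]_x f (x, y)).
  by apply/funext => y; rewrite /= fineK//; exact: integrable_fin_num (i1 y).
split => //.
- by have := integrable_fubini_F fi; rewrite E1.
- apply: (@rintble_le _ _ _ _ _ (fun y => \int[m1]_x a x * b y)).
  + apply/measurable_EFinP.
    by have := measurable_fubini_G fi; rewrite E2.
  + exact: rintbleZ.
  + move=> y; rewrite mulrC -RintegralZl//.
    rewrite (le_trans (le_normr_Rintegral _ (i1 y)))//.
    apply: le_Rintegral => //; [exact: rintble_norm|exact: rintbleZ|].
    by move=> x _; rewrite mulrC.
- have := integral12_prod_meas1 fi; rewrite -(integral21_prod_meas1 fi) E1 E2.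
  by move=> h; rewrite /Rintegral h.
Qed.

Lemma cfubini (f : T1 * T2 -> R[i]) : cmeas f ->
  (forall x y, n1 (f (x, y)) <= a x * b y) ->
  [/\ forall x, cintble m2 (fun y => f (x, y)), forall y, cintble m1 (fun x => f (x, y)),
   cintble m1 (fun x => cintegral m2 (fun y => f (x, y))),
   cintble m2 (fun y => cintegral m1 (fun x => f (x, y)))
   & cintegral m1 (fun x => cintegral m2 (fun y => f (x, y))) =
     cintegral m2 (fun y => cintegral m1 (fun x => f (x, y)))].
Proof.
move=> [mf1 mf2] fab.
have [x1 y1 X1 Y1 e1] := @rfubini (fun z => re (f z)) mf1
  (fun x y => le_trans (re_le_n1 _) (fab x y)).
have [x2 y2 X2 Y2 e2] := @rfubini (fun z => im (f z)) mf2
  (fun x y => le_trans (im_le_n1 _) (fab x y)).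
by split => //; apply: complex_eqP.
Qed.

End DominatedFubini.

Section Caratheodory.
Context d (T : measurableType d) (R : realType).

(** Rounding the first argument down to the grid of step 1/(n+1) gives functions whose preimages are
    countable unions of rectangles; continuity in that argument makes them converge pointwise. *)
Lemma measurable_caratheodory (f : R -> T -> R) :
  (forall x, measurable_fun setT (f x)) -> (forall w, continuous (f^~ w)) ->
  measurable_fun setT (fun p : R * T => f p.1 p.2).
Proof.
move=> mf cf.
pose q n (x : R) : R := (Num.floor (n.+1%:R * x))%:~R / n.+1%:R.
apply: (@measurable_fun_cvg _ _ _ _ (fun n (p : R * T) => f (q n p.1) p.2)).
  move=> n _ B mB; rewrite setTI.
  pose A (k : int) := [set x : R | Num.floor (n.+1%:R * x) = k].
  have mA k : measurable (A k).
    rewrite (_ : A k = `[k%:~R / n.+1%:R, (k + 1)%:~R / n.+1%:R[%classic) //.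
    apply/seteqP; split => x; rewrite /A /= in_itv /= ler_pdivrMr// ltr_pdivlMr// mulrC.
      by move=> <-; rewrite floor_itv.
    exact: floor_def.
  rewrite (_ : _ @^-1` B = \bigcup_k (A k `*` (f (k%:~R / n.+1%:R) @^-1` B))).
    apply: countable_bigcupT_measurable; first exact: countableP.
    by move=> k; apply: measurableX => //; rewrite -[X in measurable X]setTI; exact: mf.
  apply/seteqP; split => [[x w] /= Bx|[x w] [k _ [/= <- Bx]]//].
  by exists (Num.floor (n.+1%:R * x)).
move=> [x w] _ /=.
have qx : q n x @[n --> \oo] --> x.
  apply: (@squeeze_cvgr _ _ _ _ (fun n => x - n.+1%:R^-1) (fun=> x)).
  - apply: nearW => n; rewrite /q.
    rewrite lerBlDr -[X in _ + X]mul1r -mulrDl ler_pdivlMr// mulrC ltW//=.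
      by rewrite ler_pdivrMr// [leRHS]mulrC floor_le.
    by have := floorD1_gt (n.+1%:R * x); rewrite intrD.
  - rewrite -[X in _ --> X]subr0; apply: cvgB; first exact: cvg_cst.
    exact: cvg_harmonic.
  - exact: cvg_cst.
exact: (cvg_comp _ _ qx (cf w x)).
Qed.

End Caratheodory.

Lemma pushforward_measure d1 d2 (T1 : measurableType d1) (T2 : measurableType d2)
    (R : realType) (mu : {measure set T1 -> \bar R}) (phi : T1 -> T2) :
  measurable_fun setT phi ->
  {pm : {measure set T2 -> \bar R} | (pm : set T2 -> \bar R) = pushforward mu phi}.
Proof. by move=> mphi; unshelve eexists; [exact: (pushforward mu phi)|]. Qed.

Notation plane R := (measurableTypeR R * measurableTypeR R)%type.

Section Lebesgue2.
Variable R : realType.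
Implicit Types (x r h : plane R) (f g : plane R -> R).

(* [lebesgue2] with a sigma-finite structure, for Fubini. *)
Definition leb2 : set (plane R) -> \bar R :=
  (@lebesgue_measure R \x @lebesgue_measure R)%E.
HB.instance Definition _ := Measure.on leb2.

Lemma leb2_sigma_finite : sigma_finite setT leb2.
Proof.
pose I n : set (measurableTypeR R) := `]-(n%:R : R), n%:R]%classic.
exists (fun n => I n `*` I n).
  apply/seteqP; split=> // -[a b] _ /=.
  exists (Num.bound (Num.max `|a| `|b|)) => //=.
  have ab : Num.max `|a| `|b| < (Num.bound (Num.max `|a| `|b|))%:R.
    by rewrite archi_boundP// le_max normr_ge0.
  move: ab; rewrite gt_max => /andP[/ltr_normlP[a1 a2] /ltr_normlP[b1 b2]].
  rewrite /I /=; split; rewrite in_itv /= ltrNl (ltW _)// ?a1 ?b1//=.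
move=> n; have mI : measurable (I n) by exact: measurable_itv.
split; first exact: measurableX.
rewrite /leb2/= product_measure1E//= !lebesgue_measure_itv/=.
by case: ifPn => _; rewrite -?EFinB ?mule0 -?EFinM ltry.
Qed.

HB.instance Definition _ :=
  Measure_isSigmaFinite.Build _ _ _ leb2 leb2_sigma_finite.

(** Uniqueness of Lebesgue measure: the scaled pushforward agrees with it on half-open intervals. A
    negative slope swaps the two ends and the side on which the preimage is closed. *)
Lemma lebesgue_affine (a h : R) (A : set (measurableTypeR R)) : a != 0 -> measurable A ->
  (`|a|%:E * lebesgue_measure ((fun t : measurableTypeR R => (a * t + h)%R) @^-1` A) =
   lebesgue_measure A)%E.
Proof.
move=> a0 mA.
have mphi : measurable_fun setT (fun t : measurableTypeR R => (a * t + h : measurableTypeR R)).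
  by apply: measurable_funD => //; apply: measurable_funM.
have [pm pmE] := pushforward_measure lebesgue_measure mphi.
transitivity (mscale `|a|%:nng pm A); first by rewrite /mscale pmE.
apply/esym/lebesgue_measure_unique => // _ [[c d'] _ <-].
rewrite /= /mscale pmE /pushforward /=.
have [agt|alt|aE] := ltrgtP a 0; last by rewrite aE eqxx in a0.
- rewrite (_ : _ @^-1` _ = `[(d' - h) / a, (c - h) / a[%classic); last first.
    apply/seteqP; split => t; rewrite /= !in_itv /= ler_ndivrMr// ltr_ndivlMr//;
      rewrite ltrBlDr lerBrDr (mulrC t) andbC//.
  rewrite !lebesgue_measure_itv /= !lte_fin ltr_nM2r ?invr_lt0// ltrD2r.
  case: ifPn => _; rewrite ?mule0// -!EFinB -EFinM ?(ltr0_norm agt) ?(gtr0_norm alt); congr EFin; field; exact: a0.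
- rewrite (_ : _ @^-1` _ = `](c - h) / a, (d' - h) / a]%classic); last first.
    apply/seteqP; split => t; rewrite /= !in_itv /= ltr_pdivrMr// ler_pdivlMr//;
      rewrite ltrBlDr lerBrDr (mulrC t)//.
  rewrite !lebesgue_measure_itv /= !lte_fin ltr_pM2r ?invr_gt0// ltrD2r.
  case: ifPn => _; rewrite ?mule0// -!EFinB -EFinM ?(ltr0_norm agt) ?(gtr0_norm alt); congr EFin; field; exact: a0.
Qed.

Definition affine2 (a : R) h (u : plane R) : plane R := scale2 a u + h.

Lemma measurable_affine2 (a : R) h : measurable_fun setT (affine2 a h).
Proof.
apply/measurable_fun_pairP; split.
  apply: measurable_funD => //; apply: measurable_funM => //; exact: measurable_fst.
apply: measurable_funD => //; apply: measurable_funM => //; exact: measurable_snd.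
Qed.

Lemma leb2_affine (a : R) h (A : set (plane R)) : a != 0 -> measurable A ->
  leb2 A = ((a ^+ 2)%:E * leb2 (affine2 a h @^-1` A))%E.
Proof.
move=> a0 mA; have a2 : 0 <= a ^+ 2 by exact: sqr_ge0.
have [pm pmE] := pushforward_measure leb2 (measurable_affine2 a h).
transitivity (mscale (NngNum a2) pm A); last by rewrite /mscale pmE.
apply: (@product_measure_unique _ _ _ _ _ lebesgue_measure lebesgue_measure) => //.
move=> B C mB mC; rewrite /= /mscale pmE /pushforward /=.
rewrite (_ : _ @^-1` _ = ((fun t : measurableTypeR R => (a * t + h.1)%R) @^-1` B) `*`
   ((fun t : measurableTypeR R => (a * t + h.2)%R) @^-1` C)) //.
have mp k (D : set (measurableTypeR R)) : measurable D ->
    measurable ((fun t : measurableTypeR R => a * t + k) @^-1` D).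
  move=> mD; rewrite -[X in measurable X]setTI.
  have : measurable_fun setT (fun t : measurableTypeR R => (a * t + k : measurableTypeR R)).
    by apply: measurable_funD => //; apply: measurable_funM.
  exact.
rewrite /leb2 product_measure1E; [|exact: mp..].
rewrite -(lebesgue_affine h.1 a0 mB) -(lebesgue_affine h.2 a0 mC).
rewrite -[a ^+ 2]real_normK ?num_real// expr2 EFinM.
by rewrite muleACA.
Qed.

Lemma rint_affine f (a : R) h : a != 0 -> rintble leb2 f ->
  rintble leb2 (fun u => f (scale2 a u + h)) /\
  \int[leb2]_u f u = a ^+ 2 * \int[leb2]_u f (scale2 a u + h).
Proof.
move=> a0 fi; have mf := rintble_meas fi.
have a2 : 0 <= a ^+ 2 by exact: sqr_ge0.
have a2n : a ^+ 2 != 0 by rewrite sqrf_eq0.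
pose phi : plane R -> plane R := affine2 a h.
have mphi : measurable_fun setT phi by exact: measurable_affine2.
have [pm pmE] := pushforward_measure leb2 mphi.
have lE A : measurable A -> leb2 A = mscale (NngNum a2) pm A.
  by move=> mA; rewrite /mscale pmE /=; exact: leb2_affine.
have ge0E (g : plane R -> \bar R) : measurable_fun setT g -> (forall x, (0 <= g x)%E) ->
    (\int[leb2]_u g u = (a ^+ 2)%:E * \int[leb2]_u g (phi u))%E.
  move=> mg g0.
  rewrite (@eq_measure_integral _ _ _ _ (mscale (NngNum a2) pm)).
    rewrite ge0_integral_mscale//; congr (_ * _)%E.
    by rewrite pmE ge0_integral_pushforward// => x _; exact: g0.
  by move=> A mA _; exact: lE.
have ip g : rintble leb2 g -> rintble leb2 (g \o phi).
  move=> gi; have mg := rintble_meas gi.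
  have mgp : measurable_fun setT (g \o phi) by exact: measurableT_comp.
  apply/integrableP; split; first exact/measurable_EFinP.
  have /integrableP[_] := gi.
  rewrite ge0E//; last by apply: measurableT_comp => //; exact/measurable_EFinP.
  rewrite /comp /=; set J := integral _ _ _.
  by case: J => [r|//|//]; rewrite ?ltry// gt0_muley// lte_fin lt_def a2n.
have E0 g : rintble leb2 g -> (forall x, 0 <= g x) ->
    \int[leb2]_u g u = a ^+ 2 * \int[leb2]_u g (phi u).
  move=> gi g0; rewrite [in LHS]/Rintegral ge0E//.
  - by rewrite fineM//; apply: integrable_fin_num => //; exact: ip.
  - by apply/measurable_EFinP; exact: rintble_meas gi.
split; first exact: ip.
(* The formula for nonnegative functions extends to [g], the difference of the nonnegative functions
   [|g| + g] and [|g|]. *)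
have fE (g : plane R -> R) : rintble leb2 g ->
    \int[leb2]_u g u = \int[leb2]_u (`|g u| + g u) - \int[leb2]_u `|g u|.
  move=> gi; rewrite -RintegralB//; [|by apply: rintbleD => //; exact: rintble_norm
    |exact: rintble_norm].
  by apply: eq_Rintegral => x _; rewrite addrC addKr.
rewrite fE// (fE (fun u => f (phi u))); last exact: ip.
rewrite mulrBr; congr (_ - _); apply: (E0 (fun u => _)).
- by apply: rintbleD => //; exact: rintble_norm.
- by move=> x; rewrite -lerBlDr sub0r -normrN ler_norm.
- exact: rintble_norm.
- by [].
Qed.

Lemma cint_affine (f : R * R -> R[i]) (a : R) h : a != 0 -> cintble leb2 f ->
  cintble leb2 (fun u => f (scale2 a u + h)) /\
  cintegral leb2 f = (a ^+ 2)%:C * cintegral leb2 (fun u => f (scale2 a u + h)).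
Proof.
move=> a0 [f1 f2]; have [i1 e1] := rint_affine h a0 f1.
have [i2 e2] := rint_affine h a0 f2.
by split => //; apply: complex_eqP; rewrite !reimE /= ?e1 ?e2; ring.
Qed.

End Lebesgue2.

(** * Partial derivatives and integration *)

Section Weight.
Variable R : realType.
Implicit Types (x r h : plane R) (t : R).

(** Derivative of the arctangent. Its tensor square [weight] is the integrable majorant on the
    plane; unlike a radial weight it factors over the coordinates, so its bounds reduce to one
    variable. *)
Definition w1 t : R := (1 + t ^+ 2)^-1.
Definition weight x : R := w1 x.1 * w1 x.2.

Lemma w1D_gt0 t : 0 < 1 + t ^+ 2.
Proof. by rewrite ltr_pwDl// sqr_ge0. Qed.
Lemma w1_gt0 t : 0 < w1 t. Proof. by rewrite invr_gt0 w1D_gt0. Qed.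
Lemma w1_le1 t : w1 t <= 1.
Proof. by rewrite invf_le1 ?w1D_gt0// lerDl sqr_ge0. Qed.
Lemma weight_gt0 x : 0 < weight x. Proof. by rewrite mulr_gt0 ?w1_gt0. Qed.
Lemma weight_ge0 x : 0 <= weight x. Proof. exact/ltW/weight_gt0. Qed.
Lemma weight_le1 x : weight x <= 1.
Proof. by rewrite mulr_ile1 ?w1_le1// ltW// w1_gt0. Qed.
Lemma weight_sqr_le x : weight x ^+ 2 <= weight x.
Proof. by rewrite expr2 ler_piMr ?weight_ge0 ?weight_le1. Qed.

Lemma weightM x c : c * (((1 + x.1 ^+ 2) * (1 + x.2 ^+ 2)) * weight x) = c.
Proof.
rewrite /weight /w1; have := w1D_gt0 x.1; have := w1D_gt0 x.2 => h1 h2.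
by field; rewrite !gt_eqF.
Qed.

Lemma le_weight x (a C : R) : (1 + x.1 ^+ 2) * (1 + x.2 ^+ 2) * a <= C -> a <= C * weight x.
Proof.
move=> h; have -> : a = (1 + x.1 ^+ 2) * (1 + x.2 ^+ 2) * a * weight x.
  by rewrite -[LHS](weightM x); ring.
by rewrite ler_wpM2r ?weight_ge0.
Qed.

Lemma rintble_w1 : rintble (@lebesgue_measure R) w1.
Proof.
have mw : measurable_fun setT w1.
  by apply: continuous_measurable_fun; exact: continuous_oneDsqrV.
apply/integrableP; split; first exact/measurable_EFinP.
under eq_integral do rewrite /= ger0_norm ?(ltW (w1_gt0 _))//.
rewrite ge0_symfun_integralT.
- rewrite (_ : [set x | _] = `[0%R, +oo[%classic); last first.
    by apply/seteqP; split => x /=; rewrite in_itv /= andbT.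
  by rewrite [X in (_ * X)%E]integral0y_oneDsqr -EFinM ltry.
- by move=> x; exact/ltW/w1_gt0.
- exact: continuous_oneDsqrV.
- by move=> x; rewrite /w1 /= sqrrN.
Qed.

Lemma rintble_weight : rintble (@leb2 R) weight.
Proof.
exact: (rintble_prod rintble_w1 rintble_w1 (fun t => ltW (w1_gt0 t)) (fun t => ltW (w1_gt0 t))).
Qed.

(** From [t ^+ 2 <= 2 * (t + s) ^+ 2 + 2 * s ^+ 2] and [s ^+ 2 <= 1]. *)
Lemma w1_shift t s : `|s| <= 1 -> w1 (t + s) <= 3 * w1 t.
Proof.
move=> /ler_normlP[s1 s2].
rewrite ler_pdivlMr ?w1D_gt0// mulrC ler_pdivrMr ?w1D_gt0//.
have := sqr_ge0 (t + s); have := sqr_ge0 (t + 2 * s); nra.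
Qed.

Lemma weight_shift x h : `|h.1| <= 1 -> `|h.2| <= 1 -> weight (x + h) <= 9 * weight x.
Proof.
move=> h1 h2; have -> : 9 * weight x = (3 * w1 x.1) * (3 * w1 x.2) by rewrite /weight; ring.
by apply: ler_pM; rewrite ?(ltW (w1_gt0 _))//=; exact: w1_shift.
Qed.

(** From [s = t - (t - s)], hence [s ^+ 2 <= 2 * t ^+ 2 + 2 * (t - s) ^+ 2]. *)
Lemma w1_conv t s : w1 (t - s) * w1 t <= 2 * w1 s.
Proof.
rewrite /w1 -invfM ler_pdivlMr ?w1D_gt0// mulrC ler_pdivrMr ?mulr_gt0 ?w1D_gt0//.
have := sqr_ge0 (2 * t - s); have := mulr_ge0 (sqr_ge0 (t - s)) (sqr_ge0 t); nra.
Qed.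

(** Puts the integrand of an autocorrelation in the product form that [cfubini] demands. One factor
    of each square is traded for decay in [r]; of the remaining two, [weight x] is kept and
    [weight (x - r)] is bounded by 1. *)
Lemma weight_conv x r : weight (x - r) ^+ 2 * weight x ^+ 2 <= 4 * weight r * weight x.
Proof.
have -> : weight (x - r) ^+ 2 * weight x ^+ 2 =
   (weight (x - r) * weight x) * weight x * weight (x - r) by ring.
rewrite (le_trans (_ : _ <= weight (x - r) * weight x * weight x * 1))//.
  apply: ler_wpM2l; last exact: weight_le1.
  by apply: mulr_ge0; [apply: mulr_ge0|]; exact: weight_ge0.
rewrite mulr1 ler_wpM2r ?weight_ge0//.
have -> : 4 * weight r = (2 * w1 r.1) * (2 * w1 r.2) by rewrite /weight; ring.
rewrite /weight /=.
have -> : w1 (x.1 - r.1) * w1 (x.2 - r.2) * (w1 x.1 * w1 x.2) =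
  (w1 (x.1 - r.1) * w1 x.1) * (w1 (x.2 - r.2) * w1 x.2) by ring.
by apply: ler_pM; rewrite ?mulr_ge0 ?(ltW (w1_gt0 _))//; exact: w1_conv.
Qed.

End Weight.

Section PartialDerivatives.
Variable R : realType.
Implicit Types (x : plane R) (f g : plane R -> R) (t s : R) (b : bool).

Definition upd b x t : plane R := if b then (x.1, t) else (t, x.2).
Definition crd b x : R := if b then x.2 else x.1.

Lemma upd_crd b x : upd b x (crd b x) = x.
Proof. by case: b; case: x. Qed.
Lemma crd_upd b x t : crd b (upd b x t) = t.
Proof. by case: b. Qed.
Lemma upd_upd b x t s : upd b (upd b x t) s = upd b x s.
Proof. by case: b. Qed.
Lemma updE b x t : upd b x t = x + upd b 0 (t - crd b x).
Proof.
by case: b; case: x => x1 x2; rewrite /upd /crd /=;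
  apply/pair_equal_spec; split; rewrite /= ?addr0// addrC subrK.
Qed.
Lemma upd_small b s : `|s| <= 1 -> `|(upd b 0 s).1| <= 1 /\ `|(upd b 0 s).2| <= 1.
Proof. by case: b => hs; rewrite /= normr0. Qed.
Lemma upd_shift b x s : upd b x (crd b x + s) = affine2 1 (upd b 0 s) x.
Proof. by case: b; case: x => u v; rewrite /affine2 /scale2 /= /upd /=;
  apply/pair_equal_spec; split; rewrite /= !mul1r ?addr0. Qed.

(** Differentiability along the lines of one coordinate only. This suffices for the mean value
    theorem and for difference quotients, and it passes through integrals without any joint
    differentiability. *)
Definition rder b f f' := forall x,
  is_derive (crd b x) 1 (fun t => f (upd b x t)) (f' x).

Lemma rder_slice b f f' x t : rder b f f' ->
  is_derive t 1 (fun s => f (upd b x s)) (f' (upd b x t)).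
Proof.
move=> /(_ (upd b x t)); rewrite crd_upd.
by under eq_fun do rewrite upd_upd.
Qed.

Lemma rder_continuous b f f' x : rder b f f' -> continuous (fun t => f (upd b x t)).
Proof.
move=> h t; apply: differentiable_continuous; apply/derivable1_diffP.
by have [] := rder_slice x t h.
Qed.

Lemma rder_mvt b f f' x t s (C : R) : rder b f f' ->
  (forall u, `|u - t| <= `|s - t| -> `|f' (upd b x u)| <= C) ->
  `|f (upd b x s) - f (upd b x t)| <= C * `|s - t|.
Proof.
move=> h hC.
have gen a c : a <= c -> (forall u, u \in `[a, c] -> `|f' (upd b x u)| <= C) ->
    `|f (upd b x c) - f (upd b x a)| <= C * `|c - a|.
  move=> ac hac.
  have [||u uac ->] := @MVT_segment R (fun t => f (upd b x t)) (fun t => f' (upd b x t)) a c ac.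
  - by move=> u _; exact: rder_slice.
  - by apply: continuous_subspaceT; exact: (@rder_continuous b f f' x h).
  by rewrite normrM ler_wpM2r// hac.
have [st|ts] := leP s t.
  rewrite distrC (distrC s); apply: gen => // u; rewrite in_itv /= => /andP[u1 u2].
  by apply: hC; rewrite !ler0_norm ?subr_le0//; lra.
apply: gen; first exact: ltW.
move=> u; rewrite in_itv /= => /andP[u1 u2].
by apply: hC; rewrite !ger0_norm ?subr_ge0//; lra.
Qed.

(** Separate continuity in the two coordinates is enough, by [measurable_caratheodory]. *)
Lemma rder_meas f : (forall b, exists f', rder b f f') -> measurable_fun setT f.
Proof.
move=> hf.
have mf : measurable_fun setT (fun p : R * R => f (p.1, p.2)).
  apply: (@measurable_caratheodory _ _ _ (fun x1 x2 : R => f (x1, x2))) => [x1|x2].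
    have [f' h] := hf true.
    by apply: continuous_measurable_fun => t; exact: (@rder_continuous true f f' (x1, 0) h).
  by have [f' h] := hf false; exact: (@rder_continuous false f f' (0, x2) h).
by have -> : f = fun p => f (p.1, p.2) by apply/funext => -[].
Qed.

Definition dquot b f (n : nat) x : R := n.+1%:R * (f (upd b x (crd b x + n.+1%:R^-1)) - f x).

Lemma dquot_cvg b f f' x : rder b f f' -> dquot b f n x @[n --> \oo] --> f' x.
Proof.
move=> /(_ x) [+ <-]; rewrite /derivable => /cvgr_dnbhsP /(_ (fun n => n.+1%:R^-1)).
have hn : (forall n : nat, n.+1%:R^-1 != 0 :> R) /\ n.+1%:R^-1 @[n --> \oo] --> (0 : R).
  by split => [n|]; [rewrite invr_eq0|exact: cvg_harmonic].
move=> /(_ hn).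
rewrite /derive; set l := lim _.
have -> // : (fun n => dquot b f n x) = (fun n => n.+1%:R^-1^-1 *:
  (((fun t => f (upd b x t)) \o shift (crd b x)) n.+1%:R^-1%:A - f (upd b x (crd b x)))).
by apply/funext => n; rewrite /dquot /GRing.scale /= invrK mulr1 upd_crd (addrC _ (crd b x)).
Qed.

Lemma dquot_meas b f n : measurable_fun setT f -> measurable_fun setT (dquot b f n).
Proof.
move=> mf; apply: measurable_funM => //; apply: measurable_funB => //.
under eq_fun do rewrite upd_shift.
apply: (measurableT_comp mf); exact: measurable_affine2.
Qed.

Lemma rder_meas' b f f' : measurable_fun setT f -> rder b f f' -> measurable_fun setT f'.
Proof.
move=> mf h; apply: (@measurable_fun_cvg _ _ _ _ (dquot b f)).
  by move=> n; exact: dquot_meas.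
by move=> x _; exact: dquot_cvg.
Qed.

(* Each difference quotient of [f] integrates to 0 by translation invariance. *)
Lemma rder_int0 b f f' (C : R) : measurable_fun setT f -> rder b f f' ->
  (forall x, `|f x| <= C * weight x) -> (forall x, `|f' x| <= C * weight x) ->
  \int[@leb2 R]_x f' x = 0.
Proof.
move=> mf h fC f'C.
have fi : rintble (@leb2 R) f.
  by apply: rintble_le fC => //; apply: rintbleZ; exact: rintble_weight.
have C0 : 0 <= C.
  have := le_trans (normr_ge0 _) (fC 0).
  by rewrite pmulr_lge0// weight_gt0.
(* The mean value theorem moves the bound on [f'] to a point at distance at most 1, which costs the
   factor 9 of [weight_shift]. *)
have dC n x : `|dquot b f n x| <= 9 * C * weight x.
  have e : f x = f (upd b x (crd b x)) by rewrite upd_crd.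
  have es : crd b x + n.+1%:R^-1 - crd b x = n.+1%:R^-1 by rewrite addrAC subrr add0r.
  rewrite /dquot normrM e.
  have n0 : 0 < n.+1%:R^-1 :> R by rewrite invr_gt0.
  have n1 : n.+1%:R^-1 <= 1 :> R by rewrite invf_le1// ler1n.
  have := @rder_mvt b f f' x (crd b x) (crd b x + n.+1%:R^-1) (9 * C * weight x) h.
  rewrite es (gtr0_norm n0) => hm.
  rewrite (@ger0_norm _ n.+1%:R)// mulrC -ler_pdivlMr// hm// => u hu.
  rewrite (le_trans (f'C _))// updE//.
  rewrite (mulrC 9) -mulrA ler_wpM2l//.
  have [u1 u2] := upd_small b (le_trans hu n1).
  exact: weight_shift.
have [_] := @rint_cvg _ _ _ (@leb2 R) (dquot b f) f' (fun x => 9 * C * weight x)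
  (fun n => dquot_meas b n mf) (fun x => @dquot_cvg b f f' x h)
  (rintbleZ (9 * C) (rintble_weight R)) dC.
rewrite (_ : (fun n => _) = cst 0); first by move=> hh; exact: (cvg_unique _ hh (cvg_cst _)).
apply/funext => n /=; rewrite /dquot.
under eq_Rintegral do rewrite upd_shift.
have [ia ea] := rint_affine (upd b 0 n.+1%:R^-1) (oner_neq0 _) fi.
rewrite RintegralZl// ?RintegralB//; last exact: rintbleB.
by rewrite [X in _ - X]ea expr1n mul1r subrr mulr0.
Qed.

Lemma der_int d (T : measurableType d) (mu : {measure set T -> \bar R})
    (F F' : R -> T -> R) (G : T -> R) :
  (forall t, rintble mu (F t)) -> (forall t y, is_derive t 1 (F^~ y) (F' t y)) ->
  rintble mu G -> (forall t y, `|F' t y| <= G y) ->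
  forall t, is_derive t 1 (fun t => \int[mu]_y F t y) (\int[mu]_y F' t y).
Proof.
move=> iF dF iG hG t.
have d1E s y : partial1of2 F s y = F' s y.
  by rewrite partial1of2E; have [] := dF s y.
have tI : `]t - 1, t + 1[%classic t by rewrite /= in_itv /=; apply/andP; split; lra.
have G0 y : 0 <= G y by rewrite (le_trans _ (hG t y)).
have h1 (x : R) y : `]t - 1, t + 1[%classic x -> [set: T] y -> derivable (F^~ y) x 1.
  by move=> _ _; have [] := dF x y.
have h2 (x : R) y : `]t - 1, t + 1[%classic x -> [set: T] y -> `|partial1of2 F x y| <= G y.
  by move=> _ _; rewrite d1E.
have iF' (x : R) : `]t - 1, t + 1[%classic x -> mu.-integrable setT (EFin \o F x).
  by move=> _; exact: iF.
split; first exact: (derivable_under_integral measurableT tI iF' h1 G0 iG h2).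
rewrite -derive1E (differentiation_under_integral measurableT tI iF' h1 G0 iG h2).
by apply: eq_Rintegral => y _; rewrite -/(partial1of2 F t y) d1E.
Qed.

Lemma rder_int d (T : measurableType d) (mu : {measure set T -> \bar R}) b
    (F F' : plane R -> T -> R) (G : T -> R) :
  (forall x, rintble mu (F x)) -> (forall y, rder b (F^~ y) (F'^~ y)) ->
  rintble mu G -> (forall x y, `|F' x y| <= G y) ->
  rder b (fun x => \int[mu]_y F x y) (fun x => \int[mu]_y F' x y).
Proof.
move=> iF dF iG hG x.
have := @der_int _ _ mu (fun t => F (upd b x t)) (fun t => F' (upd b x t)) G
  (fun t => iF _) (fun t y => rder_slice x t (dF y)) iG (fun t => hG _) (crd b x).
by rewrite upd_crd.
Qed.

Lemma rder_ext b f f' g g' : rder b f f' -> f =1 g -> f' =1 g' -> rder b g g'.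
Proof. by move=> h /funext <- /funext <-. Qed.

Lemma rder_cst b (c : R) : rder b (fun=> c) (fun=> 0).
Proof. by move=> x; exact: is_derive_cst. Qed.

Lemma rderD b f f' g g' : rder b f f' -> rder b g g' ->
  rder b (fun x => f x + g x) (fun x => f' x + g' x).
Proof. by move=> hf hg x; apply: is_deriveD. Qed.

Lemma rderN b f f' : rder b f f' -> rder b (fun x => - f x) (fun x => - f' x).
Proof. by move=> hf x; apply: is_deriveN. Qed.

Lemma rderM b f f' g g' : rder b f f' -> rder b g g' ->
  rder b (fun x => f x * g x) (fun x => f' x * g x + f x * g' x).
Proof.
move=> hf hg x; apply: is_derive_eq; first exact: (is_deriveM (hf x) (hg x)).
by rewrite /GRing.scale /= !upd_crd; ring.
Qed.

Lemma rder_comp b f f' (h h' : R -> R) : rder b f f' ->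
  (forall t, is_derive t 1 h (h' t)) ->
  rder b (fun x => h (f x)) (fun x => h' (f x) * f' x).
Proof.
move=> hf hh x; have hh' := hh (f (upd b x (crd b x))).
apply: is_derive_eq; first exact: (is_derive1_comp hh' (hf x)).
by rewrite upd_crd mulrC.
Qed.

Lemma rder_crd b c : rder b (crd c) (fun=> (b == c)%:R).
Proof.
move=> x; case: b; case: c; rewrite /crd /upd /=;
  (exact: is_derive_cst || exact: is_derive_id).
Qed.

Lemma rder0_cst f : (forall b, rder b f (fun=> 0)) -> forall x y, f x = f y.
Proof.
move=> h [x1 x2] [y1 y2]; transitivity (f (x1, y2)).
  have := @is_derive_0_is_cst R (fun t => f (upd true (x1, x2) t)) x2 y2.
  by apply => t; exact: (rder_slice (x1, x2) t (h true)).
have := @is_derive_0_is_cst R (fun t => f (upd false (x1, y2) t)) x1 y1.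
by apply => t; exact: (rder_slice (x1, y2) t (h false)).
Qed.

End PartialDerivatives.

Section ComplexPartialDerivatives.
Variable R : realType.
Implicit Types (x : plane R) (f g : plane R -> R[i]) (t s : R) (b : bool).

Definition pder b f f' := rder b (fun x => re (f x)) (fun x => re (f' x)) /\
  rder b (fun x => im (f x)) (fun x => im (f' x)).

Lemma pder_ext b f f' g g' : pder b f f' -> f =1 g -> f' =1 g' -> pder b g g'.
Proof. by move=> h /funext <- /funext <-. Qed.

Lemma pder_cst b c : pder b (fun=> c) (fun=> 0).
Proof. by split; exact: rder_cst. Qed.

Lemma pder_real b (f f' : plane R -> R) :
  rder b f f' -> pder b (fun x => (f x)%:C) (fun x => (f' x)%:C).
Proof. by split => //=; exact: rder_cst. Qed.

Lemma pderD b f f' g g' : pder b f f' -> pder b g g' ->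
  pder b (fun x => f x + g x) (fun x => f' x + g' x).
Proof.
move=> [f1 f2] [g1 g2]; split.
  by apply: (rder_ext (rderD f1 g1)) => x; rewrite reD.
by apply: (rder_ext (rderD f2 g2)) => x; rewrite imD.
Qed.

Lemma pderM b f f' g g' : pder b f f' -> pder b g g' ->
  pder b (fun x => f x * g x) (fun x => f' x * g x + f x * g' x).
Proof.
move=> [f1 f2] [g1 g2]; split.
- by apply: (rder_ext (rderD (rderM f1 g1) (rderN (rderM f2 g2)))) => x;
    rewrite !reimE; ring.
- by apply: (rder_ext (rderD (rderM f1 g2) (rderM f2 g1))) => x; rewrite !reimE; ring.
Qed.

Lemma pderZ b c f f' : pder b f f' -> pder b (fun x => c * f x) (fun x => c * f' x).
Proof.
move=> h; apply: (pder_ext (pderM (pder_cst b c) h)) => // x.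
by rewrite mul0r add0r.
Qed.

Lemma pder_crd b c : pder b (fun x => (crd c x)%:C) (fun=> (b == c)%:R%:C).
Proof. exact: pder_real (rder_crd b c). Qed.

Lemma pder_cis b (f f' : plane R -> R) : rder b f f' ->
  pder b (fun x => cis (f x)) (fun x => 'i%C * (f' x)%:C * cis (f x)).
Proof.
move=> h; split.
- by apply: (rder_ext (rder_comp h (fun t => is_derive_cos t))) => // x;
    rewrite !reimE /=; ring.
- by apply: (rder_ext (rder_comp h (fun t => is_derive_sin t))) => // x;
    rewrite !reimE /=; ring.
Qed.

Lemma pder_cexp b f f' : pder b f f' ->
  pder b (fun x => cexp (f x)) (fun x => f' x * cexp (f x)).
Proof.
move=> [h1 h2].
have e := rder_comp h1 (fun t => is_derive_expR t).
apply: (pder_ext (pderM (pder_real e) (pder_cis h2))) => // x.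
by rewrite /cexp; apply: complex_eqP; rewrite !reimE /=; ring.
Qed.

Lemma pder_meas f : (forall b, exists f', pder b f f') -> cmeas f.
Proof.
move=> h; split; apply: rder_meas => b; have [f' [h1 h2]] := h b.
  by exists (fun x => re (f' x)).
by exists (fun x => im (f' x)).
Qed.

Lemma pder_meas' b f f' : cmeas f -> pder b f f' -> cmeas f'.
Proof. by move=> [m1 m2] [h1 h2]; split; [exact: rder_meas' m1 h1|exact: rder_meas' m2 h2]. Qed.

Lemma pder_int0 b f f' (C : R) : cmeas f -> pder b f f' ->
  (forall x, n1 (f x) <= C * weight x) -> (forall x, n1 (f' x) <= C * weight x) ->
  cintegral (@leb2 R) f' = 0.
Proof.
move=> [m1 m2] [h1 h2] fC f'C; apply: complex_eqP => /=.
  by apply: (rder_int0 m1 h1) => x; rewrite (le_trans (re_le_n1 _)).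
by apply: (rder_int0 m2 h2) => x; rewrite (le_trans (im_le_n1 _)).
Qed.

Lemma pder_int d (T : measurableType d) (mu : {measure set T -> \bar R}) b
    (F F' : plane R -> T -> R[i]) (G : T -> R) :
  (forall x, cintble mu (F x)) -> (forall y, pder b (F^~ y) (F'^~ y)) ->
  rintble mu G -> (forall x y, n1 (F' x y) <= G y) ->
  pder b (fun x => cintegral mu (F x)) (fun x => cintegral mu (F' x)).
Proof.
move=> iF dF iG hG; split => /=.
  apply: (rder_int (fun x => (iF x).1) (fun y => (dF y).1) iG) => x y.
  by rewrite (le_trans (re_le_n1 _)).
apply: (rder_int (fun x => (iF x).2) (fun y => (dF y).2) iG) => x y.
by rewrite (le_trans (im_le_n1 _)).
Qed.

Lemma pder0_cst f : (forall b, pder b f (fun=> 0)) -> forall x y, f x = f y.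
Proof.
move=> h x y; apply: complex_eqP.
  by apply: (@rder0_cst R (fun x => re (f x))) => b; have [] := h b.
by apply: (@rder0_cst R (fun x => im (f x))) => b; have [] := h b.
Qed.

End ComplexPartialDerivatives.

(** * Gaussian integrals *)

Section ProductIntegral.
Context d1 d2 (T1 : measurableType d1) (T2 : measurableType d2) (R : realType).
Variables (m1 : {sigma_finite_measure set T1 -> \bar R})
  (m2 : {sigma_finite_measure set T2 -> \bar R}) (a : T1 -> R) (b : T2 -> R).

Lemma rint_prodM : rintble m1 a -> rintble m2 b ->
  (forall x, 0 <= a x) -> (forall y, 0 <= b y) ->
  fine (\int[(m1 \x m2)%E]_z (a z.1 * b z.2)%:E)%E = (\int[m1]_x a x) * (\int[m2]_y b y).
Proof.
move=> ia ib a0 b0; rewrite -(integral12_prod_meas1 (rintble_prod ia ib a0 b0)) /fubini_F /=.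
rewrite -RintegralZr// /Rintegral; congr fine; apply: eq_integral => x _.
have -> : (\int[m2]_y (a x * b y)%R%:E = \int[m2]_y ((a x)%:E * (b y)%:E))%E.
  by apply: eq_integral => y _; exact: EFinM.
by rewrite integralZl// EFinM fineK//; exact: integrable_fin_num.
Qed.

End ProductIntegral.

Lemma n1_iM (R : realType) (z : R[i]) : n1 ('i%C * z) = n1 z.
Proof. by rewrite /n1 !reimE /= !mul0r !mul1r sub0r add0r normrN addrC. Qed.

Section Gaussian.
Variable R : realType.
Implicit Types (x k : plane R) (p : R[i]) (b : bool) (s t : R).

(** With [u = D * t ^+ 2 / 4] the Gaussian is the inverse of [expR u * expR u], and each factor
    dominates [1 + t ^+ 2] up to the constant because [(1 + 4 / D) * (1 + u) = 1 + t ^+ 2 + u + 4 /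
    D]. *)
Lemma gauss_decay1 (D : R) : 0 < D ->
  exists2 C, 0 < C & forall t, expR (- (D * (t ^+ 2 / 2))) <= C * w1 t ^+ 2.
Proof.
move=> D0; exists ((1 + 4 / D) ^+ 2); first by rewrite exprn_gt0// ltr_pwDl// divr_ge0// ltW.
move=> t; set u := D * t ^+ 2 / 4.
have u0 : 0 <= u by rewrite divr_ge0// mulr_ge0 ?sqr_ge0// ltW.
have c0 : 0 < 1 + 4 / D by rewrite ltr_pwDl// divr_ge0// ltW.
have key : 1 + t ^+ 2 <= (1 + 4 / D) * expR u.
  rewrite (@le_trans _ _ ((1 + 4 / D) * (1 + u)))//; last first.
    by rewrite ler_wpM2l ?expR_ge1Dx// ltW.
  have -> : (1 + 4 / D) * (1 + u) = 1 + t ^+ 2 + (u + 4 / D).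
    by rewrite /u; field; rewrite gt_eqF.
  by rewrite lerDl addr_ge0// divr_ge0// ltW.
have e1 : w1 t * (1 + t ^+ 2) = 1 by rewrite mulVf// gt_eqF// w1D_gt0.
rewrite expRN -[leLHS]mul1r ler_pdivrMr ?expR_gt0//.
have -> : D * (t ^+ 2 / 2) = u + u by rewrite /u; field.
rewrite expRD.
have -> : (1 + 4 / D) ^+ 2 * w1 t ^+ 2 * (expR u * expR u) =
  (w1 t * ((1 + 4 / D) * expR u)) ^+ 2 by ring.
by apply: exprn_ege1; rewrite -[leLHS]e1 ler_wpM2l// ltW// w1_gt0.
Qed.

Lemma gauss_decay (D : R) : 0 < D ->
  exists2 C, 0 < C & forall x, expR (- (D * (sqnorm2 x / 2))) <= C * weight x ^+ 2.
Proof.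
move=> /gauss_decay1[C C0 hC]; exists (C * C); first exact: mulr_gt0.
move=> x; have -> : - (D * (sqnorm2 x / 2)) =
  - (D * (x.1 ^+ 2 / 2)) + - (D * (x.2 ^+ 2 / 2)) by rewrite /sqnorm2 /dot2; ring.
rewrite expRD.
have -> : C * C * weight x ^+ 2 = (C * w1 x.1 ^+ 2) * (C * w1 x.2 ^+ 2).
  by rewrite /weight; ring.
by apply: ler_pM; rewrite ?expR_ge0.
Qed.

Lemma crd_weight b x : (1 + crd b x ^+ 2) * weight x <= 1.
Proof.
have := w1_le1 x.1; have := w1_le1 x.2.
have := w1_gt0 x.1; have := w1_gt0 x.2.
have e t : (1 + t ^+ 2) * w1 t = 1 by rewrite mulfV// gt_eqF// w1D_gt0.
rewrite /weight; case: b => /=.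
  by rewrite mulrCA e mulr1.
by rewrite mulrA e mul1r.
Qed.

Definition gau p x : R[i] := cexp (- p * (sqnorm2 x / 2)%:C).

Lemma n1_gau p x : n1 (gau p x) <= 2 * expR (- (re p * (sqnorm2 x / 2))).
Proof. by rewrite (le_trans (n1_cexp _))// !reimE /= mulr0 subr0 mulNr. Qed.

Lemma rder_sqnorm2 b : rder b (fun x => sqnorm2 x / 2) (fun x => crd b x).
Proof.
have h c := rderM (rderM (@rder_crd R b c) (rder_crd b c)) (rder_cst b 2^-1).
apply: (rder_ext (rderD (h false) (h true))) => x.
  by rewrite /sqnorm2 /dot2 /=; ring.
by case: b {h} => /=; field.
Qed.

Lemma rder_dot2 b k : rder b (dot2 k) (fun=> crd b k).
Proof.
have h c := rderM (rder_cst b (crd c k)) (@rder_crd R b c).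
apply: (rder_ext (rderD (h false) (h true))) => x //.
by case: b {h} => /=; ring.
Qed.

Lemma dot2C x k : dot2 x k = dot2 k x.
Proof. by rewrite /dot2; ring. Qed.

Lemma pder_gau b p : pder b (gau p) (fun x => - p * (crd b x)%:C * gau p x).
Proof. exact: pder_cexp (pderZ (- p) (pder_real (rder_sqnorm2 b))). Qed.

Definition gk p k x := cis (dot2 k x) * gau p x.

Lemma pder_gk b p k :
  pder b (gk p k) (fun x => ('i%C * (crd b k)%:C - p * (crd b x)%:C) * gk p k x).
Proof.
apply: (pder_ext (pderM (pder_cis (rder_dot2 b k)) (pder_gau b p))) => // x.
by rewrite /gk; ring.
Qed.

Lemma gau_meas p : cmeas (gau p).
Proof. by apply: pder_meas => b; eexists; exact: pder_gau. Qed.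

Lemma gk_meas p k : cmeas (gk p k).
Proof. by apply: pder_meas => b; eexists; exact: pder_gk. Qed.

Lemma crd_meas b : cmeas (fun x => (crd b x)%:C).
Proof. by apply: pder_meas => c; eexists; exact: pder_crd. Qed.

(** The Gaussian decays like the square of [weight]: one factor pays for a polynomial of degree at
    most two in a coordinate, the other remains as the majorant. *)
Lemma gau_bound p : 0 < re p -> exists C, [/\ 0 <= C,
  forall x, n1 (gau p x) <= C * weight x,
  forall b x, n1 ((crd b x)%:C * gau p x) <= C * weight x &
  forall b x, n1 ((crd b x)%:C * ((crd b x)%:C * gau p x)) <= C * weight x].
Proof.
move=> /gauss_decay[C C0 hC]; exists (2 * C).
have h0 x (a : R) : 0 <= a -> a <= 1 + crd true x ^+ 2 \/ a <= 1 + crd false x ^+ 2 ->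
    a * n1 (gau p x) <= 2 * C * weight x.
  move=> a0 ha.
  have aw : a * weight x <= 1.
    by case: ha => ha; apply: le_trans (crd_weight _ x);
      apply: ler_wpM2r ha; exact: weight_ge0.
  rewrite (@le_trans _ _ (a * (2 * (C * weight x ^+ 2))))//.
    by rewrite ler_wpM2l// (le_trans (n1_gau _ _))// ler_wpM2l.
  have -> : a * (2 * (C * weight x ^+ 2)) = 2 * C * weight x * (a * weight x) by ring.
  by apply: ler_piMr aw; apply: mulr_ge0; [rewrite mulr_ge0// ltW|exact: weight_ge0].
have sq (c : R) : `|c| <= 1 + c ^+ 2.
  have := sqr_ge0 (c - 1); have := sqr_ge0 (c + 1); case: (ger0P c); nra.
split.
- by rewrite mulr_ge0// ltW.
- by move=> x; rewrite -[n1 _]mul1r h0//; left; rewrite lerDl sqr_ge0.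
- move=> b x; rewrite (le_trans (n1M _ _))// n1_real h0//.
  by case: b; [left|right]; exact: sq.
- move=> b x; rewrite mulrA -rmorphM /= (le_trans (n1M _ _))// n1_real h0//.
  by rewrite -expr2 ger0_norm ?sqr_ge0//; case: b; [left|right]; rewrite lerDr.
Qed.

Lemma gau_int p : 0 < re p -> cintble (@leb2 R) (gau p).
Proof.
move=> /gau_bound[C [C0 h _ _]]; apply: (cintble_le _ _ h); first exact: gau_meas.
by apply: rintbleZ; exact: rintble_weight.
Qed.

Lemma gk_int p k : 0 < re p -> cintble (@leb2 R) (gk p k).
Proof.
move=> p0; apply: (cintbleMb (gau_int p0) _ (fun x => n1_cis _)).
by apply: cmeas_cis; apply: rder_meas => b; eexists; exact: rder_dot2.
Qed.

Lemma crd_gk_int b p k : 0 < re p -> cintble (@leb2 R) (fun x => (crd b x)%:C * gk p k x).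
Proof.
move=> /gau_bound[C [C0 _ h _]].
apply: (@cintble_le _ _ _ _ _ (fun x => 2 * C * weight x)).
- by apply: cmeasM; [exact: crd_meas|exact: gk_meas].
- by apply: rintbleZ; exact: rintble_weight.
- by move=> x; rewrite /gk mulrCA (le_trans (n1_cisM _ _))// -mulrA ler_wpM2l.
Qed.

Lemma crd2_gau_int b p : 0 < re p ->
  cintble (@leb2 R) (fun x => (crd b x)%:C * ((crd b x)%:C * gau p x)).
Proof.
move=> /gau_bound[C [C0 _ _ h]]; apply: (cintble_le _ _ (h b)).
  by do 2 (apply: cmeasM; first exact: crd_meas); exact: gau_meas.
by apply: rintbleZ; exact: rintble_weight.
Qed.

Lemma neq0_re p : 0 < re p -> p != 0.
Proof. by move=> h; apply/eqP => p0; rewrite p0 ltxx in h. Qed.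

(** The integral of a partial derivative of [gk p k] vanishes; this is a linear equation for the
    first moment. *)
Lemma cint_crd_gk b p k : 0 < re p ->
  cintegral (@leb2 R) (fun x => (crd b x)%:C * gk p k x) =
  'i%C * (crd b k)%:C / p * cintegral (@leb2 R) (gk p k).
Proof.
move=> p0; have pn := neq0_re p0.
have [C [C0 h1 h2 _]] := gau_bound p0.
pose C' := 2 * ((n1 ('i%C * (crd b k)%:C) + n1 p + 1) * C).
have CC' : 2 * C <= C'.
  rewrite /C' ler_wpM2l// ler_peMl//.
  by rewrite lerDr addr_ge0 ?n1_ge0.
have := @pder_int0 R b (gk p k) _ C' (gk_meas p k) (pder_gk b p k).
have e : (fun x => ('i%C * (crd b k)%:C - p * (crd b x)%:C) * gk p k x) =
  (fun x => ('i%C * (crd b k)%:C) * gk p k x + (- p) * ((crd b x)%:C * gk p k x)).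
  by apply/funext => x; ring.
rewrite e cintegralD; [|exact: cintbleZ (gk_int k p0)|exact: cintbleZ (crd_gk_int b k p0)].
rewrite !cintegralZ; [|exact: crd_gk_int|exact: gk_int].
move=> h; have : 'i%C * (crd b k)%:C * cintegral (@leb2 R) (gk p k) +
   - p * cintegral (@leb2 R) (fun x => (crd b x)%:C * gk p k x) = 0.
  apply: h => x.
    rewrite (le_trans (n1_cisM _ _))// (@le_trans _ _ (2 * C * weight x))//.
      by rewrite -mulrA ler_wpM2l.
    by rewrite ler_wpM2r// weight_ge0.
  have -> : ('i%C * (crd b k)%:C - p * (crd b x)%:C) * gk p k x = cis (dot2 k x) *
      ('i%C * (crd b k)%:C * gau p x + (- p) * ((crd b x)%:C * gau p x)).
    by rewrite /gk; ring.
  rewrite (le_trans (n1_cisM _ _))//.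
  rewrite /C' -!mulrA ler_wpM2l// (le_trans (n1D _ _))//.
  rewrite (@le_trans _ _ ((n1 ('i%C * (crd b k)%:C) + n1 p) * (C * weight x)))//.
    rewrite mulrDl lerD//.
      by rewrite mulrA (le_trans (n1M _ _))// ler_wpM2l ?n1_ge0.
    by rewrite (le_trans (n1M _ _))// n1N ler_wpM2l ?n1_ge0.
  apply: ler_wpM2r; last by rewrite lerDl.
  by apply: mulr_ge0; [|exact: weight_ge0].
move=> /eqP; rewrite mulNr subr_eq0 => /eqP e'; apply: (mulfI pn); rewrite -e'.
by field.
Qed.

Lemma pder_gk_int b p : 0 < re p ->
  pder b (fun k => cintegral (@leb2 R) (gk p k))
    (fun k => - (crd b k)%:C / p * cintegral (@leb2 R) (gk p k)).
Proof.
move=> p0; have [C [C0 _ h _]] := gau_bound p0.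
have := @pder_int R _ _ (@leb2 R) b (gk p) (fun k x => 'i%C * ((crd b x)%:C * gk p k x))
  (fun x => 2 * C * weight x) (fun k => gk_int k p0).
move=> hh; apply: (pder_ext (hh _ _ _)) => //.
- move=> x; apply: (pder_ext (pderM (pder_cis (rder_dot2 b x)) (pder_cst b (gau p x)))) => k.
    by rewrite /gk dot2C.
  by rewrite mulr0 addr0 /gk (dot2C k); ring.
- by apply: rintbleZ; exact: rintble_weight.
- move=> k x; rewrite /gk !(mulrCA _ (cis _)) (le_trans (n1_cisM _ _))// -mulrA ler_wpM2l//.
  by rewrite n1_iM.
- move=> k; rewrite cintegralZ ?cint_crd_gk//; last exact: crd_gk_int.
  have -> : 'i%C * ('i%C * (crd b k)%:C / p * cintegral (@leb2 R) (gk p k)) =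
    ('i%C * 'i%C) * ((crd b k)%:C / p * cintegral (@leb2 R) (gk p k)) by ring.
  have -> : 'i%C * 'i%C = -1 :> R[i] by apply: complex_eqP; rewrite !reimE /=; ring.
  by ring.
Qed.

(** By [cint_crd_gk] the transform satisfies a linear first-order equation in each coordinate of
    [k]. Multiplied by the inverse of the expected Gaussian it has zero gradient, so it keeps its
    value at 0. *)
Lemma cint_gk p k : 0 < re p ->
  cintegral (@leb2 R) (gk p k) =
  cintegral (@leb2 R) (gau p) * cexp (- (sqnorm2 k / 2)%:C / p).
Proof.
move=> p0.
pose D k := cintegral (@leb2 R) (gk p k) * cexp (p^-1 * (sqnorm2 k / 2)%:C).
have hD : D k = D 0.
  apply: pder0_cst => b.
  apply: (pder_ext (pderM (pder_gk_int b p0)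
    (pder_cexp (pderZ p^-1 (pder_real (rder_sqnorm2 b)))))) => // x.
  by ring.
have D0 : D 0 = cintegral (@leb2 R) (gau p).
  have s0 : sqnorm2 (0 : plane R) = 0 by rewrite /sqnorm2 /dot2 /= mulr0 addr0.
  rewrite /D s0 mul0r mulr0 cexp0 mulr1.
  by apply: eq_cintegral => x; rewrite /gk /dot2 !mul0r addr0 cis0 mul1r.
rewrite -D0 -hD /D -mulrA -cexpD.
by rewrite mulNr (mulrC p^-1) subrr cexp0 mulr1.
Qed.

Lemma cint_sqnorm_gau p : 0 < re p ->
  cintble (@leb2 R) (fun x => (sqnorm2 x)%:C * gau p x) /\
  cintegral (@leb2 R) (fun x => (sqnorm2 x)%:C * gau p x) =
  2 / p * cintegral (@leb2 R) (gau p).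
Proof.
move=> p0; have pn := neq0_re p0.
have [C [C0 h1 h2 h3]] := gau_bound p0.
have e : (fun x => (sqnorm2 x)%:C * gau p x) = (fun x =>
    (crd false x)%:C * ((crd false x)%:C * gau p x) +
    (crd true x)%:C * ((crd true x)%:C * gau p x)).
  by apply/funext => x; rewrite /sqnorm2 /dot2 /crd rmorphD !rmorphM /=; ring.
rewrite e; split; first by apply: cintbleD; exact: crd2_gau_int.
rewrite cintegralD; [|exact: crd2_gau_int..].
have hb b : cintegral (@leb2 R) (fun x => (crd b x)%:C * ((crd b x)%:C * gau p x)) =
    p^-1 * cintegral (@leb2 R) (gau p).
  have hp : pder b (fun x => (crd b x)%:C * gau p x)
      (fun x => gau p x + (- p) * ((crd b x)%:C * ((crd b x)%:C * gau p x))).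
    apply: (pder_ext (pderM (@pder_crd R b b) (pder_gau b p))) => // x.
    by rewrite eqxx (_ : (true%:R : R)%:C = 1)//; ring.
  have := pder_int0 (C := C + n1 p * C) _ hp.
  rewrite cintegralD; [|exact: gau_int|exact: cintbleZ (crd2_gau_int b p0)].
  rewrite cintegralZ; last exact: crd2_gau_int.
  move=> h; have : cintegral (@leb2 R) (gau p) +
    - p * cintegral (@leb2 R) (fun x => (crd b x)%:C * ((crd b x)%:C * gau p x)) = 0.
    apply: h.
    - by apply: cmeasM; [exact: crd_meas|exact: gau_meas].
    - move=> x; rewrite (le_trans (h2 b x))// ler_wpM2r ?weight_ge0// lerDl.
      by rewrite mulr_ge0 ?n1_ge0.
    - move=> x; rewrite (le_trans (n1D _ _))// mulrDl lerD//.
      by rewrite (le_trans (n1M _ _))// n1N -mulrA ler_wpM2l ?n1_ge0.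
  by move=> /eqP; rewrite mulNr subr_eq0 => /eqP ->; rewrite mulKf.
by rewrite !hb; ring.
Qed.

Lemma cint_gau_real (D : R) : 0 < D ->
  cintegral (@leb2 R) (gau D%:C) = (2 * pi / D)%:C.
Proof.
move=> D0.
have gE x : gau D%:C x = (expR (- (D * (sqnorm2 x / 2))))%:C.
  by rewrite /gau -rmorphN -rmorphM /= cexp_real mulNr.
rewrite (eq_cintegral _ gE) cintegral_real; congr (_%:C).
have gi : rintble (@leb2 R) (fun x => expR (- (D * (sqnorm2 x / 2)))).
  have [h _] := gau_int (p := D%:C) D0.
  by under eq_fun do rewrite -[expR _]/(re (_%:C)) -gE.
(* This dilation turns the exponent into minus the squared norm, so the integrand becomes a product
   of two one-dimensional functions [gauss_fun]. *)
have a0 : Num.sqrt (2 / D) != 0 by rewrite gt_eqF// sqrtr_gt0 divr_gt0.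
have [_ ->] := rint_affine 0 a0 gi.
rewrite sqr_sqrtr ?divr_ge0// ?(ltW D0)//.
rewrite (_ : Rintegral _ _ _ = pi); first by field; rewrite gt_eqF.
have gi1 := @integrableT_gauss R.
have iG : \int[lebesgue_measure]_x @gauss_fun R x = Num.sqrt pi.
  by rewrite /Rintegral integralT_gauss.
have := rint_prodM gi1 gi1 (@gauss_fun_ge0 R) (@gauss_fun_ge0 R).
rewrite !iG -expr2 sqr_sqrtr ?pi_ge0// => <-.
rewrite /Rintegral; congr fine; apply: eq_integral => x _; congr EFin.
rewrite /gauss_fun -expRD; congr expR.
rewrite /sqnorm2 /dot2 /scale2 /= !addr0.
have -> : forall c u v : R, D * ((c * u * (c * u) + c * v * (c * v)) / 2) =
   D / 2 * c ^+ 2 * (u ^+ 2 + v ^+ 2) by move=> c u v; field.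
rewrite sqr_sqrtr ?divr_ge0// ?(ltW D0)//.
by field; rewrite gt_eqF.
Qed.

(** In place of a contour deformation: along the line of constant real part through [p], the product
    of the parameter and the integral has derivative 0 by [cint_sqnorm_gau], so it equals its value
    at the real point [re p]. *)
Lemma cint_gau p : 0 < re p -> cintegral (@leb2 R) (gau p) = (2 * pi)%:C / p.
Proof.
move=> p0; have pn := neq0_re p0.
(* The vertical line through [p], parametrized over the plane and constant in the second coordinate,
   so that [pder_int] and [pder0_cst] apply. *)
pose q (y : plane R) : R[i] := (re p)%:C + 'i%C * (crd false y)%:C.
have req y : re (q y) = re p by rewrite !reimE /=; ring.
pose A y := cintegral (@leb2 R) (gau (q y)).
have [C C0 hC] := gauss_decay p0.
have cst0 : forall y z, q y * A y = q z * A z.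
  apply: pder0_cst => b.
  have hq : pder b q (fun=> 'i%C * (b == false)%:R%:C).
    apply: (pder_ext (pderD (pder_cst b _) (pderZ 'i%C (@pder_crd R b false)))) => // y.
    by rewrite add0r.
  have hA : pder b A (fun y => cintegral (@leb2 R)
      (fun x => - ('i%C * (b == false)%:R%:C) * (2^-1)%:C * ((sqnorm2 x)%:C * gau (q y) x))).
    apply: (@pder_int R _ _ (@leb2 R) b (fun y => gau (q y)) _ (fun x => 4 * C * weight x)).
    - by move=> y; apply: gau_int; rewrite req.
    - move=> x; apply: (pder_ext (pder_cexp (pderM (pderZ (-1) hq)
        (pder_cst b (sqnorm2 x / 2)%:C)))) => y; first by rewrite /gau mulN1r.
      rewrite /gau !mulN1r; move: (cexp _) => e.
      by apply: complex_eqP; rewrite !reimE /=; field.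
    - by apply: rintbleZ; exact: rintble_weight.
    - move=> y x; rewrite (le_trans (n1M _ _))//.
      have h1 : n1 (- ('i%C * (b == false)%:R%:C) * (2^-1)%:C : R[i]) <= 1.
        rewrite /n1 !reimE /=; case: (b == false) => /=;
        rewrite ?(mulr0, mul0r, mulr1, mul1r, subr0, sub0r, oppr0, add0r, addr0, normr0, normrN)//.
        by rewrite ler_norml; lra.
      rewrite (le_trans (ler_wpM2r (n1_ge0 _) h1))// mul1r (le_trans (n1M _ _))// n1_real.
      have s0 : 0 <= sqnorm2 x by rewrite /sqnorm2 /dot2 addr_ge0// -expr2 sqr_ge0.
      rewrite ger0_norm//.
      have sw : sqnorm2 x * weight x <= 2.
        have := crd_weight true x; have := crd_weight false x; have := weight_ge0 x.
        by rewrite /sqnorm2 /dot2 /=; nra.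
      have := n1_gau (q y) x; rewrite req => hg.
      rewrite (le_trans (ler_wpM2l s0 (le_trans hg (ler_wpM2l (ler0n _ 2) (hC x)))))//.
      have -> : sqnorm2 x * (2 * (C * weight x ^+ 2)) =
        2 * C * weight x * (sqnorm2 x * weight x) by ring.
      have -> : 4 * C * weight x = 2 * C * weight x * 2 by ring.
      by apply: ler_wpM2l sw; apply: mulr_ge0; [rewrite mulr_ge0// ltW|exact: weight_ge0].
  apply: (pder_ext (pderM hq hA)) => // y.
  have rq0 : 0 < re (q y) by rewrite req.
  have [i1 e1] := cint_sqnorm_gau rq0.
  rewrite cintegralZ// e1 -/(A y).
  have -> : (2^-1)%:C = 2^-1 :> R[i] by rewrite fmorphV rmorph_nat.
  by field; rewrite neq0_re.
have := cst0 (im p, 0) 0; rewrite /A.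
have -> : q (im p, 0) = p by apply: complex_eqP; rewrite !reimE /=; ring.
have -> : q 0 = (re p)%:C by rewrite /q /= mulr0 addr0.
rewrite cint_gau_real// -rmorphM /= => h.
apply: (mulfI pn); rewrite h; transitivity ((2 * pi)%:C : R[i]); last by field.
by congr (_%:C); field; rewrite gt_eqF.
Qed.

Theorem gauss_fourier p k : 0 < re p ->
  cintegral (@leb2 R) (gk p k) = (2 * pi)%:C / p * cexp (- (sqnorm2 k / 2)%:C / p).
Proof. by move=> p0; rewrite cint_gk// cint_gau. Qed.

End Gaussian.

(** * Fresnel diffraction and Fourier inversion *)

Section ComplexLimits.
Variable R : realType.
Implicit Types (u : nat -> R[i]) (a : R[i]).

Lemma complex_inv a : a^-1 = ((sqmod a)^-1)%:C * conjc a.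
Proof.
have [->|a0] := eqVneq a 0; first by rewrite invr0 /sqmod /= expr0n addr0 invr0 mul0r.
have s0 : (sqmod a)%:C != 0 :> R[i].
  by rewrite -mulc_conj mulf_neq0// conjc_eq0.
by apply: (mulfI a0); rewrite mulfV// mulrCA mulc_conj fmorphV mulVf.
Qed.

Lemma sqmod_eq0 a : (sqmod a == 0) = (a == 0).
Proof.
apply/eqP/eqP => [h|->]; last by rewrite /sqmod /= expr0n addr0.
have : (sqmod a)%:C = 0 :> R[i] by rewrite h.
by rewrite -mulc_conj => /eqP; rewrite mulf_eq0 conjc_eq0 orbb => /eqP.
Qed.

Lemma re_inv a : re (a^-1) = re a / sqmod a.
Proof. by rewrite complex_inv !reimE /=; ring. Qed.

Lemma ccvgV u a : a != 0 -> ccvg u a -> ccvg (fun n => (u n)^-1) a^-1.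
Proof.
move=> a0 ua; rewrite complex_inv; under [X in ccvg X _]eq_fun do rewrite complex_inv.
apply: ccvgM; last exact: ccvgJ.
apply: ccvg_real; apply: cvgV; first by rewrite sqmod_eq0.
exact: ccvg_sqmod.
Qed.

Lemma ccvg_ext u v a : ccvg u a -> u =1 v -> ccvg v a.
Proof. by move=> h /funext <-. Qed.

Lemma ccvgZ c u a : ccvg u a -> ccvg (fun n => c * u n) (c * a).
Proof. by apply: ccvgM; exact: ccvg_cst. Qed.

End ComplexLimits.

Section ProductMeasurability.
Context d1 d2 (T1 : measurableType d1) (T2 : measurableType d2) (R : realType).

Lemma cmeas_fst (f : T1 -> R[i]) : cmeas f -> cmeas (fun z : T1 * T2 => f z.1).
Proof.
move=> [m1 m2]; split; [apply: (measurableT_comp m1)|apply: (measurableT_comp m2)];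
  exact: measurable_fst.
Qed.

Lemma cmeas_snd (f : T2 -> R[i]) : cmeas f -> cmeas (fun z : T1 * T2 => f z.2).
Proof.
move=> [m1 m2]; split; [apply: (measurableT_comp m1)|apply: (measurableT_comp m2)];
  exact: measurable_snd.
Qed.

End ProductMeasurability.

Section MeasurabilityExtras.
Variable R : realType.

Lemma cmeas_comp d d' (T : measurableType d) (T' : measurableType d') (f : T' -> R[i])
  (phi : T -> T') : cmeas f -> measurable_fun setT phi -> cmeas (fun x => f (phi x)).
Proof. by move=> [m1 m2] mp; split; [exact: (measurableT_comp m1)|exact: (measurableT_comp m2)]. Qed.

Lemma cintbleMb' d (T : measurableType d) (mu : {measure set T -> \bar R})
    (f g : T -> R[i]) (C : R) : cintble mu f -> cmeas g -> (forall x, n1 (g x) <= C) ->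
  cintble mu (fun x => f x * g x).
Proof. by move=> h mg gC; under eq_fun do rewrite mulrC; exact: cintbleMb gC. Qed.

End MeasurabilityExtras.

Section FourierInversion.
Variable R : realType.
Implicit Types (x k : plane R) (p : R[i]) (F G : plane R -> R[i]).

Lemma measurable_dot2 :
  measurable_fun setT (fun z : plane R * plane R => dot2 z.1 z.2).
Proof.
have m1 := @measurable_fst _ _ (plane R) (plane R).
have m2 := @measurable_snd _ _ (plane R) (plane R).
have c1 := @measurable_fst _ _ (measurableTypeR R) (measurableTypeR R).
have c2 := @measurable_snd _ _ (measurableTypeR R) (measurableTypeR R).
apply: measurable_funD; apply: measurable_funM.
- exact: (measurableT_comp c1 m1).
- exact: (measurableT_comp c1 m2).
- exact: (measurableT_comp c2 m1).
- exact: (measurableT_comp c2 m2).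
Qed.

Lemma measurable_dot2r k : measurable_fun setT (dot2 k).
Proof. by apply: rder_meas => b; eexists; exact: rder_dot2. Qed.

Lemma dot2D k x y : dot2 k (x + y) = dot2 k x + dot2 k y.
Proof. by rewrite /dot2 /=; ring. Qed.

Lemma sqnorm2_ge0 x : 0 <= sqnorm2 x.
Proof. by rewrite /sqnorm2 /dot2 addr_ge0// -expr2 sqr_ge0. Qed.

Lemma fourierE F k :
  fourier F k = cintegral (@leb2 R) (fun x => cis (- dot2 k x) * F x).
Proof. by []. Qed.

Lemma fourier_int F k : cintble (@leb2 R) F ->
  cintble (@leb2 R) (fun x => cis (- dot2 k x) * F x).
Proof.
move=> iF; apply: (cintbleMb iF _ (fun x => n1_cis _)).
by apply: cmeas_cis; apply: measurableT_comp => //; exact: measurable_dot2r.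
Qed.

Lemma n1_fourier F k (g : plane R -> R) : cintble (@leb2 R) F -> rintble (@leb2 R) g ->
  (forall x, n1 (F x) <= g x) -> n1 (fourier F k) <= 2 * \int[@leb2 R]_x g x.
Proof.
move=> iF ig Fg; rewrite fourierE -RintegralZl//.
apply: n1_cintegral; [exact: fourier_int|exact: rintbleZ|].
by move=> x; rewrite (le_trans (n1_cisM _ _))// ler_wpM2l.
Qed.

Lemma cexp_i (t : R) : cexp ('i%C * t%:C) = cis t.
Proof.
rewrite /cexp; have -> : re ('i%C * t%:C) = 0 by rewrite reM /=; ring.
have -> : im ('i%C * t%:C) = t by rewrite imM /=; ring.
by rewrite expR0 mul1r.
Qed.

(** The transform of [gau p] given by [gauss_fourier]. For real [p > 0] it is a heat kernel of
    variance [p] per coordinate and total mass [(2 * pi) ^+ 2]. *)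
Definition heat p x : R[i] := (2 * pi)%:C / p * cexp (- (sqnorm2 x / 2)%:C / p).

(** The Gaussian makes the double integral absolutely convergent even when [fourier F] is not
    integrable, so Fubini applies and the integral over [k] is explicit. *)
Lemma gauss_swap F p x : 0 < re p -> cintble (@leb2 R) F ->
  cintble (@leb2 R) (fun k => fourier F k * (cis (dot2 k x) * gau p k)) /\
  cintegral (@leb2 R) (fun k => fourier F k * (cis (dot2 k x) * gau p k)) =
  cintegral (@leb2 R) (fun x' => F x' * heat p (x - x')).
Proof.
move=> p0 iF.
pose f (z : plane R * plane R) :=
  cis (- dot2 z.1 z.2) * F z.2 * (cis (dot2 x z.1) * gau p z.1).
have mf : cmeas f.
  apply: cmeasM; first apply: cmeasM.
  - by apply: cmeas_cis; apply: measurableT_comp => //; exact: measurable_dot2.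
  - by apply: cmeas_snd; exact: cintble_meas iF.
  - apply: (@cmeas_fst _ _ (plane R) (plane R) R (fun k => cis (dot2 x k) * gau p k)).
    by apply: cmeasM; [apply: cmeas_cis; exact: measurable_dot2r|exact: gau_meas].
have fb k x' : n1 (f (k, x')) <= 4 * n1 (gau p k) * n1 (F x').
  rewrite /f /= (le_trans (n1M _ _))//.
  have -> : 4 * n1 (gau p k) * n1 (F x') = (2 * n1 (F x')) * (2 * n1 (gau p k)) by ring.
  by apply: ler_pM; rewrite ?n1_ge0 ?n1_cisM.
have [h1 h2 h3 h4 h5] := cfubini (rintbleZ 4 (cintble_n1 (gau_int p0))) (cintble_n1 iF)
  (fun k => mulr_ge0 (ler0n _ 4) (n1_ge0 _)) (fun x' => n1_ge0 _) mf fb.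
have e k : cintegral (@leb2 R) (fun x' => f (k, x')) =
    fourier F k * (cis (dot2 k x) * gau p k).
  rewrite mulrC fourierE -cintegralZ; last exact: fourier_int.
  by apply: eq_cintegral => x'; rewrite /f /= (dot2C x); ring.
have e' x' : cintegral (@leb2 R) (fun k => f (k, x')) = F x' * heat p (x - x').
  rewrite /heat -(gauss_fourier (x - x') p0) -cintegralZ; last exact: gk_int.
  apply: eq_cintegral => k; rewrite /f /gk /= dot2C.
  have -> : dot2 (x - x') k = - dot2 x' k + dot2 x k by rewrite /dot2 /=; ring.
  by rewrite (cisD (- dot2 x' k) (dot2 x k)); ring.
split; first by under eq_fun do rewrite -e.
under eq_fun do rewrite -e; rewrite h5.
by apply: eq_cintegral => x'; rewrite e'.
Qed.

(** Fubini yields measurability of the transform times a Gaussian; multiplying by the reciprocal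
    Gaussian undoes the damping. *)
Lemma fourier_meas F : cintble (@leb2 R) F -> cmeas (fourier F).
Proof.
move=> iF; have p1 : 0 < re (1 : R[i]) by rewrite /= ltr01.
have [/cintble_meas h _] := gauss_swap 0 p1 iF.
have -> : fourier F = fun k =>
    fourier F k * (cis (dot2 k 0) * gau 1 k) * cexp (1 * (sqnorm2 k / 2)%:C).
  apply/funext => k.
  have -> : forall a c g e : R[i], a * (c * g) * e = a * c * (g * e).
    by move=> a c g e; ring.
  rewrite /gau -cexpD mulN1r mul1r addNr cexp0 mulr1.
  by rewrite /dot2 /= !mulr0 addr0 cis0 mulr1.
apply: cmeasM => //; apply: cmeas_cexp; under eq_fun do rewrite mul1r.
by apply: cmeas_real; apply: rder_meas => b; eexists; exact: rder_sqnorm2.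
Qed.

(** Approaches the imaginary axis from the right half-plane. The limit point with [s != 0] gives the
    Fresnel formula, [s = 0] gives Fourier inversion. *)
Definition reg (s : R) (n : nat) : R[i] := (n.+1%:R^-1)%:C + 'i%C * s%:C.

Lemma re_reg s n : re (reg s n) = n.+1%:R^-1.
Proof. by rewrite !reimE /=; ring. Qed.
Lemma re_reg_gt0 s n : 0 < re (reg s n).
Proof. by rewrite re_reg invr_gt0. Qed.

Lemma ccvg_reg s : ccvg (reg s) ('i%C * s%:C).
Proof.
rewrite -[X in ccvg _ X]add0r; apply: ccvgD; last exact: ccvg_cst.
by apply: ccvg_real; exact: cvg_harmonic.
Qed.

Lemma n1_gau_le2 p x : 0 <= re p -> n1 (gau p x) <= 2.
Proof.
move=> p0; rewrite (le_trans (n1_gau _ _))// ler_piMr//.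
by rewrite -expR0 ler_expR oppr_le0 mulr_ge0// divr_ge0// sqnorm2_ge0.
Qed.

Lemma regularized_limit F s x : cintble (@leb2 R) F -> cintble (@leb2 R) (fourier F) ->
  ccvg (fun n => cintegral (@leb2 R) (fun x' => F x' * heat (reg s n) (x - x')))
    (cintegral (@leb2 R) (fun k =>
      fourier F k * (cis (dot2 k x) * cis (- (s * (sqnorm2 k / 2)))))).
Proof.
move=> iF iFF.
have e n := (gauss_swap x (re_reg_gt0 s n) iF).2.
under [X in ccvg X _]eq_fun do rewrite -e.
apply: (proj2 (cint_cvg _ _ (rintbleZ 4 (cintble_n1 iFF)) _)) => [n|k|n k].
- exact: cintble_meas (gauss_swap x (re_reg_gt0 s n) iF).1.
- apply: ccvgZ; apply: ccvgZ.
  have -> : cis (- (s * (sqnorm2 k / 2))) = gau ('i%C * s%:C) k.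
    rewrite /gau /cexp !reimE /=.
    rewrite !(mul0r, mulr0, mul1r, subr0, add0r, addr0, oppr0) expR0 mul1r.
    by congr cis; ring.
  apply: ccvg_cexp; apply: ccvgM; last exact: ccvg_cst.
  rewrite -mulN1r; apply: (ccvg_ext (ccvgZ (-1) (ccvg_reg s))) => n.
  by rewrite mulN1r.
- rewrite (le_trans (n1M _ _))// mulrC ler_wpM2r ?n1_ge0//.
  rewrite (le_trans (n1_cisM _ _))//; have -> : 4 = 2 * 2 :> R by rewrite -natrM.
  rewrite ler_wpM2l//.
  by apply: n1_gau_le2; exact/ltW/re_reg_gt0.
Qed.

Lemma subE x u : x - u = scale2 (-1) u + x.
Proof. by case: x => a c; case: u => a' c'; apply/pair_equal_spec; split;
  rewrite /= mulN1r addrC. Qed.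

Lemma heat_meas p x : cmeas (fun x' => cexp (- (sqnorm2 (x - x') / 2)%:C / p)).
Proof.
apply: cmeas_cexp; apply: cmeasM; last exact: cmeas_cst.
apply: cmeasN; apply: cmeas_real; under eq_fun do rewrite subE.
apply: (measurableT_comp (f := fun u => sqnorm2 u / 2)); last exact: measurable_affine2.
by apply: rder_meas => b; eexists; exact: rder_sqnorm2.
Qed.

Lemma n1_heat p x : 0 <= re p -> n1 (cexp (- (sqnorm2 x / 2)%:C / p)) <= 2.
Proof.
move=> p0; rewrite (le_trans (n1_cexp _))// ler_piMr//.
rewrite -expR0 ler_expR !reimE /= oppr0 mul0r subr0 re_inv mulNr oppr_le0.
by rewrite mulr_ge0 ?divr_ge0 ?sqnorm2_ge0 ?sqmod_ge0.
Qed.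

(* Limit of [gauss_swap] along [p = reg s n], with parabolic damping [1 / (n + 1)]. *)
Theorem fresnel F s x : s != 0 -> cintble (@leb2 R) F -> cintble (@leb2 R) (fourier F) ->
  cintegral (@leb2 R) (fun k =>
      fourier F k * (cis (dot2 k x) * cis (- (s * (sqnorm2 k / 2))))) =
  (2 * pi)%:C / ('i%C * s%:C) *
  cintegral (@leb2 R) (fun x' => F x' * cis (sqnorm2 (x - x') / 2 / s)).
Proof.
move=> s0 iF iFF; apply: ccvg_unique (regularized_limit s x iF iFF) _.
have is0 : 'i%C * s%:C != 0 :> R[i].
  apply/eqP => /(congr1 (@complex.Im R)); rewrite !reimE /= mul0r mul1r add0r.
  by move=> /eqP; rewrite (negbTE s0).
have e n : cintegral (@leb2 R) (fun x' => F x' * heat (reg s n) (x - x')) =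
   (2 * pi)%:C / reg s n * cintegral (@leb2 R) (fun x' =>
     F x' * cexp (- (sqnorm2 (x - x') / 2)%:C / reg s n)).
  rewrite -cintegralZ; first by apply: eq_cintegral => x'; rewrite /heat; ring.
  apply: (cintbleMb' iF (heat_meas _ x) (fun x' => n1_heat (x - x') _)).
  by move=> _; exact/ltW/re_reg_gt0.
under [X in ccvg X _]eq_fun do rewrite e.
apply: ccvgM; first by apply: ccvgZ; apply: ccvgV => //; exact: ccvg_reg.
apply: (proj2 (cint_cvg _ _ (rintbleZ 2 (cintble_n1 iF)) _)) => [n|x'|n x'].
- by apply: cmeasM; [exact: cintble_meas iF|exact: heat_meas].
- apply: ccvgZ.
  have -> : cis (sqnorm2 (x - x') / 2 / s) = cexp (- (sqnorm2 (x - x') / 2)%:C / ('i%C * s%:C)).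
    have -> : - (sqnorm2 (x - x') / 2)%:C / ('i%C * s%:C) =
        'i%C * (sqnorm2 (x - x') / 2 / s)%:C :> R[i].
      apply: (mulIf is0); rewrite mulfVK//.
      have -> : 'i%C * (sqnorm2 (x - x') / 2 / s)%:C * ('i%C * s%:C) =
         ('i%C * 'i%C) * (sqnorm2 (x - x') / 2 / s * s)%:C :> R[i].
        by rewrite [in RHS]rmorphM /=; ring.
      rewrite mulfVK//.
      by apply: complex_eqP; rewrite !reimE /=; ring.
    by rewrite cexp_i.
  apply: ccvg_cexp; apply: ccvgZ; apply: ccvgV => //; exact: ccvg_reg.
- rewrite (le_trans (n1M _ _))// mulrC ler_wpM2r ?n1_ge0// n1_heat//.
  exact/ltW/re_reg_gt0.
Qed.

Lemma cint_heat_real (D : R) x : 0 < D ->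
  rintble (@leb2 R) (fun x' => expR (- (sqnorm2 (x - x') / 2 / D))) /\
  \int[@leb2 R]_x' expR (- (sqnorm2 (x - x') / 2 / D)) = 2 * pi * D.
Proof.
move=> D0; have D0' : 0 < D^-1 by rewrite invr_gt0.
have gE u : gau D^-1%:C u = (expR (- (sqnorm2 u / 2 / D)))%:C.
  by rewrite /gau -rmorphN -rmorphM /= cexp_real; congr (expR _)%:C; ring.
have iG : rintble (@leb2 R) (fun u => expR (- (sqnorm2 u / 2 / D))).
  have [h _] := gau_int (p := D^-1%:C) D0'.
  by under eq_fun do rewrite -[expR _]/(re (_%:C)) -gE.
have a0 : -1 != 0 :> R by rewrite oppr_eq0 oner_eq0.
have [h e] := rint_affine x a0 iG.
have e2 u : x - u = scale2 (-1) u + x by rewrite subE.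
split; first by under eq_fun do rewrite e2.
under eq_Rintegral do rewrite e2.
have := cint_gau_real D0'; rewrite (eq_cintegral _ gE) cintegral_real.
move=> /(congr1 (@complex.Re R)) /=; rewrite e sqrrN expr1n mul1r invrK => ->.
by [].
Qed.

(* After rescaling the heat kernel, the limit of the regularized inversion integrals is a
   dominated convergence. *)
Theorem fourier_inversion F (C : R) x : cintble (@leb2 R) F -> cintble (@leb2 R) (fourier F) ->
  (forall x', n1 (F x') <= C) ->
  (forall (a : nat -> R) u, a n @[n --> \oo] --> (0 : R) ->
     ccvg (fun n => F (scale2 (a n) u + x)) (F x)) ->
  cintegral (@leb2 R) (fun k => fourier F k * cis (dot2 k x)) = ((2 * pi) ^+ 2)%:C * F x.
Proof.
move=> iF iFF FC cF.
have := regularized_limit 0 x iF iFF.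
have -> : (fun k => fourier F k * (cis (dot2 k x) * cis (- (0 * (sqnorm2 k / 2))))) =
    (fun k => fourier F k * cis (dot2 k x)).
  by apply/funext => k; rewrite mul0r oppr0 cis0 mulr1.
move=> h; apply: (ccvg_unique h); move: h => _.
pose a n : R := Num.sqrt n.+1%:R^-1.
have a0 n : a n != 0 by rewrite gt_eqF// sqrtr_gt0 invr_gt0.
have a2 n : a n ^+ 2 = n.+1%:R^-1 by rewrite sqr_sqrtr.
have regE n : reg 0 n = (n.+1%:R^-1)%:C by rewrite /reg mulr0 addr0.
have i1 : 0 < re (1 : R[i]) by rewrite /= ltr01.
have e n : cintegral (@leb2 R) (fun x' => F x' * heat (reg 0 n) (x - x')) =
    (2 * pi)%:C * cintegral (@leb2 R) (fun u => F (scale2 (a n) u + x) * gau 1 u).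
  have iFh : cintble (@leb2 R) (fun x' => F x' * heat (reg 0 n) (x - x')).
    rewrite /heat; under eq_fun do rewrite mulrCA.
    apply: cintbleZ; apply: (cintbleMb' iF (heat_meas _ x) (fun x' => n1_heat (x - x') _)).
    by move=> _; exact/ltW/re_reg_gt0.
  have [iA ->] := cint_affine x (a0 n) iFh.
  have hE u : heat (reg 0 n) (x - (scale2 (a n) u + x)) =
      (2 * pi * n.+1%:R)%:C * gau 1 u.
    rewrite /heat regE -fmorphV invrK -rmorphM /=; congr (_ * _).
    rewrite /gau; congr cexp; rewrite mulN1r -rmorphN -rmorphM -rmorphN /=; congr (_%:C).
    have -> : sqnorm2 (x - (scale2 (a n) u + x)) = a n ^+ 2 * sqnorm2 u.
      by rewrite /sqnorm2 /dot2 /=; ring.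
    rewrite a2; move: n.+1%:R (pnatr_eq0 R n.+1) => N /negbT n0.
    by field.
  have eA : (fun u => F (scale2 (a n) u + x) * heat (reg 0 n) (x - (scale2 (a n) u + x))) =
      (fun u => (2 * pi * n.+1%:R)%:C * (F (scale2 (a n) u + x) * gau 1 u)).
    by apply/funext => u; rewrite hE; ring.
  rewrite eA cintegralZ; last first.
    have mA : cmeas (fun u => F (scale2 (a n) u + x)).
      by apply: (cmeas_comp (cintble_meas iF)); exact: measurable_affine2.
    exact: (cintbleMb (gau_int i1) mA (fun u => FC _)).
  rewrite mulrA -rmorphM /=; congr (_%:C * _).
  rewrite a2; move: n.+1%:R (pnatr_eq0 R n.+1) => N /negbT n0.
  by field.
under [X in ccvg X _]eq_fun do rewrite e.
have -> : ((2 * pi) ^+ 2)%:C * F x = (2 * pi)%:C * (F x * (2 * pi)%:C).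
  by rewrite expr2 rmorphM /=; ring.
apply: ccvgZ.
have -> : (2 * pi)%:C = cintegral (@leb2 R) (gau 1) by rewrite cint_gau// divr1.
rewrite -cintegralZ; last exact: gau_int.
apply: (proj2 (cint_cvg _ _ (rintbleZ C (cintble_n1 (gau_int i1))) _)) => [n|u|n u].
- apply: cmeasM; last exact: gau_meas.
  by apply: (cmeas_comp (cintble_meas iF)); exact: measurable_affine2.
- apply: ccvgM; last exact: ccvg_cst.
  apply: cF; rewrite -(sqrtr0 R); apply: continuous_cvg; first exact: sqrt_continuous.
  exact: cvg_harmonic.
- by rewrite (le_trans (n1M _ _))// ler_wpM2r ?n1_ge0.
Qed.

(** Monotone convergence as the Gaussian damping is removed. A real-valued integral reads 0 when the
    extended one is infinite; the bound [B] makes the damped integrals finite and so gives content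
    to the hypothesis on [M]. *)
Lemma rintble_reg (g : plane R -> R) (B M : R) : measurable_fun setT g ->
  (forall x, 0 <= g x <= B) ->
  (forall n, \int[@leb2 R]_x (g x * expR (- (n.+1%:R^-1 * (sqnorm2 x / 2)))) <= M) ->
  rintble (@leb2 R) g.
Proof.
move=> mg gB gM.
pose e n x := expR (- (n.+1%:R^-1 * (sqnorm2 x / 2))) : R.
have gE n x : gau (n.+1%:R^-1)%:C x = (e n x)%:C.
  by rewrite /gau -rmorphN -rmorphM /= cexp_real mulNr.
have ie n : rintble (@leb2 R) (e n).
  have n0 : 0 < re ((n.+1%:R^-1)%:C : R[i]) by rewrite /= invr_gt0.
  have [h _] := gau_int n0.
  by rewrite (_ : e n = fun x => re (gau (n.+1%:R^-1)%:C x))//; apply/funext => x; rewrite gE.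
have g0 x : 0 <= g x by have /andP[] := gB x.
have ige n : rintble (@leb2 R) (fun x => g x * e n x).
  apply: (rintble_le _ (rintbleZ B (ie n))).
    by apply: measurable_funM => //; exact: rintble_meas (ie n).
  move=> x; rewrite ger0_norm ?mulr_ge0 ?expR_ge0// ler_wpM2r ?expR_ge0//.
  by have /andP[] := gB x.
have gcvg x : (g x * e n x)%:E @[n --> \oo] --> (g x)%:E.
  apply/cvg_EFin; first exact: nearW.
  rewrite -[X in _ --> X]mulr1; apply: cvgM; first exact: cvg_cst.
  rewrite -expR0; apply: continuous_cvg; first exact: continuous_expR.
  rewrite -oppr0; apply: cvgN; rewrite -(mul0r (sqnorm2 x / 2)).
  by apply: cvgM; [exact: cvg_harmonic|exact: cvg_cst].
apply/integrableP; split; first exact/measurable_EFinP.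
have -> : (\int[@leb2 R]_x `|(EFin \o g) x| =
    \int[@leb2 R]_x limn (fun n => (g x * e n x)%:E))%E.
  apply: eq_integral => x _; rewrite /= ger0_norm//.
  by apply/esym/cvg_lim => //; exact: gcvg.
rewrite monotone_convergence//; last 3 first.
- by move=> n; apply/measurable_EFinP; exact: rintble_meas (ige n).
- by move=> n x _; rewrite lee_fin mulr_ge0 ?expR_ge0.
- move=> x _ n m nm; rewrite lee_fin ler_wpM2l// ler_expR lerN2.
  rewrite ler_wpM2r//; first by rewrite divr_ge0 ?sqnorm2_ge0.
  by rewrite lef_pV2 ?posrE// ler_nat.
apply: (@le_lt_trans _ _ M%:E); last exact: ltry.
apply: lime_le.
  apply: ereal_nondecreasing_is_cvgn => n m nm; apply: ge0_le_integral => //.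
  - by move=> x _; rewrite lee_fin mulr_ge0 ?expR_ge0.
  - by apply/measurable_EFinP; exact: rintble_meas (ige n).
  - by apply/measurable_EFinP; exact: rintble_meas (ige m).
  - move=> x _; rewrite lee_fin ler_wpM2l// ler_expR lerN2.
    rewrite ler_wpM2r//; first by rewrite divr_ge0 ?sqnorm2_ge0.
    by rewrite lef_pV2 ?posrE// ler_nat.
apply: nearW => n.
have -> : (\int[@leb2 R]_x (g x * e n x)%:E = (\int[@leb2 R]_x (g x * e n x))%:E)%E.
  by rewrite fineK//; exact: (integrable_fin_num _ (ige n)).
by rewrite lee_fin; exact: gM.
Qed.

(** Half of Plancherel without L2 theory: by Fubini the damped integral of the squared modulus is
    the pairing of [G] with its heat regularization. The heat kernel has fixed mass and [G] is
    bounded, so the pairing is bounded uniformly in the damping. *)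
Lemma fourier_L2 G (C : R) : cmeas G -> (forall x, n1 (G x) <= C * weight x) ->
  rintble (@leb2 R) (fun k => sqmod (fourier G k)).
Proof.
move=> mG GC.
have iG : cintble (@leb2 R) G.
  by apply: (cintble_le mG _ GC); apply: rintbleZ; exact: rintble_weight.
have C0 : 0 <= C.
  have := le_trans (n1_ge0 _) (GC 0); rewrite pmulr_lge0//; exact: weight_gt0.
have GC' x : n1 (G x) <= C.
  by rewrite (le_trans (GC x))// ler_piMr// weight_le1.
have [N [NE N0 FB]] : exists N, [/\ N = \int[@leb2 R]_x n1 (G x), 0 <= N &
    forall k, n1 (fourier G k) <= 2 * N].
  exists (\int[@leb2 R]_x n1 (G x)); split => //.
    by apply: Rintegral_ge0 => x _; exact: n1_ge0.
  by move=> k; exact: (n1_fourier _ iG (cintble_n1 iG)).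
have mF := fourier_meas iG.
(* The first constant is the square of the bound [2 * N] on the transform. In the second,
   [8 * pi ^+ 2] is twice the mass [(2 * pi) ^+ 2] of the heat kernel; the factor 2 is slack. *)
apply: (@rintble_reg _ ((2 * N) ^+ 2) (N * (C * (8 * pi ^+ 2)))).
- exact: cmeas_sqmod.
- move=> k; rewrite sqmod_ge0 /= (le_trans (sqmod_le_n1 _))//.
  by rewrite ler_sqr ?nnegrE ?n1_ge0 ?mulr_ge0.
move=> n; have : 0 < n.+1%:R^-1 :> R by rewrite invr_gt0.
move: n.+1%:R^-1 => D D0.
have pD : 0 < re (D%:C : R[i]) by [].
have gE x : gau D%:C x = (expR (- (D * (sqnorm2 x / 2))))%:C.
  by rewrite /gau -rmorphN -rmorphM /= cexp_real mulNr.
pose H k := fourier G k * gau D%:C k.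
have iH : cintble (@leb2 R) H.
  exact: (cintbleMb (gau_int pD) mF FB).
have -> : \int[@leb2 R]_k (sqmod (fourier G k) * expR (- (D * (sqnorm2 k / 2)))) =
   re (cintegral (@leb2 R) (fun k => conjc (fourier G k) * H k)).
  apply: eq_Rintegral => k _; rewrite /H mulrA (mulrC (conjc _)) mulc_conj gE.
  by rewrite -rmorphM.
pose f (z : plane R * plane R) := H z.1 * (cis (dot2 z.1 z.2) * conjc (G z.2)).
have mf : cmeas f.
  apply: cmeasM; first by apply: (@cmeas_fst _ _ (plane R) (plane R) R H); exact: cintble_meas iH.
  apply: cmeasM; first by apply: cmeas_cis; exact: measurable_dot2.
  by apply: (@cmeas_snd _ _ (plane R) (plane R) R (fun x => conjc (G x))); exact: cmeasJ.
have fb k x : n1 (f (k, x)) <= 2 * n1 (H k) * n1 (G x).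
  rewrite /f /= (le_trans (n1M _ _))// (mulrC 2) -mulrA ler_wpM2l ?n1_ge0//.
  by rewrite (le_trans (n1_cisM _ _))// n1J.
have [h1 h2 h3 h4 h5] := cfubini (rintbleZ 2 (cintble_n1 iH)) (cintble_n1 iG)
  (fun k => mulr_ge0 (ler0n _ 2) (n1_ge0 _)) (fun x' => n1_ge0 _) mf fb.
have e k : cintegral (@leb2 R) (fun x => f (k, x)) = conjc (fourier G k) * H k.
  rewrite mulrC fourierE -cintegralJ; last exact: fourier_int.
  rewrite -cintegralZ; last by apply: cintbleJ; exact: fourier_int.
  by apply: eq_cintegral => x; rewrite /f /= conjcM cisN; congr (_ * (_ * _));
    rewrite conjcK.
have e' x : cintegral (@leb2 R) (fun k => f (k, x)) =
    conjc (G x) * cintegral (@leb2 R) (fun x' => G x' * heat D%:C (x - x')).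
  have [i <-] := gauss_swap x pD iG.
  rewrite -(cintegralZ (conjc (G x)) i); apply: eq_cintegral => k.
  by rewrite /f /H; ring.
have -> : (fun k => conjc (fourier G k) * H k) =
    (fun k => cintegral (@leb2 R) (fun x => f (k, x))) by apply/funext => k; rewrite e.
rewrite h5; clear FB; apply: (le_trans (ler_norm _)); apply: (le_trans (re_le_n1 _)).
rewrite NE mulrC -(RintegralZl (C * (8 * pi ^+ 2)) measurableT (cintble_n1 iG)).
apply: (n1_cintegral h4 (rintbleZ _ (cintble_n1 iG))) => x.
rewrite e'.
apply: (le_trans (n1M _ _)).
rewrite n1J.
rewrite [leLHS]mulrC.
apply: ler_wpM2r; first exact: n1_ge0.
have [i1 e1] := cint_heat_real x D0.
have hE x' : heat D%:C (x - x') = (2 * pi / D * expR (- (sqnorm2 (x - x') / 2 / D)))%:C.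
  rewrite /heat -fmorphV -!rmorphM -rmorphN -rmorphM /= cexp_real -rmorphM /=.
  by congr (_ * expR _)%:C; ring.
have hb x' : n1 (G x' * heat D%:C (x - x')) <=
    (C * (2 * pi / D)) * expR (- (sqnorm2 (x - x') / 2 / D)).
  have c0 : 0 <= 2 * pi / D * expR (- (sqnorm2 (x - x') / 2 / D)).
    apply: mulr_ge0; last exact: expR_ge0.
    apply: divr_ge0; last exact: ltW D0.
    by apply: mulr_ge0; [exact: ler0n|exact: pi_ge0].
  apply: (le_trans (n1M _ _)); rewrite hE n1_real (ger0_norm c0).
  rewrite -[leRHS]mulrA.
  by apply: ler_wpM2r; [exact: c0|exact: GC'].
have -> : C * (8 * pi ^+ 2) = 2 * \int[@leb2 R]_x'
    ((C * (2 * pi / D)) * expR (- (sqnorm2 (x - x') / 2 / D))).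
  by rewrite (RintegralZl (C * (2 * pi / D)) measurableT i1) e1; field; rewrite gt_eqF.
apply: (@le_trans _ _ (\int[@leb2 R]_x'
    ((C * (2 * pi / D)) * expR (- (sqnorm2 (x - x') / 2 / D))))); last first.
  apply: ler_peMl; last by rewrite ler1n.
  apply: Rintegral_ge0 => x' _; exact: (le_trans (n1_ge0 _) (hb x')).
apply: (n1_cintegral _ (rintbleZ _ i1) hb).
rewrite /heat; under eq_fun do rewrite mulrCA.
apply: cintbleZ; apply: (cintbleMb' iG (heat_meas _ x) (fun x' => n1_heat (x - x') _)).
by move=> _; exact: ltW.
Qed.

End FourierInversion.

(** * Schwartz functions *)

Lemma n1_realM (R : realType) (a : R) (z : R[i]) : n1 (a%:C * z) = `|a| * n1 z.
Proof. by rewrite /n1 !reimE /= !mul0r subr0 addr0 !normrM mulrDr. Qed.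

Section IntegrableFourier.
Variable R : realType.
Implicit Types (x k : plane R) (F f g : plane R -> R[i]) (b : bool) (C : R).

Lemma le_weight_int F C : cmeas F -> (forall x, n1 (F x) <= C * weight x) ->
  cintble (@leb2 R) F.
Proof.
by move=> mF FC; apply: (cintble_le mF _ FC); apply: rintbleZ; exact: rintble_weight.
Qed.

Lemma fourier_pder b F F' C k : cmeas F -> pder b F F' ->
  (forall x, n1 (F x) <= C * weight x) -> (forall x, n1 (F' x) <= C * weight x) ->
  fourier F' k = 'i%C * (crd b k)%:C * fourier F k.
Proof.
move=> mF dF FC F'C; have mF' := pder_meas' mF dF.
have iF := le_weight_int mF FC; have iF' := le_weight_int mF' F'C.
have C0 : 0 <= C.
  have := le_trans (n1_ge0 _) (FC 0); rewrite pmulr_lge0//; exact: weight_gt0.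
have d1 : pder b (fun x => cis (- dot2 k x) * F x)
    (fun x => - ('i%C * (crd b k)%:C) * (cis (- dot2 k x) * F x) + cis (- dot2 k x) * F' x).
  apply: (pder_ext (pderM (pder_cis (rderN (rder_dot2 b k))) dF)) => // x.
  by rewrite rmorphN /=; ring.
have iA := fourier_int k iF; have iB := fourier_int k iF'.
pose K := 2 * (n1 ('i%C * (crd b k)%:C) + 1) * C.
have K1 : 2 * C <= K.
  by rewrite /K ler_wpM2r// ler_peMr// lerDr n1_ge0.
have bA x : n1 (cis (- dot2 k x) * F x) <= 2 * C * weight x.
  by rewrite -mulrA (le_trans (n1_cisM _ _))// ler_wpM2l.
have bB x : n1 (cis (- dot2 k x) * F' x) <= 2 * C * weight x.
  by rewrite -mulrA (le_trans (n1_cisM _ _))// ler_wpM2l.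
have := pder_int0 (C := K) (cintble_meas iA) d1.
rewrite cintegralD; [|exact: cintbleZ iA|exact: iB].
rewrite (cintegralZ _ iA) -!fourierE => h.
have : - ('i%C * (crd b k)%:C) * fourier F k + fourier F' k = 0.
  apply: h => x.
    by apply: (le_trans (bA x)); apply: ler_wpM2r K1; exact: weight_ge0.
  apply: (le_trans (n1D _ _)).
  have -> : K * weight x = n1 ('i%C * (crd b k)%:C) * (2 * C * weight x) + 2 * C * weight x.
    by rewrite /K; ring.
  apply: lerD; last exact: bB.
  apply: (le_trans (n1M _ _)); rewrite n1N.
  by apply: ler_wpM2l; [exact: n1_ge0|exact: bA].
by move=> /eqP; rewrite mulNr addrC subr_eq0 => /eqP.
Qed.

(* With [B = (1 + d1)(1 + d2) F], the transform of [B] is square integrable and equals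
   [(1 + i k1)(1 + i k2)] times that of [F]. *)
Lemma fourier_L1 F F1 F2 F12 C : cmeas F ->
  pder false F F1 -> pder true F F2 -> pder false F2 F12 ->
  (forall x, n1 (F x) <= C * weight x) -> (forall x, n1 (F1 x) <= C * weight x) ->
  (forall x, n1 (F2 x) <= C * weight x) -> (forall x, n1 (F12 x) <= C * weight x) ->
  cintble (@leb2 R) (fourier F).
Proof.
move=> mF d1 d2 d12 b0 b1 b2 b12.
have m2 := pder_meas' mF d2; have m1 := pder_meas' mF d1; have m12 := pder_meas' m2 d12.
pose A x := F x + F2 x; pose A' x := F1 x + F12 x; pose B x := A x + A' x.
have dA : pder false A A' by exact: pderD.
have mA : cmeas A by exact: cmeasD. have mA' : cmeas A' by exact: cmeasD.
have bA x : n1 (A x) <= 2 * C * weight x.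
  apply: (le_trans (n1D _ _)).
  have -> : 2 * C * weight x = C * weight x + C * weight x by ring.
  by apply: lerD; [exact: b0|exact: b2].
have bA' x : n1 (A' x) <= 2 * C * weight x.
  apply: (le_trans (n1D _ _)).
  have -> : 2 * C * weight x = C * weight x + C * weight x by ring.
  by apply: lerD; [exact: b1|exact: b12].
have bB x : n1 (B x) <= 4 * C * weight x.
  apply: (le_trans (n1D _ _)).
  have -> : 4 * C * weight x = 2 * C * weight x + 2 * C * weight x by ring.
  by apply: lerD; [exact: bA|exact: bA'].
have mB : cmeas B by exact: cmeasD.
have fD (f g : plane R -> R[i]) k : cintble (@leb2 R) f -> cintble (@leb2 R) g ->
    fourier (fun x => f x + g x) k = fourier f k + fourier g k.
  move=> i1 i2; rewrite !fourierE -cintegralD; [|exact: fourier_int..].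
  by apply: eq_cintegral => x; rewrite mulrDr.
have fA k : fourier A k = (1 + 'i%C * (crd true k)%:C) * fourier F k.
  rewrite /A fD; [|exact: le_weight_int b0|exact: le_weight_int b2].
  by rewrite (fourier_pder k mF d2 b0 b2); ring.
have fB k : fourier B k = (1 + 'i%C * (crd false k)%:C) * fourier A k.
  rewrite /B fD; [|exact: le_weight_int bA|exact: le_weight_int bA'].
  by rewrite (fourier_pder k mA dA bA bA'); ring.
have iL2 := fourier_L2 mB bB.
have s1 (t : R) : sqmod (1 + 'i%C * t%:C) = 1 + t ^+ 2.
  by rewrite /sqmod !reimE /=; ring.
(* Arithmetic-geometric mean instead of Cauchy-Schwarz: with [S = sqmod (fourier B k)], [n1 (fourier
   F k) ^+ 2 <= 2 * (S * weight k) <= (S + weight k) ^+ 2]. *)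
apply: (@cintble_le _ _ _ _ _ (fun k => sqmod (fourier B k) + weight k)).
- by apply: fourier_meas; exact: le_weight_int b0.
- by apply: rintbleD => //; exact: rintble_weight.
move=> k; set S := sqmod (fourier B k).
have hS : sqmod (fourier F k) = S * weight k.
  rewrite /S fB fA !sqmodM !s1 /= -[LHS](weightM k).
  by ring.
have := n1_le_sqmod (fourier F k); rewrite hS => h.
have S0 : 0 <= S by exact: sqmod_ge0.
have w0 := weight_ge0 k.
rewrite -ler_sqr ?nnegrE ?n1_ge0//; last exact: addr_ge0.
apply: (le_trans h); have := sqr_ge0 (S - weight k); nra.
Qed.

End IntegrableFourier.

Section SchwartzClass.
Variable R : realType.
Implicit Types (x k h : plane R) (f g : plane R -> R[i]) (b : bool) (a s : R) (c : R[i]).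

(* The Schwartz space as the largest space of bounded functions that is stable under
   linear combinations, partial derivatives and multiplication by coordinates. *)
Definition sclosed (Q : (plane R -> R[i]) -> Prop) := forall f, Q f ->
  [/\ exists C, forall x, n1 (f x) <= C,
      forall b, exists2 f', Q f' & pder b f f',
      forall b, Q (fun x => (crd b x)%:C * f x)
    & forall g c, Q g -> Q (fun x => f x + c * g x)].

Definition schw f := exists2 Q, sclosed Q & Q f.

Lemma sclosedZ Q f c : sclosed Q -> Q f -> Q (fun x => c * f x).
Proof.
move=> hQ Qf; have [_ _ _ lin] := hQ f Qf.
have Q0 : Q (fun=> 0).
  by have := lin f (-1) Qf; congr Q; apply/funext => x; rewrite mulN1r subrr.
have [_ _ _ lin0] := hQ _ Q0.
by have := lin0 f c Qf; congr Q; apply/funext => x; rewrite add0r.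
Qed.

Lemma sclosedD Q f g : sclosed Q -> Q f -> Q g -> Q (fun x => f x + g x).
Proof.
move=> hQ Qf Qg; have [_ _ _ lin] := hQ f Qf.
by have := lin g 1 Qg; congr Q; apply/funext => x; rewrite mul1r.
Qed.

Lemma schw_pder f b : schw f -> exists2 f', schw f' & pder b f f'.
Proof.
by move=> [Q hQ Qf]; have [_ /(_ b) [f' Qf' d] _ _] := hQ f Qf; exists f' => //; exists Q.
Qed.

Lemma schwZ f c : schw f -> schw (fun x => c * f x).
Proof. by move=> [Q hQ Qf]; exists Q => //; exact: sclosedZ. Qed.

Lemma schw_meas f : schw f -> cmeas f.
Proof. by move=> sf; apply: pder_meas => b; have [f' _ d] := schw_pder b sf; exists f'. Qed.

(** Multiplication by [1 + t ^+ 2], twice in each coordinate, stays in the class of bounded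
    functions. The square of [weight] is what [weight_conv] consumes. *)
Lemma schw_bound f : schw f -> exists2 C, 0 <= C & forall x, n1 (f x) <= C * weight x ^+ 2.
Proof.
move=> [Q hQ].
have step b g : Q g -> Q (fun x => (1 + crd b x ^+ 2)%:C * g x).
  move=> Qg; have [_ _ m _] := hQ g Qg; have [_ _ m2 _] := hQ _ (m b).
  have := sclosedD hQ Qg (m2 b); congr Q; apply/funext => x.
  by rewrite [in RHS]rmorphD [in RHS]rmorphXn /=; ring.
move=> /(step true)/(step true)/(step false)/(step false) Qg.
have [[C hC] _ _ _] := hQ _ Qg.
exists C; first exact: (le_trans (n1_ge0 _) (hC 0)).
move=> x; pose A := (1 + x.1 ^+ 2) * (1 + x.1 ^+ 2) * (1 + x.2 ^+ 2) * (1 + x.2 ^+ 2).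
have hA : n1 (A%:C * f x) <= C.
  have := hC x; congr (n1 _ <= _); rewrite /A !rmorphM /=; ring.
have e : A * weight x ^+ 2 = 1.
  have := weightM x 1; rewrite mul1r => e.
  transitivity (((1 + x.1 ^+ 2) * (1 + x.2 ^+ 2) * weight x) ^+ 2); last by rewrite e expr1n.
  by rewrite /A /=; ring.
have A0 : 0 <= A.
  by rewrite /A /= !mulr_ge0 ?(ltW (w1D_gt0 _)).
have nA : n1 (A%:C * f x) = A * n1 (f x).
  by rewrite n1_realM (ger0_norm A0).
rewrite nA in hA.
have -> : n1 (f x) = A * n1 (f x) * weight x ^+ 2 by rewrite mulrAC e mul1r.
by apply: ler_wpM2r hA; exact: sqr_ge0.
Qed.

Lemma schw_bound1 f : schw f -> exists2 C, 0 <= C & forall x, n1 (f x) <= C * weight x.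
Proof.
move=> /schw_bound[C C0 h]; exists C => // x; apply: (le_trans (h x)).
by apply: ler_wpM2l => //; exact: weight_sqr_le.
Qed.

Lemma schw_int f : schw f -> cintble (@leb2 R) f.
Proof.
by move=> sf; have [C _ h] := schw_bound1 sf; exact: le_weight_int (schw_meas sf) h.
Qed.

(** The factor [s] covers both transforms: [s = -1] is [fourier], [s = 1] is [inv_fourier] up to its
    constant. *)
Definition ftr s g k := cintegral (@leb2 R) (fun x => cis (s * dot2 k x) * g x).

Lemma ftr_int s g k : cintble (@leb2 R) g ->
  cintble (@leb2 R) (fun x => cis (s * dot2 k x) * g x).
Proof.
move=> iF; apply: (cintbleMb iF _ (fun x => n1_cis _)).
by apply: cmeas_cis; apply: measurable_funM => //; exact: measurable_dot2r.
Qed.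

(** The transform exchanges derivatives with multiplications by coordinates, so the image of a
    stable class of functions is again stable; no seminorm is estimated. *)
Lemma schw_ftr s f : s != 0 -> schw f -> schw (ftr s f).
Proof.
move=> s0 [Q hQ Qf]; exists (fun F => exists2 g, Q g & F = ftr s g); last by exists f.
have is0 : 'i%C * s%:C != 0 :> R[i].
  apply/eqP => /(congr1 (@complex.Im R)); rewrite !reimE /= mul0r mul1r add0r.
  by move=> /eqP; rewrite (negbTE s0).
move=> _ [g Qg ->].
have sg : schw g by exists Q.
have ig := schw_int sg; have [C C0 gC] := schw_bound1 sg.
have [_ dg mg lg] := hQ g Qg.
split.
- exists (2 * \int[@leb2 R]_x n1 (g x)) => k.
  rewrite -(RintegralZl 2 measurableT (cintble_n1 ig)).
  apply: n1_cintegral; [exact: ftr_int|exact: (rintbleZ 2 (cintble_n1 ig))|].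
  by move=> x; exact: n1_cisM.
- move=> b; exists (ftr s (fun x => ('i%C * s%:C) * ((crd b x)%:C * g x))).
    exists (fun x => ('i%C * s%:C) * ((crd b x)%:C * g x)) => //.
    exact: sclosedZ (mg b).
  have sxg : schw (fun x => (crd b x)%:C * g x) by exists Q.
  have [C' C'0 gC'] := schw_bound1 sxg.
  apply: (@pder_int R _ _ (@leb2 R) b (fun k x => cis (s * dot2 k x) * g x)
    (fun k x => cis (s * dot2 k x) * ('i%C * s%:C * ((crd b x)%:C * g x)))
    (fun x => 2 * (n1 ('i%C * s%:C) * (C' * weight x)))).
  + by move=> k; exact: ftr_int.
  + move=> x.
    have d1 := pder_cis (rderM (rder_cst b s) (rder_dot2 b x)).
    apply: (pder_ext (pderM d1 (pder_cst b (g x)))) => k; first by rewrite (dot2C k).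
    rewrite (dot2C k) mul0r add0r mulr0 addr0 rmorphM /=; ring.
  + by do 3 apply: rintbleZ; exact: rintble_weight.
  + move=> k x; apply: (le_trans (n1_cisM _ _)); apply: ler_wpM2l => //.
    by apply: (le_trans (n1M _ _)); apply: ler_wpM2l; [exact: n1_ge0|exact: gC'].
- move=> b; have [g' Qg' dg'] := dg b.
  have sg' : schw g' by exists Q.
  have [C' C'0 gC'] := schw_bound1 sg'.
  exists (fun x => - ('i%C * s%:C)^-1 * g' x); first exact: sclosedZ.
  apply/funext => k; rewrite /ftr.
  have ig' := schw_int sg'.
  have eE : (fun x => cis (s * dot2 k x) * (- ('i%C * s%:C)^-1 * g' x)) =
     (fun x => - ('i%C * s%:C)^-1 * (cis (s * dot2 k x) * g' x)).
    by apply/funext => x; ring.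
  rewrite eE (cintegralZ _ (ftr_int s k ig')).
  have d1 : pder b (fun x => cis (s * dot2 k x) * g x)
    (fun x => ('i%C * s%:C * (crd b k)%:C) * (cis (s * dot2 k x) * g x) +
       cis (s * dot2 k x) * g' x).
    have d0 := pder_cis (rderM (rder_cst b s) (rder_dot2 b k)).
    apply: (pder_ext (pderM d0 dg')) => // x.
    rewrite mul0r add0r rmorphM /=; ring.
  pose K := n1 ('i%C * s%:C * (crd b k)%:C) * (2 * C) + (2 * C + 2 * C').
  have b1 x : n1 (cis (s * dot2 k x) * g x) <= 2 * C * weight x.
    rewrite -mulrA; apply: (le_trans (n1_cisM _ _)).
    by apply: ler_wpM2l => //; exact: gC.
  have b2 x : n1 (cis (s * dot2 k x) * g' x) <= 2 * C' * weight x.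
    rewrite -mulrA; apply: (le_trans (n1_cisM _ _)).
    by apply: ler_wpM2l => //; exact: gC'.
  have i1 := ftr_int s k ig; have i2 := ftr_int s k ig'.
  have := pder_int0 (C := K) (cintble_meas i1) d1.
  rewrite cintegralD; [|exact: cintbleZ i1|exact: i2].
  rewrite (cintegralZ _ i1) => h.
  have c1 : 0 <= 2 * C by rewrite mulr_ge0.
  have c2 : 0 <= 2 * C' by rewrite mulr_ge0.
  have c3 : 0 <= n1 ('i%C * s%:C * (crd b k)%:C) by exact: n1_ge0.
  have /eqP : 'i%C * s%:C * (crd b k)%:C * cintegral (@leb2 R) (fun x => cis (s * dot2 k x) * g x)
    + cintegral (@leb2 R) (fun x => cis (s * dot2 k x) * g' x) = 0.
    apply: h => x.
      apply: (le_trans (b1 x)); apply: ler_wpM2r; first exact: weight_ge0.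
      rewrite /K; nra.
    apply: (le_trans (n1D _ _)); rewrite /K mulrDl; apply: lerD.
      apply: (le_trans (n1M _ _)); rewrite -[leRHS]mulrA.
      by apply: ler_wpM2l => //; exact: b1.
    apply: (le_trans (b2 x)); apply: ler_wpM2r; first exact: weight_ge0.
    by rewrite lerDr.
  rewrite addr_eq0 => /eqP e.
  apply: (mulfI is0); rewrite mulrA e.
  by rewrite mulrA mulrN mulfV// mulN1r.
- move=> F c [g2 Qg2 ->]; exists (fun x => g x + c * g2 x); first exact: lg.
  apply/funext => k; rewrite /ftr.
  have ig2 : cintble (@leb2 R) g2 by apply: schw_int; exists Q.
  rewrite -(cintegralZ _ (ftr_int s k ig2)) -cintegralD; [|exact: ftr_int|].
    by apply: eq_cintegral => x; ring.
  exact: cintbleZ (ftr_int s k ig2).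
Qed.

Lemma fourier_ftr f : fourier f = ftr (-1) f.
Proof. by apply/funext => k; rewrite /ftr; under eq_fun do rewrite mulN1r. Qed.

Lemma inv_fourier_ftr f : inv_fourier f = fun x => (((2 * pi) ^+ 2)^-1)%:C * ftr 1 f x.
Proof.
apply/funext => x; rewrite /inv_fourier /ftr; congr (_ * _).
by apply: eq_cintegral => k; rewrite mul1r dot2C.
Qed.

Lemma schw_fourier f : schw f -> schw (fourier f).
Proof. by move=> sf; rewrite fourier_ftr; apply: schw_ftr => //; rewrite oppr_eq0 oner_eq0. Qed.

Lemma schw_inv_fourier f : schw f -> schw (inv_fourier f).
Proof.
by move=> sf; rewrite inv_fourier_ftr; apply: schwZ; apply: schw_ftr => //; exact: oner_neq0.
Qed.

Definition chirp a x : R[i] := cis (a * (sqnorm2 x / 2)).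

Lemma pder_chirp b a : pder b (chirp a) (fun x => ('i%C * a%:C) * (crd b x)%:C * chirp a x).
Proof.
apply: (pder_ext (pder_cis (rderM (rder_cst b a) (rder_sqnorm2 b)))) => // x.
by rewrite mul0r add0r rmorphM /chirp /=; ring.
Qed.

(** A derivative of the chirp is the chirp times a coordinate, and a stable class absorbs coordinate
    factors. Its multiples by the chirp thus form a stable class. *)
Lemma schw_chirp a f : schw f -> schw (fun x => chirp a x * f x).
Proof.
move=> [Q hQ Qf]; exists (fun F => exists2 g, Q g & F = fun x => chirp a x * g x); last by exists f.
move=> _ [g Qg ->]; have [[C hC] dg mg lg] := hQ g Qg; split.
- by exists (2 * C) => x; apply: (le_trans (n1_cisM _ _)); apply: ler_wpM2l.
- move=> b; have [g' Qg' dg'] := dg b.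
  exists (fun x => chirp a x * (g' x + ('i%C * a%:C) * ((crd b x)%:C * g x))).
    exists (fun x => g' x + (('i%C * a%:C) * ((crd b x)%:C * g x))) => //.
    by have [_ _ _ l] := hQ _ Qg'; apply: l.
  by apply: (pder_ext (pderM (pder_chirp b a) dg')) => // x; ring.
- by move=> b; exists (fun x => (crd b x)%:C * g x) => //; apply/funext => x; ring.
- move=> F c [g2 Qg2 ->]; exists (fun x => g x + c * g2 x); first exact: lg.
  by apply/funext => x; ring.
Qed.

Lemma rder_affine b a h (f f' : plane R -> R) : rder b f f' ->
  rder b (fun x => f (scale2 a x + h)) (fun x => a * f' (scale2 a x + h)).
Proof.
move=> d x.
have e : (fun t => f (scale2 a (upd b x t) + h)) =
   (fun t => f (upd b (scale2 a x + h) (a * t + crd b h))).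
  by apply/funext => t; congr f; case: b {d}; case: x.
rewrite e.
have h1 := rder_slice (scale2 a x + h) (a * crd b x + crd b h) d.
have h2 : is_derive (crd b x) 1 (fun t : R => a * t + crd b h) a.
  have : is_derive (crd b x) 1 ((a *: id) + cst (crd b h) : R -> R) (a *: 1 + 0).
    by apply: is_deriveD.
  by rewrite /GRing.scale /= mulr1 addr0.
apply: is_derive_eq; first exact: (@is_derive1_comp _ (fun s => f (upd b (scale2 a x + h) s))
  (fun t => a * t + crd b h) (crd b x) _ _ h1 h2).
rewrite mulrC; congr (_ * f' _).
by case: b {d e h1 h2}; case: x.
Qed.

Lemma pder_affine b a h f f' : pder b f f' ->
  pder b (fun x => f (scale2 a x + h)) (fun x => a%:C * f' (scale2 a x + h)).
Proof.
move=> [d1 d2]; split.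
  by apply: (rder_ext (rder_affine a h d1)) => // x; rewrite reM /= mul0r subr0.
by apply: (rder_ext (rder_affine a h d2)) => // x; rewrite imM /= mul0r addr0.
Qed.

Lemma schw_affine a h f : a != 0 -> schw f -> schw (fun x => f (scale2 a x + h)).
Proof.
move=> a0 [Q hQ Qf]; exists (fun F => exists2 g, Q g & F = fun x => g (scale2 a x + h)); last by exists f.
move=> _ [g Qg ->]; have [[C hC] dg mg lg] := hQ g Qg; split.
- by exists C.
- move=> b; have [g' Qg' dg'] := dg b.
  exists (fun x => a%:C * g' (scale2 a x + h)); last exact: pder_affine.
  by exists (fun x => a%:C * g' x) => //; exact: sclosedZ.
- move=> b.
  exists (fun x => (a^-1)%:C * ((crd b x)%:C * g x + (- (crd b h)%:C) * g x)).
    by apply: sclosedZ => //; have [_ _ _ l] := hQ _ (mg b); apply: l.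
  apply/funext => x; rewrite -mulrDl -rmorphN -rmorphD mulrA -rmorphM /=.
  congr (_%:C * _); case: b; rewrite /= addrK mulKf//.
- move=> F c [g2 Qg2 ->]; exists (fun x => g x + c * g2 x); first exact: lg.
  by [].
Qed.

(** Continuity in the form that [fourier_inversion] asks for; bounded partial derivatives make both
    components Lipschitz. *)
Lemma schw_continuous f x : schw f -> forall (e : nat -> R) u, e n @[n --> \oo] --> (0 : R) ->
  ccvg (fun n => f (scale2 (e n) u + x)) (f x).
Proof.
move=> sf e u e0.
have key (g : plane R -> R) (D : R) : (forall b, exists2 g', rder b g g' & forall x, `|g' x| <= D) ->
    g (scale2 (e n) u + x) @[n --> \oo] --> g x.
  move=> hg.
  have lip y : `|g y - g x| <= D * `|y.1 - x.1| + D * `|y.2 - x.2|.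
    have [g1 d1 b1] := hg false; have [g2 d2 b2] := hg true.
    have := rder_mvt (x := y) (t := x.1) (s := y.1) d1 (fun u _ => b1 _).
    have := rder_mvt (x := (x.1, y.2)) (t := x.2) (s := y.2) d2 (fun u _ => b2 _).
    rewrite /upd /=; case: x y {e0} => x1 x2 [y1 y2] /= h1 h2.
    rewrite (_ : g (y1, y2) - g (x1, x2) = (g (y1, y2) - g (x1, y2)) + (g (x1, y2) - g (x1, x2))); last by ring.
    exact: (le_trans (ler_normD _ _) (lerD h2 h1)).
  apply/subr_cvg0; apply: norm_cvg0.
  apply: (@squeeze_cvgr _ _ _ _ (cst 0)
    (fun n => D * `|e n * u.1| + D * `|e n * u.2|)).
  - apply: nearW => n /=; rewrite normr_ge0 /=.
    by have := lip (scale2 (e n) u + x); rewrite /= !addrK.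
  - exact: cvg_cst.
  - have hz (c : R) : D * `|e n * c| @[n --> \oo] --> (0 : R).
      rewrite -(mulr0 D); apply: cvgM; first exact: cvg_cst.
      rewrite -(@normr0 _ R) -(mul0r c); apply: cvg_norm; apply: cvgM => //; exact: cvg_cst.
    by rewrite -(addr0 0); apply: cvgD; exact: hz.
have [f1 s1 d1] := schw_pder false sf; have [f2 s2 d2] := schw_pder true sf.
have [C1 C10 b1] := schw_bound1 s1; have [C2 C20 b2] := schw_bound1 s2.
have B1 y : n1 (f1 y) <= C1 + C2.
  apply: (le_trans (b1 y)); apply: (@le_trans _ _ C1); last by rewrite lerDl.
  by apply: ler_piMr => //; exact: weight_le1.
have B2 y : n1 (f2 y) <= C1 + C2.
  apply: (le_trans (b2 y)); apply: (@le_trans _ _ C2); last by rewrite lerDr.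
  by apply: ler_piMr => //; exact: weight_le1.
split.
  apply: (key (fun y => re (f y)) (C1 + C2)) => -[].
    by exists (fun y => re (f2 y)); [exact: d2.1|move=> y; exact: le_trans (re_le_n1 _) (B2 y)].
  by exists (fun y => re (f1 y)); [exact: d1.1|move=> y; exact: le_trans (re_le_n1 _) (B1 y)].
apply: (key (fun y => im (f y)) (C1 + C2)) => -[].
  by exists (fun y => im (f2 y)); [exact: d2.2|move=> y; exact: le_trans (im_le_n1 _) (B2 y)].
by exists (fun y => im (f1 y)); [exact: d1.2|move=> y; exact: le_trans (im_le_n1 _) (B1 y)].
Qed.

Lemma schw_fourier_int f : schw f -> cintble (@leb2 R) (fourier f).
Proof. by move=> sf; apply: schw_int; exact: schw_fourier. Qed.

Lemma schw_inversion f x : schw f ->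
  cintegral (@leb2 R) (fun k => fourier f k * cis (dot2 k x)) = ((2 * pi) ^+ 2)%:C * f x.
Proof.
move=> sf; have [C C0 fC] := schw_bound1 sf.
apply: (fourier_inversion (C := C) (schw_int sf) (schw_fourier_int sf)).
  move=> y; apply: (le_trans (fC y)).
  by apply: ler_piMr => //; exact: weight_le1.
by move=> e u; exact: schw_continuous.
Qed.

(** Feeds [fourier_L1], which involves d1, d2 and d1 d2 only: bounds on these three derivatives of
    the phase suffice. *)
Lemma cis_schw_fourier_int (u u1 u2 u12 : plane R -> R) (K : R) f : schw f ->
  rder false u u1 -> rder true u u2 -> rder false u2 u12 ->
  (forall x, `|u1 x| <= K) -> (forall x, `|u2 x| <= K) -> (forall x, `|u12 x| <= K) ->
  cintble (@leb2 R) (fun x => cis (u x) * f x) /\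
  cintble (@leb2 R) (fourier (fun x => cis (u x) * f x)).
Proof.
move=> sf d1 d2 d12 K1 K2 K12.
have [f1 sf1 df1] := schw_pder false sf; have [f2 sf2 df2] := schw_pder true sf.
have [f12 sf12 df12] := schw_pder false sf2.
have [C C0 b0] := schw_bound1 sf; have [C1 C10 b1] := schw_bound1 sf1.
have [C2 C20 b2] := schw_bound1 sf2; have [C12 C120 b12] := schw_bound1 sf12.
have K0 : 0 <= K by exact: le_trans (normr_ge0 _) (K1 0).
pose F x := cis (u x) * f x.
pose F1 x := cis (u x) * ('i%C * (u1 x)%:C * f x + f1 x).
pose F2 x := cis (u x) * ('i%C * (u2 x)%:C * f x + f2 x).
pose F12 x := cis (u x) * ('i%C * (u1 x)%:C * ('i%C * (u2 x)%:C * f x + f2 x) +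
  ('i%C * (u12 x)%:C * f x + 'i%C * (u2 x)%:C * f1 x + f12 x)).
have D1 : pder false F F1.
  by apply: (pder_ext (pderM (pder_cis d1) df1)) => // x; rewrite /F1; ring.
have D2 : pder true F F2.
  by apply: (pder_ext (pderM (pder_cis d2) df2)) => // x; rewrite /F2; ring.
have D12 : pder false F2 F12.
  apply: (pder_ext (pderM (pder_cis d1)
    (pderD (pderM (pderZ 'i%C (pder_real d12)) df1) df12))) => // x.
  by rewrite /F12; ring.
pose M := 2 * ((K + K * K) * C + K * C1 + K * C2 + (C + C1 + C2 + C12)).
have nI (a : R) z : n1 ('i%C * a%:C * z) = `|a| * n1 z.
  by rewrite -mulrA n1_iM n1_realM.
have KC : 0 <= K * C by exact: mulr_ge0. have KC1 : 0 <= K * C1 by exact: mulr_ge0.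
have KC2 : 0 <= K * C2 by exact: mulr_ge0.
have KKC : 0 <= K * (K * C) by exact: mulr_ge0.
have lift x z (c : R) : n1 z <= c * weight x -> 2 * c <= M -> n1 (cis (u x) * z) <= M * weight x.
  move=> h1 h2; apply: (le_trans (n1_cisM _ _)).
  apply: (@le_trans _ _ (2 * c * weight x)); first by rewrite -mulrA ler_wpM2l.
  by apply: ler_wpM2r h2; exact: weight_ge0.
have bI x (a : R) z (c : R) : `|a| <= K -> n1 z <= c * weight x ->
    n1 ('i%C * a%:C * z) <= (K * c) * weight x.
  by move=> h1 h2; rewrite nI -mulrA; apply: ler_pM => //; exact: n1_ge0.
have bD x z z' (c c' : R) : n1 z <= c * weight x -> n1 z' <= c' * weight x ->
    n1 (z + z') <= (c + c') * weight x.
  by move=> h1 h2; rewrite mulrDl; apply: (le_trans (n1D _ _)); exact: lerD.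
have B0 x : n1 (F x) <= M * weight x by apply: (lift _ _ C); [exact: b0|rewrite /M; lra].
have B1 x : n1 (F1 x) <= M * weight x.
  by apply: (lift _ _ (K * C + C1)); [apply: bD => //; exact: bI|rewrite /M; lra].
have B2 x : n1 (F2 x) <= M * weight x.
  by apply: (lift _ _ (K * C + C2)); [apply: bD => //; exact: bI|rewrite /M; lra].
have B12 x : n1 (F12 x) <= M * weight x.
  apply: (lift _ _ (K * (K * C + C2) + (K * C + K * C1 + C12))); last by rewrite /M; lra.
  have E1 := bD _ _ _ _ _ (bI _ _ _ _ (K2 x) (b0 x)) (b2 x).
  have E2 := bD _ _ _ _ _ (bI _ _ _ _ (K12 x) (b0 x)) (bI _ _ _ _ (K2 x) (b1 x)).
  exact: (bD _ _ _ _ _ (bI _ _ _ _ (K1 x) E1) (bD _ _ _ _ _ E2 (b12 x))).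
have mF : cmeas F.
  by apply: pder_meas => -[]; [exists F2|exists F1].
split; first exact: le_weight_int mF B0.
exact: (fourier_L1 mF D1 D2 D12 B0 B1 B2 B12).
Qed.

End SchwartzClass.

(** * Closure properties of the Schwartz class of the statement *)

Section SmoothFunctions.
Variable R : realType.
Implicit Types (x h : R * R) (f g : R * R -> R) (b : bool) (s : seq bool).

Lemma partial_quotient b f x :
  (fun t : R => t^-1 *: ((f \o shift x) (t *: (if b then (0, 1) else (1, 0))) - f x)) =
  (fun t : R => t^-1 *: (((fun r => f (upd b x r)) \o shift (crd b x)) (t *: 1) -
     f (upd b x (crd b x)))).
Proof.
apply/funext => t; rewrite upd_crd /=; congr (_ *: (f _ - _)).
by case: b; case: x => x1 x2; rewrite /upd /crd /= /GRing.scale /=;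
  apply/pair_equal_spec; split; rewrite /= /GRing.scale /= ?mulr0 ?mulr1 ?add0r.
Qed.

Lemma partialE b f x : partial b f x = 'D_1 (fun t => f (upd b x t)) (crd b x).
Proof. by rewrite /partial /derive partial_quotient. Qed.

Lemma rder_partial b f : (forall x, differentiable f x) -> rder b f (partial b f).
Proof.
move=> df x; rewrite partialE; apply: DeriveDef; last by [].
have := @diff_derivable _ _ _ f x (if b then (0, 1) else (1, 0)) (df x).
by rewrite /derivable partial_quotient.
Qed.

Lemma partial_rder b f f' : rder b f f' -> partial b f = f'.
Proof. by move=> d; apply/funext => x; rewrite partialE; have [_ <-] := d x. Qed.

Lemma differentiable_crd b x : differentiable (crd b) x.
Proof.
case: b.
  have h := @linear_differentiable R (R * R)%type R (@snd R R) x; apply: h.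
  by move=> y; exact: cvg_snd.
have h := @linear_differentiable R (R * R)%type R (@fst R R) x; apply: h.
by move=> y; exact: cvg_fst.
Qed.

Lemma smooth2_partial b f : smooth2 f -> smooth2 (partial b f).
Proof. by move=> sf s x; have := sf (rcons s b) x; rewrite /partials foldr_rcons. Qed.

Definition rapid f := forall n : nat, exists C, forall x, (1 + enorm2 x) ^+ n * `|f x| <= C.

Lemma real_schwartz_partial b f : real_schwartz f -> real_schwartz (partial b f).
Proof.
move=> [sf df]; split; first exact: smooth2_partial.
by move=> s n; have := df (rcons s b) n; rewrite /partials foldr_rcons.
Qed.

Lemma real_schwartz_diff f x : real_schwartz f -> differentiable f x.
Proof. by move=> [sf _]; have := sf [::] x. Qed.

Lemma real_schwartz_rapid f : real_schwartz f -> rapid f.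
Proof. by move=> [_ df] n; exact: (df [::] n). Qed.

Lemma real_schwartz_rder b f : real_schwartz f -> rder b f (partial b f).
Proof. by move=> sf; apply: rder_partial => x; exact: real_schwartz_diff. Qed.

(* Coinduction avoids Leibniz and chain rules for iterated partial derivatives. *)
Lemma real_schwartz_coind (Q : (R * R -> R) -> Prop) :
  (forall f, Q f -> [/\ forall x, differentiable f x, forall b, Q (partial b f) & rapid f]) ->
  forall f, Q f -> real_schwartz f.
Proof.
move=> hQ f Qf; have Qs s : Q (partials s f).
  by elim: s => [|b s IH] //=; have [_ h _] := hQ _ IH; exact: h.
by split => [s x|s n]; have [h1 _ h2] := hQ _ (Qs s); [exact: h1|exact: h2].
Qed.

Lemma enorm2_ge0 x : 0 <= enorm2 x. Proof. exact: sqrtr_ge0. Qed.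

Lemma enorm2_gt0 (n : nat) x : 0 < (1 + enorm2 x) ^+ n.
Proof. by rewrite exprn_gt0// ltr_pwDl// enorm2_ge0. Qed.

Lemma crd_enorm2 b x : `|crd b x| <= enorm2 x.
Proof.
rewrite -sqrtr_sqr /enorm2 ler_wsqrtr// /sqnorm2 /dot2 -!expr2.
by case: b => /=; rewrite ?lerDl ?lerDr sqr_ge0.
Qed.

Lemma rapidD f g : rapid f -> rapid g -> rapid (fun x => f x + g x).
Proof.
move=> hf hg n; have [C1 h1] := hf n; have [C2 h2] := hg n; exists (C1 + C2) => x.
apply: (@le_trans _ _ ((1 + enorm2 x) ^+ n * (`|f x| + `|g x|))).
  by apply: ler_wpM2l; [exact: ltW (enorm2_gt0 _ _)|exact: ler_normD].
by rewrite mulrDr lerD.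
Qed.

Lemma rapidZ c f : rapid f -> rapid (fun x => c * f x).
Proof.
move=> hf n; have [C1 h1] := hf n; exists (`|c| * C1) => x.
by rewrite normrM mulrCA ler_wpM2l.
Qed.

Lemma rapid_crd b f : rapid f -> rapid (fun x => crd b x * f x).
Proof.
move=> hf n; have [C1 h1] := hf n.+1; exists C1 => x.
apply: le_trans (h1 x); rewrite normrM exprSr -mulrA.
apply: ler_wpM2l; first exact: ltW (enorm2_gt0 _ _).
apply: ler_wpM2r => //; apply: (le_trans (crd_enorm2 b x)).
by rewrite lerDr.
Qed.

Lemma rapidM f g : rapid f -> rapid g -> rapid (fun x => f x * g x).
Proof.
move=> hf hg n; have [C1 h1] := hf n; have [C2 h2] := hg 0%N; exists (C1 * C2) => x.
rewrite normrM mulrA; have := h2 x; rewrite expr0 mul1r => h2'.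
apply: ler_pM => //; rewrite mulr_ge0//; exact: ltW (enorm2_gt0 _ _).
Qed.

Lemma rapid_affine (a : R) h f : a != 0 -> rapid f -> rapid (fun x => f (scale2 a x + h)).
Proof.
move=> a0 hf n; have [C hC] := hf n.
(* Since [x = a^-1 (y - h)], the norm of [x] is at most [|a|^-1 * (2 * enorm2 y + |h.1| + |h.2|)],
   hence [1 + enorm2 x <= K * (1 + enorm2 y)]. *)
pose K := 1 + `|a|^-1 * (2 + `|h.1| + `|h.2|).
exists (K ^+ n * C) => x; set y := scale2 a x + h.
have ai : 0 <= `|a|^-1 by rewrite invr_ge0.
have hb b : `|crd b x| <= `|a|^-1 * (enorm2 y + `|crd b h|).
  have -> : crd b x = a^-1 * (crd b y - crd b h).
    by rewrite /y; case: b; rewrite /= addrK mulKf.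
  rewrite normrM normfV; apply: ler_wpM2l => //; apply: (le_trans (ler_normB _ _)).
  by rewrite lerD2r crd_enorm2.
have hx : enorm2 x <= `|crd false x| + `|crd true x|.
  rewrite -[leRHS]ger0_norm ?addr_ge0// -sqrtr_sqr /enorm2 ler_wsqrtr//.
  rewrite /sqnorm2 /dot2 /= -!expr2 sqrrD !real_normK ?num_real//.
  by rewrite -addrA lerD2l lerDr mulrn_wge0// mulr_ge0.
have e0 := enorm2_ge0 y.
have hK : 1 + enorm2 x <= K * (1 + enorm2 y).
  have := hb false; have := hb true; rewrite /K /= => h2 h1.
  have := mulr_ge0 ai (mulr_ge0 (addr_ge0 (normr_ge0 h.1) (normr_ge0 h.2)) e0).
  have := mulr_ge0 ai (mulr_ge0 (normr_ge0 h.2) e0).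
  move: (`|a|^-1) ai h1 h2 hx => A *; nra.
have K0 : 0 <= K by rewrite addr_ge0// mulr_ge0// !addr_ge0.
apply: (@le_trans _ _ (K ^+ n * ((1 + enorm2 y) ^+ n * `|f y|))).
  rewrite mulrA -exprMn; apply: ler_wpM2r => //; apply: lerXn2r => //;
    by rewrite nnegrE ?mulr_ge0// addr_ge0// enorm2_ge0.
by apply: ler_wpM2l; [exact: exprn_ge0|exact: hC].
Qed.

Lemma real_schwartz_lin c f g : real_schwartz f -> real_schwartz g ->
  real_schwartz (fun x => f x + c * g x).
Proof.
move=> sf sg.
apply: (@real_schwartz_coind (fun F => exists f g, [/\ real_schwartz f, real_schwartz g &
  F = fun x => f x + c * g x])); last by exists f, g.
move=> _ [{sf}f [{sg}g [sf sg ->]]]; split.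
- move=> x; apply: (@differentiableD _ _ _ f (fun x => c * g x)); first exact: real_schwartz_diff.
  by apply: (@differentiableZ _ _ _ g c); exact: real_schwartz_diff.
- move=> b; exists (partial b f), (partial b g); split; [exact: real_schwartz_partial..|].
  apply: partial_rder; apply: (rder_ext (rderD (real_schwartz_rder b sf)
    (rderM (rder_cst b c) (real_schwartz_rder b sg)))) => // x.
  by rewrite mul0r add0r.
- by apply: rapidD; [|apply: rapidZ]; exact: real_schwartz_rapid.
Qed.

Lemma real_schwartzZ c f : real_schwartz f -> real_schwartz (fun x => c * f x).
Proof.
move=> sf; have := real_schwartz_lin (c - 1) sf sf.
by congr real_schwartz; apply/funext => x; ring.
Qed.

Lemma real_schwartzD f g : real_schwartz f -> real_schwartz g ->
  real_schwartz (fun x => f x + g x).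
Proof.
move=> sf sg; have := real_schwartz_lin 1 sf sg.
by congr real_schwartz; apply/funext => x; rewrite mul1r.
Qed.

(** Differentiating the product leaves a term without the coordinate, so the coinduction runs on the
    larger class of functions [crd c x * f x + g x]. *)
Lemma real_schwartz_crd c f : real_schwartz f -> real_schwartz (fun x => crd c x * f x).
Proof.
move=> sf.
apply: (@real_schwartz_coind (fun F => exists f g, [/\ real_schwartz f, real_schwartz g &
  F = fun x => crd c x * f x + g x])).
  move=> _ [{sf}f [g [sf sg ->]]]; split.
  - move=> x; apply: (@differentiableD _ _ _ (fun x => crd c x * f x) g);
      last exact: real_schwartz_diff.
    apply: (@differentiableM _ _ (crd c) f); first exact: differentiable_crd.
    exact: real_schwartz_diff.
  - move=> b; exists (partial b f), (fun x => (b == c)%:R * f x + partial b g x); split.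
    + exact: real_schwartz_partial.
    + by apply: real_schwartzD; [exact: real_schwartzZ|exact: real_schwartz_partial].
    + apply: partial_rder; apply: (rder_ext (rderD
        (rderM (@rder_crd R b c) (real_schwartz_rder b sf)) (real_schwartz_rder b sg))) => // x.
      by ring.
  - by apply: rapidD; [apply: rapid_crd|]; exact: real_schwartz_rapid.
exists f, (fun x => 0 * f x); split => //; first exact: real_schwartzZ.
by apply/funext => x; rewrite mul0r addr0.
Qed.

(** The invariant for the coinduction on products: sums are included because the Leibniz rule turns
    one product into two. *)
Inductive product_span : (R * R -> R) -> Prop :=
| product_span_mul f g : real_schwartz f -> real_schwartz g ->
    product_span (fun x => f x * g x)
| product_span_add F G : product_span F -> product_span G ->
    product_span (fun x => F x + G x).

Lemma real_schwartzM f g : real_schwartz f -> real_schwartz g ->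
  real_schwartz (fun x => f x * g x).
Proof.
move=> sf sg; apply: (@real_schwartz_coind product_span); last exact: product_span_mul.
move=> F; elim => {F sf sg f g} [f g sf sg|F G _ [dF pF rF] _ [dG pG rG]]; split.
- by move=> x; apply: (@differentiableM _ _ f g); exact: real_schwartz_diff.
- move=> b; rewrite (partial_rder (rderM (real_schwartz_rder b sf) (real_schwartz_rder b sg))).
  by apply: product_span_add; apply: product_span_mul => //; exact: real_schwartz_partial.
- by apply: rapidM; exact: real_schwartz_rapid.
- by move=> x; apply: (@differentiableD _ _ _ F G).
- move=> b; rewrite (partial_rder (rderD (rder_partial b dF) (rder_partial b dG))).
  exact: product_span_add.
- exact: rapidD.
Qed.

Lemma real_schwartz_affine (a : R) h f : a != 0 -> real_schwartz f ->
  real_schwartz (fun x => f (scale2 a x + h)).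
Proof.
move=> a0 sf.
apply: (@real_schwartz_coind (fun F => exists2 f, real_schwartz f &
  F = fun x => f (scale2 a x + h))); last by exists f.
move=> _ [{sf}f sf ->]; split.
- move=> x; apply: (@differentiable_comp _ _ _ _ (fun x : R * R => a *: x + h) f).
    apply: (@differentiableD _ _ _ (fun x : R * R => a *: x) (cst h)) => //.
  exact: real_schwartz_diff.
- move=> b; exists (fun x => a * partial b f x).
    by apply: real_schwartzZ; exact: real_schwartz_partial.
  by apply: partial_rder; exact: rder_affine (real_schwartz_rder b sf).
- by apply: rapid_affine => //; exact: real_schwartz_rapid.
Qed.

Lemma schwartz_schw (f : R * R -> R[i]) : schwartz f -> schw f.
Proof.
move=> sf; exists (@schwartz R) => //.
move=> {sf}f [s1 s2]; split.
- have [C1 h1] := real_schwartz_rapid s1 0%N; have [C2 h2] := real_schwartz_rapid s2 0%N.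
  exists (C1 + C2) => x; have := h1 x; have := h2 x; rewrite !expr0 !mul1r => h2' h1'.
  exact: lerD.
- move=> b; exists (fun x => partial b (fun y => re (f y)) x +i* partial b (fun y => im (f y)) x).
    by split => /=; exact: real_schwartz_partial.
  by split => /=; exact: real_schwartz_rder.
- move=> b; split.
    under eq_fun do rewrite reM /= mul0r subr0; exact: real_schwartz_crd.
  under eq_fun do rewrite imM /= mul0r addr0; exact: real_schwartz_crd.
- move=> g c [g1 g2]; split.
    have := real_schwartz_lin (- im c) (real_schwartz_lin (re c) s1 g1) g2.
    by congr real_schwartz; apply/funext => x; rewrite !reimE; ring.
  have := real_schwartz_lin (im c) (real_schwartz_lin (re c) s2 g2) g1.
  by congr real_schwartz; apply/funext => x; rewrite !reimE; ring.
Qed.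

(** The scattering kernel is tested against [schwartz] functions only, so membership of the image
    profile in [schw] would not be enough. *)
Lemma schwartz_sqmod (f : R * R -> R[i]) : schwartz f -> schwartz (fun x => (sqmod (f x))%:C).
Proof.
move=> [s1 s2]; split => /=.
  have := real_schwartzD (real_schwartzM s1 s1) (real_schwartzM s2 s2).
  by congr real_schwartz; apply/funext => x; rewrite /sqmod !expr2.
have := real_schwartzZ 0 s1.
by congr real_schwartz; apply/funext => x; rewrite mul0r.
Qed.

Lemma schwartz_affine (a : R) h (f : R * R -> R[i]) : a != 0 -> schwartz f ->
  schwartz (fun x => f (scale2 a x + h)).
Proof. by move=> a0 [s1 s2]; split; [exact: (real_schwartz_affine h a0 s1)|exact: (real_schwartz_affine h a0 s2)]. Qed.

(* The mean value theorem over a unit step compares [u'] with an increment of [u]. *)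
Lemma rder_bounded b (u u' u'' : plane R -> R) (B M : R) : rder b u u' -> rder b u' u'' ->
  (forall x, `|u x| <= B) -> (forall x, `|u'' x| <= M) -> forall x, `|u' x| <= 2 * B + M.
Proof.
move=> d1 d2 uB uM x.
have [|||c + e] := @MVT_segment R (fun t => u (upd b x t)) (fun t => u' (upd b x t))
  (crd b x) (crd b x + 1).
- by rewrite lerDl.
- by move=> y _; exact: rder_slice.
- by apply: continuous_subspaceT; exact: (@rder_continuous _ b u u' x d1).
rewrite in_itv /= => /andP[c1 c2].
have := rder_mvt (x := x) (t := c) (s := crd b x) d2 (fun y _ => uM _).
rewrite upd_crd => h.
have hc : `|crd b x - c| <= 1 by rewrite distrC ger0_norm ?subr_ge0// lerBlDl.
have M0 : 0 <= M by exact: le_trans (normr_ge0 _) (uM x).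
have h1 : `|u' x - u' (upd b x c)| <= M by apply: (le_trans h); rewrite ler_piMr.
have h2 : `|u' (upd b x c)| <= 2 * B.
  have -> : u' (upd b x c) = u (upd b x (crd b x + 1)) - u (upd b x (crd b x)).
    by rewrite e addrAC subrr add0r mulr1.
  apply: (le_trans (ler_normB _ _)); rewrite mulr_natl mulr2n; exact: lerD.
have -> : u' x = u' (upd b x c) + (u' x - u' (upd b x c)) by ring.
by apply: (le_trans (ler_normD _ _)); exact: lerD.
Qed.

(* Only two derivatives of the realization are bounded, so the product is not a Schwartz
   function, but it is still in the domain of [fresnel]. *)
Lemma realization_fourier_int (v : R * R -> R) (B tau a : R) (f : plane R -> R[i]) :
  smooth2 v -> bounded_second_derivatives v -> (forall x, `|v x| <= B) -> schw f ->
  cintble (@leb2 R) (fun x => cis (tau * v (scale2 a x)) * f x) /\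
  cintble (@leb2 R) (fourier (fun x => cis (tau * v (scale2 a x)) * f x)).
Proof.
move=> sv [M hM] vB sf.
have dv b : rder b v (partial b v) by apply: rder_partial => x; exact: (sv [::] x).
have dv2 b c : rder b (partial c v) (partial b (partial c v)).
  by apply: rder_partial => x; exact: (sv [:: c] x).
have vM b c x : `|partial b (partial c v) x| <= M by exact: (hM [:: b; c] x).
have v1 b x : `|partial b v x| <= 2 * B + M by exact: (rder_bounded (dv b) (dv2 b b)).
have B0 : 0 <= B by exact: le_trans (normr_ge0 _) (vB (0, 0)).
have M0 : 0 <= M by exact: le_trans (normr_ge0 _) (vM true true (0, 0)).
have dA b (g g' : plane R -> R) (c : R) : rder b g g' ->
    rder b (fun x => c * g (scale2 a x)) (fun x => c * (a * g' (scale2 a x))).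
  move=> d; apply: (rder_ext (rderM (rder_cst b c) (rder_affine a 0 d))) => x.
    by rewrite addr0.
  by rewrite addr0 mul0r add0r.
pose K := `|tau| * (`|a| * (2 * B + M)) + `|tau| * (`|a| * (`|a| * M)).
have K1 : 0 <= `|tau| * (`|a| * (2 * B + M)) by rewrite !mulr_ge0// addr_ge0// mulr_ge0.
have K2 : 0 <= `|tau| * (`|a| * (`|a| * M)) by rewrite !mulr_ge0.
have h1 b x : `|tau * (a * partial b v (scale2 a x))| <= K.
  rewrite !normrM; apply: (@le_trans _ _ (`|tau| * (`|a| * (2 * B + M)))).
    by do 2 apply: ler_wpM2l => //.
  by rewrite lerDl.
apply: (cis_schw_fourier_int (K := K)
  (u12 := fun x => tau * (a * (a * partial false (partial true v) (scale2 a x)))) sf (dA false _ _ tau (dv false)) (dA true _ _ tau (dv true))).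
- apply: (rder_ext (rderM (rder_cst false tau) (dA false _ _ a (dv2 false true)))) => // x.
  by rewrite mul0r add0r.
- exact: h1.
- exact: h1.
- move=> x; rewrite !normrM; apply: (@le_trans _ _ (`|tau| * (`|a| * (`|a| * M)))).
    by do 3 apply: ler_wpM2l => //.
  by rewrite lerDr.
Qed.

End SmoothFunctions.

(** * The image of a realization *)

Section Optics.
Variable R : realType.
Implicit Types (x k y : plane R) (F f g X : plane R -> R[i]) (s : R).

Lemma realc_neq0 (a : R) : a != 0 -> a%:C != 0 :> R[i].
Proof. by move=> a0; apply/eqP => /(congr1 (@complex.Re R)) /= /eqP; exact/negP. Qed.

Lemma sqmodV (z : R[i]) : sqmod z^-1 = (sqmod z)^-1.
Proof.
have [->|z0] := eqVneq z 0; first by rewrite invr0 /sqmod /= expr0n addr0 invr0.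
apply: (mulfI (x := sqmod z)); first by rewrite sqmod_eq0.
by rewrite -sqmodM !divff// ?sqmod_eq0// /sqmod /= expr0n addr0 expr1n.
Qed.

Lemma sqmod_i : sqmod 'i%C = 1 :> R.
Proof. by rewrite /sqmod /= expr0n add0r expr1n. Qed.

Lemma dot2Zl s x k : dot2 (scale2 s x) k = s * dot2 x k.
Proof. by rewrite /dot2 /=; ring. Qed.

Lemma sqnorm2B x k : sqnorm2 (x - k) = sqnorm2 x - 2 * dot2 x k + sqnorm2 k.
Proof. by rewrite /sqnorm2 /dot2 /=; ring. Qed.

Lemma chirp_meas s : cmeas (chirp s : plane R -> R[i]).
Proof. by apply: (@pder_meas R) => b; eexists; exact: pder_chirp. Qed.

Lemma chirp_int s f : cintble (@leb2 R) f -> cintble (@leb2 R) (fun x => chirp s x * f x).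
Proof.
move=> fi; apply: (cintbleMb (C := 2) fi); first exact: chirp_meas.
by move=> x; exact: n1_cis.
Qed.

Lemma fresnel_fourier F s x : s != 0 -> cintble (@leb2 R) F -> cintble (@leb2 R) (fourier F) ->
  cintegral (@leb2 R) (fun k => fourier F k * (cis (dot2 k x) * cis (- (s * (sqnorm2 k / 2))))) =
  (2 * pi)%:C / ('i%C * s%:C) *
  (chirp s^-1 x * fourier (fun x' => chirp s^-1 x' * F x') (scale2 s^-1 x)).
Proof.
move=> s0 iF iF'; rewrite (fresnel x s0 iF iF'); congr (_ * _).
rewrite fourierE -(@cintegralZ _ _ _ _ (chirp s^-1 x)); last first.
  by apply: fourier_int; exact: chirp_int.
apply: eq_cintegral => x'.
have -> : cis (sqnorm2 (x - x') / 2 / s) =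
    chirp s^-1 x * (cis (- dot2 (scale2 s^-1 x) x') * chirp s^-1 x') :> R[i].
  rewrite /chirp -!(@cisD R); congr cis; rewrite sqnorm2B dot2Zl.
  by field.
by rewrite (mulrCA (F x')) (mulrCA (F x')) (mulrC (F x')).
Qed.

Lemma inv_fourier_fresnel F s x : s != 0 -> cintble (@leb2 R) F -> cintble (@leb2 R) (fourier F) ->
  inv_fourier (fun k => cis (- (s * (sqnorm2 k / 2))) * fourier F k) x =
  ((2 * pi)%:C * ('i%C * s%:C))^-1 *
  (chirp s^-1 x * fourier (fun x' => chirp s^-1 x' * F x') (scale2 s^-1 x)).
Proof.
move=> s0 iF iF'; rewrite /inv_fourier.
transitivity ((((2 * pi) ^+ 2)^-1)%:C * cintegral (@leb2 R) (fun k => fourier F k *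
    (cis (dot2 k x) * cis (- (s * (sqnorm2 k / 2)))))).
  by congr (_ * _); apply: eq_cintegral => k; rewrite mulrA mulrC.
rewrite fresnel_fourier// mulrA; congr (_ * _).
have p0 : (2 * pi)%:C != 0 :> R[i].
  by apply: realc_neq0; rewrite mulf_neq0// gt_eqF// pi_gt0.
rewrite fmorphV rmorphXn /= expr2 !invfM; move: ((2 * pi)%:C) p0 => p p0.
by rewrite mulrA divfK.
Qed.

Lemma fourier_affine s f x k : s != 0 -> cintble (@leb2 R) f ->
  fourier (fun k => f (scale2 s k + x)) k =
  (s ^- 2)%:C * cis (dot2 k x / s) * fourier f (scale2 s^-1 k).
Proof.
move=> s0 fi; rewrite [in RHS]fourierE.
have [i1 ->] := cint_affine x s0 (fourier_int (scale2 s^-1 k) fi).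
set J := cintegral _ _.
have -> : fourier (fun k => f (scale2 s k + x)) k = cis (dot2 k x / s) * J.
  rewrite fourierE -(@cintegralZ _ _ _ _ (cis (dot2 k x / s))) //.
  apply: eq_cintegral => u; rewrite (mulrA (cis _)) -(@cisD R); congr (cis _ * _).
  by rewrite dot2D !dot2Zl (dot2C k (scale2 s u)) dot2Zl (dot2C u); field.
rewrite (mulrC (s ^- 2)%:C) -(mulrA (cis _)); congr (_ * _).
rewrite mulrA -rmorphM /= mulVf ?mul1r//.
by rewrite expf_neq0.
Qed.

(** In the variable [k = x / s1] the curvature [a] of the incoming field and the curvature [c] left
    by lens and detector merge into one quadratic phase, so the integral over the lens plane is
    again of the form treated by [fresnel_fourier]. *)
Lemma imaging_phase (a b c s1 s' r : R) (y x k : plane R) : s1 != 0 -> s' != 0 ->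
  a = s1^-1 -> b = - r / s1 -> c = - s' / s1 ^+ 2 - a -> k = scale2 s1^-1 x ->
  cis (dot2 x (scale2 b y)) * (chirp a x * chirp c x) =
  cis (dot2 k (scale2 (- r) y)) * cis (- (s' * (sqnorm2 k / 2))) :> R[i].
Proof.
move=> s10 s'0 -> -> -> ->; rewrite /chirp -!(@cisD R); congr cis.
by rewrite /sqnorm2 /dot2 /=; field.
Qed.

Variables (omega c0 c1 zint zobs zi : R).
Hypotheses (homega : 0 < omega) (hc0 : 0 < c0) (hc1 : 0 < c1)
  (hzint : 0 < zint) (hzobs : zint < zobs) (hzi : 0 < zi).

(* The chirp is unimodular: the squared modulus of the window is the profile of the image. *)
Definition image_window (Psi : plane R -> R[i]) (y : plane R) k : R[i] :=
  chirp (c0 * zint / omega)^-1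
    (scale2 (c0 * zint / omega) k + scale2 (- (eff_distance c0 c1 zint zobs / zi)) y) *
  Psi (scale2 (c0 * zint / omega) k + scale2 (- (eff_distance c0 c1 zint zobs / zi)) y).

Lemma eff_distance_gt0 : 0 < eff_distance c0 c1 zint zobs.
Proof. by rewrite addr_gt0 ?subr_gt0// mulr_gt0// divr_gt0. Qed.

Lemma scale2A (a b : R) x : scale2 a (scale2 b x) = scale2 (a * b) x.
Proof. by rewrite /scale2 /= !mulrA. Qed.

Lemma propagator_chirp (c : R) k z : propagator omega c k z = cis (- (z * c / omega * (sqnorm2 k / 2))).
Proof.
rewrite /propagator; congr (cis (- _)); field.
by rewrite gt_eqF.
Qed.

Variables (y : plane R) (v : plane R -> R) (eps gamma : R) (Psi : plane R -> R[i]).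
Let X x : R[i] := cis (omega * (c0^-1 - c1^-1) * v (scale2 (eps `^ (gamma - 2^-1))^-1 x)).
(** All that the optical computation asks of a realization: its phase factor sends [schw] into the
    domain of [fresnel]. *)
Hypothesis hX : forall f, schw f ->
  cintble (@leb2 R) (fun x => X x * f x) /\ cintble (@leb2 R) (fourier (fun x => X x * f x)).
Hypothesis hPsi : schw Psi.

Let s0 := zint * c0 / omega.
Let s1 := (zobs - zint) * c1 / omega.
Let f0 := inv_fourier (fun k => cis (- (s0 * (sqnorm2 k / 2))) * fourier Psi k).

Lemma s0_gt0 : 0 < s0. Proof. by rewrite divr_gt0// mulr_gt0. Qed.
Lemma s1_gt0 : 0 < s1. Proof. by rewrite divr_gt0// mulr_gt0// subr_gt0. Qed.

Lemma schw_f0 : schw f0.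
Proof.
apply: schw_inv_fourier.
have -> : (fun k => cis (- (s0 * (sqnorm2 k / 2))) * fourier Psi k) =
  (fun k => chirp (- s0) k * fourier Psi k).
  by apply/funext => k; rewrite /chirp mulNr.
by apply: schw_chirp; exact: schw_fourier.
Qed.

Lemma observed_fieldE x : observed_field omega c0 c1 zint zobs v eps gamma Psi x =
  ((2 * pi)%:C * ('i%C * s1%:C))^-1 *
  (chirp s1^-1 x * fourier (fun x' => chirp s1^-1 x' * (X x' * f0 x')) (scale2 s1^-1 x)).
Proof.
have [i1 i2] := hX schw_f0.
have e0 : (fun k' => propagator omega c0 k' zint * fourier Psi k') =
    (fun k => cis (- (s0 * (sqnorm2 k / 2))) * fourier Psi k).
  by apply/funext => k'; rewrite propagator_chirp.
have e1 : (fun k => propagator omega c1 k (zobs - zint) * fourier (fun x => X x * f0 x) k) =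
    (fun k => cis (- (s1 * (sqnorm2 k / 2))) * fourier (fun x => X x * f0 x) k).
  by apply/funext => k; rewrite propagator_chirp.
rewrite /observed_field /scattering_operator e0.
transitivity (inv_fourier (fun k => cis (- (s1 * (sqnorm2 k / 2))) *
  fourier (fun x => X x * f0 x) k) x); last exact: inv_fourier_fresnel (lt0r_neq0 s1_gt0) i1 i2.
exact: (congr1 (fun g => inv_fourier g x) e1).
Qed.

Lemma f0E x : f0 x = ((2 * pi)%:C * ('i%C * s0%:C))^-1 *
  (chirp s0^-1 x * fourier (fun x' => chirp s0^-1 x' * Psi x') (scale2 s0^-1 x)).
Proof.
apply: inv_fourier_fresnel; first exact: lt0r_neq0 s0_gt0.
  exact: schw_int.
exact: schw_fourier_int.
Qed.

Let zt := eff_distance c0 c1 zint zobs.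
(** Propagation from the interface contributes the curvature [s1^-1]; lens and detector together
    contribute [- (omega / (c1 * zt))]. Their sum, times [s1 ^+ 2] for the change of variable, is
    [- s']. Likewise [r] is the tilt towards the detector point [y] in the new variable. *)
Let s' := - (s1 * (zint * (c0 / c1)) / zt).
Let r := (zobs - zint) / zi.
Let Ft x := chirp s1^-1 x * (X x * f0 x).

Lemma s'_neq0 : s' != 0.
Proof.
rewrite oppr_eq0 gt_eqF// divr_gt0 ?eff_distance_gt0//.
by rewrite mulr_gt0 ?s1_gt0// mulr_gt0// divr_gt0.
Qed.

(** The part [zi^-1] of the inverse focal length cancels the curvature of the propagation to the
    detector; the part [zt^-1] is left. *)
Lemma lens_phase x : lens omega c0 c1 zint zobs zi x * cis (omega * sqnorm2 (y - x) / (2 * zi * c1)) =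
  cis (omega * sqnorm2 y / (2 * zi * c1)) *
  (cis (dot2 x (scale2 (- (omega / (c1 * zi))) y)) * chirp (- (omega / (c1 * zt))) x).
Proof.
have n1 : c1 != 0 by rewrite gt_eqF.
have n2 : zi != 0 by rewrite gt_eqF.
have n3 : zt != 0 by rewrite gt_eqF// eff_distance_gt0.
rewrite /lens /chirp -!(@cisD R); congr cis.
rewrite /focal_length -/zt invrM ?unitfE ?invr_eq0; last 2 first.
- by rewrite mulf_neq0.
- by rewrite gt_eqF// addr_gt0// invr_gt0// eff_distance_gt0.
rewrite invrK sqnorm2B /sqnorm2 /dot2 /=; field.
by rewrite n1 n2 n3.
Qed.

Lemma Ft_int : cintble (@leb2 R) Ft /\ cintble (@leb2 R) (fourier Ft).
Proof.
have -> : Ft = (fun x => X x * (chirp s1^-1 x * f0 x)).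
  by apply/funext => x; exact: mulrCA.
by apply: hX; apply: schw_chirp; exact: schw_f0.
Qed.

Lemma image_integrand_assoc (A B C D E F : R[i]) :
  A * (D * C) * (B * (F * E)) = A * B * (C * (F * (D * E))).
Proof. by ring. Qed.

Lemma curvature_gap (s t q : R) : s != 0 -> t != 0 ->
  - - (s * q / t) / s ^+ 2 - s^-1 = (q - t) / (s * t).
Proof. by move=> h1 h2; field; rewrite h1 h2. Qed.

Lemma image_integrand x :
  observed_field omega c0 c1 zint zobs v eps gamma Psi x * lens omega c0 c1 zint zobs zi x *
    cis (omega * sqnorm2 (y - x) / (2 * zi * c1)) =
  ((2 * pi)%:C * ('i%C * s1%:C))^-1 * cis (omega * sqnorm2 y / (2 * zi * c1)) *
  (fourier Ft (scale2 s1^-1 x) * (cis (dot2 (scale2 s1^-1 x) (scale2 (- r) y)) *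
     cis (- (s' * (sqnorm2 (scale2 s1^-1 x) / 2))))).
Proof.
rewrite -(mulrA (observed_field _ _ _ _ _ _ _ _ _ _)) lens_phase observed_fieldE.
rewrite -/Ft.
have h : cis (dot2 x (scale2 (- (omega / (c1 * zi))) y)) *
    (chirp s1^-1 x * chirp (- (omega / (c1 * zt))) x) =
    cis (dot2 (scale2 s1^-1 x) (scale2 (- r) y)) *
    cis (- (s' * (sqnorm2 (scale2 s1^-1 x) / 2))) :> R[i].
  apply: imaging_phase => //.
  - by rewrite gt_eqF ?s1_gt0.
  - exact: s'_neq0.
  - rewrite /r /s1; field.
    by rewrite !gt_eqF ?subr_gt0.
  - have z1 : zobs - zint != 0 by rewrite gt_eqF ?subr_gt0.
    have e1 : s1 != 0 by rewrite gt_eqF ?s1_gt0.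
    have zt0 : zt != 0 by rewrite gt_eqF ?eff_distance_gt0.
    have -> : - s' / s1 ^+ 2 - s1^-1 = (zint * (c0 / c1) - zt) / (s1 * zt).
      exact: curvature_gap.
    have -> : zint * (c0 / c1) - zt = - (zobs - zint) by rewrite /zt /eff_distance; ring.
    move: zt0; rewrite -/zt; move: zt => t t0; rewrite /s1; field.
    by rewrite z1 t0 !gt_eqF.
by rewrite -h; exact: image_integrand_assoc.
Qed.

Let m := zt / zi.

Lemma image_windowE x : fourier (image_window Psi y) x =
  (s0 ^- 2)%:C * cis (dot2 x (scale2 (- m) y) / s0) *
  fourier (fun x' => chirp s0^-1 x' * Psi x') (scale2 s0^-1 x).
Proof.
rewrite -fourier_affine; last 2 first.
- by rewrite gt_eqF ?s0_gt0.
- by apply: chirp_int; exact: schw_int.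
by congr (fourier _ x); apply/funext => k; rewrite /image_window -/zt -/m /s0 (mulrC c0).
Qed.

Lemma chirp_window_assoc (A B C D E F S : R[i]) : S != 0 ->
  A * (B * (C * (D * F))) * E = C * S * (S^-1 * (A * (B * (D * E))) * F).
Proof. by move=> S0; field. Qed.

Lemma image_windowX_assoc (A B C D E : R[i]) : C * (B * (A * (E * D))) = E * (B * (A * D) * C).
Proof. by ring. Qed.

Lemma window_exponent (b c q : R) x : dot2 x (scale2 (- q) y) * c =
  - (b + c) * (sqnorm2 x / 2) + (b * (sqnorm2 x / 2) +
    (c * (sqnorm2 x / 2) - dot2 (scale2 (q * c) y) x)).
Proof. by rewrite /dot2 /=; field. Qed.

(** On the left stand the squared moduli of the constants met in [image_integral]; the first factor
    on the right will cancel the prefactor of [optical_image]. *)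
Lemma imaging_gain (p : R) : p != 0 ->
  ((2 * p) ^+ 2 * (1 * s1 ^+ 2))^-1 * 1 *
   ((s1 ^+ 2) ^+ 2 * ((2 * p) ^+ 2 * (1 * s' ^+ 2)^-1 * 1 *
     (((2 * p) ^+ 2 * (1 * s0 ^+ 2))^-1 * (s0 ^+ 2) ^+ 2))) =
  (omega / (2 * p * c1 * zi)) ^- 2 * (m ^+ 2 / (2 * p) ^+ 4).
Proof.
move=> p0.
have z1 : zobs - zint != 0 by rewrite gt_eqF ?subr_gt0.
have zt0 : zt != 0 by rewrite gt_eqF ?eff_distance_gt0.
rewrite /s' /m; move: zt zt0 => t t0; rewrite /r /s1 /s0; field.
by rewrite z1 t0 p0 !gt_eqF.
Qed.

Lemma window_tilt : s'^-1 * - r = m / s0.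
Proof.
have z1 : zobs - zint != 0 by rewrite gt_eqF ?subr_gt0.
have zt0 : zt != 0 by rewrite gt_eqF ?eff_distance_gt0.
rewrite /s' /m; move: zt zt0 => t t0; rewrite /r /s1 /s0; field.
by rewrite z1 t0 !gt_eqF.
Qed.

(** The imaging condition: the curvatures of the three Fresnel integrals add up to 0. It rests on
    the form of the effective distance, with the first leg rescaled by [c0 / c1]. *)
Lemma window_curvature : s'^-1 = - (s1^-1 + s0^-1).
Proof.
have z1 : zobs - zint != 0 by rewrite gt_eqF ?subr_gt0.
have e1 : c0 != 0 by rewrite gt_eqF.
have e2 : c1 != 0 by rewrite gt_eqF.
have e3 : omega != 0 by rewrite gt_eqF.
have e4 : zint != 0 by rewrite gt_eqF.
have z1p : 0 < zobs - zint by rewrite subr_gt0.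
rewrite /s' /s1 /s0 /zt /eff_distance; move: (zobs - zint) z1 z1p => z z0 zp.
have e5 : zint * c0 + z * c1 != 0 by rewrite gt_eqF// addr_gt0// mulr_gt0.
have -> : zint * (c0 / c1) + z = (zint * c0 + z * c1) / c1 by field.
field.
by rewrite ?e1 ?e2 ?e3 ?e4 ?z0 ?e5.
Qed.

(** Everything that multiplies the phase factor [X] in the interface plane. The chirp inside [f0]
    cancels the other two, and the tilt that remains is the modulation caused by the shift in
    [image_window]. *)
Lemma chirp_window x : chirp s'^-1 x * (chirp s1^-1 x * f0 x) *
    cis (- dot2 (scale2 s'^-1 (scale2 (- r) y)) x) =
  ((2 * pi)%:C * ('i%C * s0%:C))^-1 * (s0 ^+ 2)%:C * fourier (image_window Psi y) x.
Proof.
have e0 : s0 != 0 by rewrite gt_eqF ?s0_gt0.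
rewrite image_windowE f0E.
have -> : cis (dot2 x (scale2 (- m) y) / s0) =
    chirp s'^-1 x * (chirp s1^-1 x * (chirp s0^-1 x *
    cis (- dot2 (scale2 s'^-1 (scale2 (- r) y)) x))) :> R[i].
  rewrite /chirp -!(@cisD R); congr cis.
  have -> : scale2 s'^-1 (scale2 (- r) y) = scale2 (m / s0) y.
    by rewrite scale2A; congr (scale2 _ y); exact: window_tilt.
  have -> : s'^-1 = - (s1^-1 + s0^-1) by exact: window_curvature.
  exact: window_exponent.
have -> : (s0 ^- 2)%:C = ((s0 ^+ 2)%:C)^-1 :> R[i] by rewrite fmorphV.
have : (s0 ^+ 2)%:C != 0 :> R[i] by apply: realc_neq0; rewrite expf_neq0.
by move=> S0; exact: (chirp_window_assoc _ _ _ _ _ _ S0).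
Qed.

Lemma schw_image_window : schw (image_window Psi y).
Proof.
apply: (@schw_affine _ (c0 * zint / omega) _ (fun x => chirp (c0 * zint / omega)^-1 x * Psi x)).
  by rewrite (mulrC c0) gt_eqF ?s0_gt0.
exact: schw_chirp.
Qed.

(** Another application of [fresnel_fourier] carries the integral from the lens plane back to the
    interface plane, where [X] multiplies an explicit function. Of the constant only [sqmod K] is
    recorded, since the image is a squared modulus. *)
Lemma image_integral : exists2 K : R[i], sqmod K = (omega / (2 * pi * c1 * zi)) ^- 2 *
   (m ^+ 2 / (2 * pi) ^+ 4) &
  cintegral (@leb2 R) (fun x =>
      observed_field omega c0 c1 zint zobs v eps gamma Psi x * lens omega c0 c1 zint zobs zi x *
      cis (omega * sqnorm2 (y - x) / (2 * zi * c1))) =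
  K * cintegral (@leb2 R) (fun x => X x * fourier (image_window Psi y) x).
Proof.
have e0 : s0 != 0 by rewrite gt_eqF ?s0_gt0.
have e1 : s1 != 0 by rewrite gt_eqF ?s1_gt0.
have [Fi Fi'] := Ft_int.
(* [K1] comes from the observed field and the detector phase, [K2] from the Fresnel integral over
   the lens plane, [K3] from the field at the interface; the factor [s1 ^+ 2] between them is the
   Jacobian of [x = s1 k]. *)
pose K1 := ((2 * pi)%:C * ('i%C * s1%:C))^-1 * cis (omega * sqnorm2 y / (2 * zi * c1)).
pose K2 := (2 * pi)%:C / ('i%C * s'%:C) * chirp s'^-1 (scale2 (- r) y).
pose K3 := ((2 * pi)%:C * ('i%C * s0%:C))^-1 * (s0 ^+ 2)%:C.
exists (K1 * ((s1 ^+ 2)%:C * (K2 * K3))).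
  rewrite /K1 /K2 /K3 !sqmodM !sqmodV !sqmodM !sqmod_cis !sqmod_i !sqmod_real.
  have p0 : pi != 0 :> R by rewrite gt_eqF ?pi_gt0.
  exact: imaging_gain.
pose h k := fourier Ft k * (cis (dot2 k (scale2 (- r) y)) * cis (- (s' * (sqnorm2 k / 2)))).
have hi : cintble (@leb2 R) h.
  apply: (cintbleMb' (C := 4) Fi').
    apply: cmeasM; last first.
      have := chirp_meas (- s'); congr cmeas.
      by apply/funext => k; rewrite /chirp mulNr.
    apply: cmeas_cis; have := measurable_dot2r (scale2 (- r) y).
    by congr measurable_fun; apply/funext => k; exact: dot2C.
  move=> k; apply: (le_trans (n1M _ _)); rewrite (_ : 4 = 2 * 2 :> R) -?natrM//; rewrite natrM.
  by apply: ler_pM; rewrite ?n1_ge0 ?n1_cis.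
have [hi1 e2] := cint_affine 0 (invr_neq0 e1) hi.
transitivity (cintegral (@leb2 R) (fun x => K1 * h (scale2 s1^-1 x + 0))).
  by apply: eq_cintegral => x; rewrite image_integrand addr0.
rewrite (@cintegralZ _ _ _ _ K1)// -[RHS](mulrA K1); apply: (congr1 ( *%R K1)).
transitivity ((s1 ^+ 2)%:C * cintegral (@leb2 R) h).
  have ee : (s1 ^+ 2)%:C * (s1^-1 ^+ 2)%:C = 1 :> R[i].
    by rewrite -(rmorphM (@real_complex R)) /= exprVn divff ?expf_neq0.
  by rewrite e2 (mulrA (s1 ^+ 2)%:C) ee mul1r.
rewrite -[RHS](mulrA (s1 ^+ 2)%:C); apply: (congr1 ( *%R (s1 ^+ 2)%:C)).
transitivity (K2 * fourier (fun x' => chirp s'^-1 x' * Ft x') (scale2 s'^-1 (scale2 (- r) y))).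
  rewrite -(mulrA ((2 * pi)%:C / _)); exact: (fresnel_fourier _ s'_neq0 Fi Fi').
rewrite -[RHS](mulrA K2); apply: (congr1 ( *%R K2)).
rewrite -cintegralZ; last by have [] := hX (schw_fourier schw_image_window).
rewrite fourierE; apply: eq_cintegral => x.
have := chirp_window x.
rewrite -/K3 /Ft; move: (chirp _ _) (chirp _ _) (cis _) (f0 x) (X x) (fourier _ x) => A B C D E F e.
by rewrite (mulrCA K3) -e; exact: image_windowX_assoc.
Qed.

Theorem optical_imageE : optical_image omega c0 c1 zint zobs zi v eps gamma Psi y =
  m ^+ 2 / (2 * pi) ^+ 4 *
  sqmod (cintegral (@leb2 R) (fun x => X x * fourier (image_window Psi y) x)).
Proof.
have [K hK e] := image_integral.
rewrite /optical_image; transitivity (sqmod (omega%:C / (2 * pi%:C * 'i%C * c1%:C * zi%:C) *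
  (K * cintegral (@leb2 R) (fun x => X x * fourier (image_window Psi y) x)))).
  by congr (sqmod (_ * _)).
rewrite !sqmodM hK mulrA; congr (_ * _).
rewrite sqmodV !sqmodM sqmod_i !sqmod_real.
have -> : (2 : R[i]) = (2 : R)%:C by rewrite rmorph_nat.
rewrite sqmod_real.
have p0 : pi != 0 :> R by rewrite gt_eqF ?pi_gt0.
move: (m ^+ 2) pi p0 => M p p0; field.
by rewrite p0 !gt_eqF.
Qed.

End Optics.

(** * Second moments *)

Section SecondMoment.
Variable R : realType.
Context d (Omega : measurableType d) (P : probability Omega R).
Implicit Types (x k r : plane R) (w : Omega).

Lemma rintble_cst (B : R) : rintble P (fun=> B).
Proof.
apply/integrableP; split; first exact: measurable_cst.
by rewrite integral_cst//= probability_setT mule1 ltry.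
Qed.

Variables (Y : plane R -> Omega -> R[i]) (g : plane R -> R[i]) (c : plane R -> R[i]) (B C : R).
Hypothesis Ymeas : cmeas (fun z : plane R * Omega => Y z.1 z.2).
Hypothesis YB : forall x w, n1 (Y x w) <= B.
Hypothesis Ycov : forall x x', cintegral P (fun w => Y x w * conjc (Y x' w)) = c (x - x').
Hypothesis gmeas : cmeas g.
Hypothesis gC : forall x, n1 (g x) <= C * weight x ^+ 2.

Let B0 : 0 <= B.
Proof. exact: le_trans (n1_ge0 _) (YB (0, 0) point). Qed.

Let C0 : 0 <= C.
Proof.
have := le_trans (n1_ge0 _) (gC (0, 0)).
by rewrite pmulr_lge0// exprn_gt0// weight_gt0.
Qed.

Let gC1 x : n1 (g x) <= C * weight x.
Proof. by apply: (le_trans (gC x)); rewrite ler_wpM2l// weight_sqr_le. Qed.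

Lemma rintbleZw (D : R) : rintble (@leb2 R) (fun x => D * weight x).
Proof. by apply: rintbleZ; exact: rintble_weight. Qed.

Let YgM : cmeas (fun z : plane R * Omega => Y z.1 z.2 * g z.1).
Proof. by apply: cmeasM => //; exact: cmeas_fst. Qed.

Let YgB x w : n1 (Y x w * g x) <= (B * C) * weight x * 1.
Proof.
apply: (le_trans (n1M _ _)); rewrite mulr1 -mulrA.
by apply: ler_pM => //; exact: n1_ge0.
Qed.

Let BCw_ge0 x : 0 <= (B * C) * weight x.
Proof. by apply: mulr_ge0; [exact: mulr_ge0|exact: weight_ge0]. Qed.

Lemma window_sum_int w : cintble (@leb2 R) (fun x => Y x w * g x).
Proof.
by have [_ + _ _ _] := cfubini (rintbleZw (B * C)) (rintble_cst 1) BCw_ge0 (fun=> ler01) YgM YgB; apply.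
Qed.

Let S w := cintegral (@leb2 R) (fun x => Y x w * g x).

Lemma window_sum_meas : cmeas S.
Proof.
have [_ _ _ + _] := cfubini (rintbleZw (B * C)) (rintble_cst 1) BCw_ge0 (fun=> ler01) YgM YgB.
exact: cintble_meas.
Qed.

Let D := \int[@leb2 R]_x ((B * C) * weight x).

Lemma window_sum_bound w : n1 (S w) <= D.
Proof.
apply: n1_cintegral; [exact: window_sum_int|exact: rintbleZw|].
by move=> x; have := YgB x w; rewrite mulr1.
Qed.

Let SM : cmeas S. Proof. exact: window_sum_meas. Qed.

Let Ysec x : cmeas (Y x).
Proof. by split; [exact: (measurable_fun_pair2 x Ymeas.1)|exact: (measurable_fun_pair2 x Ymeas.2)]. Qed.

Let YYB x x' w : n1 (Y x w * conjc (Y x' w)) <= B * B.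
Proof. by apply: (le_trans (n1M _ _)); rewrite n1J; apply: ler_pM => //; exact: n1_ge0. Qed.

Let YY_int x x' : cintble P (fun w => Y x w * conjc (Y x' w)).
Proof.
apply: (cintble_le _ (rintble_cst (B * B))); last exact: YYB.
by apply: cmeasM => //; exact: cmeasJ.
Qed.

(** Fubini needs an integrable majorant on the plane, so [weight] is inserted into the expectation
    and divided out afterwards. *)
Lemma covariance_meas : cmeas c.
Proof.
have mf : cmeas (fun z : plane R * Omega =>
    (weight z.1)%:C * (Y z.1 z.2 * conjc (Y (0, 0) z.2))).
  apply: cmeasM; first exact: (cmeas_fst _ (cmeas_real (rintble_meas (rintble_weight R)))).
  by apply: cmeasM => //; apply: cmeasJ; exact: cmeas_snd.
have fb x w : n1 ((weight x)%:C * (Y x w * conjc (Y (0, 0) w))) <= weight x * (B * B).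
  by rewrite n1_realM ger0_norm ?weight_ge0// ler_wpM2l ?weight_ge0.
have [_ _ h _ _] := cfubini (rintble_weight R) (rintble_cst (B * B)) (@weight_ge0 R)
  (fun=> mulr_ge0 B0 B0) mf fb.
have e x : c x = ((weight x)^-1)%:C *
    cintegral P (fun w => (weight x)%:C * (Y x w * conjc (Y (0, 0) w))).
  rewrite (@cintegralZ _ _ _ _ (weight x)%:C)// Ycov subr0 mulrA -(rmorphM (@real_complex R)) /=.
  by rewrite mulVf ?mul1r// gt_eqF ?weight_gt0.
have -> := funext e.
apply: cmeasM; last exact: cintble_meas h.
apply: cmeas_real.
have -> : (fun x => (weight x)^-1) =
    (fun x => (1 + crd false x * crd false x) * (1 + crd true x * crd true x)).
  by apply/funext => x; rewrite /weight /w1 invfM !invrK.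
apply: rder_meas => b; eexists.
have hd e1 := rderD (rder_cst b 1) (rderM (@rder_crd R b e1) (@rder_crd R b e1)).
exact: (rderM (hd false) (hd true)).
Qed.

Lemma covariance_bound r : n1 (c r) <= B * B.
Proof.
rewrite -(subr0 r) -Ycov.
have := n1_cintegral (YY_int r 0) (rintble_cst (B * B)) (YYB r 0).
by rewrite /Rintegral integral_cst//= probability_setT mule1.
Qed.

Let mulrACA_swap (a b a' b' : R[i]) : a * b * (a' * b') = b * b' * (a * a').
Proof. by ring. Qed.

Let sub_meas : measurable_fun setT (fun z : plane R * plane R => z.1 - z.2 : plane R).
Proof.
have m1 := @measurable_fst _ _ (plane R) (plane R).
have m2 := @measurable_snd _ _ (plane R) (plane R).
have c1 := @measurable_fst _ _ (measurableTypeR R) (measurableTypeR R).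
have c2 := @measurable_snd _ _ (measurableTypeR R) (measurableTypeR R).
apply/measurable_fun_pairP; split; apply: measurable_funB.
- exact: (measurableT_comp c1 m1).
- exact: (measurableT_comp c1 m2).
- exact: (measurableT_comp c2 m1).
- exact: (measurableT_comp c2 m2).
Qed.


Lemma window_cross_moment x :
  cintegral P (fun w => Y x w * g x * conjc (S w)) =
  cintegral (@leb2 R) (fun r => c r * (g x * conjc (g (x - r)))).
Proof.
have mf : cmeas (fun z : plane R * Omega =>
    (g x * conjc (g z.1)) * (Y x z.2 * conjc (Y z.1 z.2))).
  apply: cmeasM; first by apply: cmeasM; [exact: cmeas_cst|exact: (cmeas_fst _ (cmeasJ gmeas))].
  by apply: cmeasM; [exact: cmeas_snd|exact: cmeasJ].
pose K := n1 (g x) * C.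
have K0 : 0 <= K by apply: mulr_ge0 => //; exact: n1_ge0.
have fb x' w : n1 ((g x * conjc (g x')) * (Y x w * conjc (Y x' w))) <=
    (K * weight x') * (B * B).
  apply: (le_trans (n1M _ _)); apply: ler_pM; [exact: n1_ge0..| |exact: YYB].
  by apply: (le_trans (n1M _ _)); rewrite n1J /K -mulrA ler_wpM2l ?n1_ge0.
have Kw x' : 0 <= K * weight x' by apply: mulr_ge0 => //; exact: weight_ge0.
have [h1 h2 h3 _ e] := cfubini (rintbleZw K) (rintble_cst (B * B)) Kw
  (fun=> mulr_ge0 B0 B0) mf fb.
transitivity (cintegral P (fun w => cintegral (@leb2 R) (fun x' =>
    (g x * conjc (g x')) * (Y x w * conjc (Y x' w))))).
  apply: eq_cintegral => w; rewrite /S -cintegralJ; last exact: window_sum_int.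
  rewrite -(@cintegralZ _ _ _ _ (Y x w * g x)); last by apply: cintbleJ; exact: window_sum_int.
  by apply: eq_cintegral => x'; rewrite conjcM; exact: mulrACA_swap.
have e2 x' : cintegral P (fun w => (g x * conjc (g x')) * (Y x w * conjc (Y x' w))) =
    c (x - x') * (g x * conjc (g x')).
  by rewrite (@cintegralZ _ _ _ _ (g x * conjc (g x')))// Ycov mulrC.
rewrite -e (eq_cintegral _ e2).
have i2 : cintble (@leb2 R) (fun x' => c (x - x') * (g x * conjc (g x'))).
  by move: h3; congr cintble; exact: (funext e2).
have n10 : -1 != 0 :> R by rewrite oppr_eq0 oner_eq0.
have [_ ->] := cint_affine x n10 i2.
rewrite sqrrN expr1n mul1r; apply: eq_cintegral => r.
by rewrite -subE opprB addrC subrK.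
Qed.

Lemma autocorrelation_swap :
  cintble (@leb2 R) (fun x => cintegral (@leb2 R) (fun r => c r * (g x * conjc (g (x - r))))) /\
  cintegral (@leb2 R) (fun x => cintegral (@leb2 R) (fun r => c r * (g x * conjc (g (x - r))))) =
  cintegral (@leb2 R) (fun r => c r * cintegral (@leb2 R) (fun x => g x * conjc (g (x - r)))).
Proof.
have mf : cmeas (fun z : plane R * plane R => c z.2 * (g z.1 * conjc (g (z.1 - z.2)))).
  apply: cmeasM; first exact: (cmeas_snd _ covariance_meas).
  apply: cmeasM; first exact: cmeas_fst.
  by apply: cmeasJ; exact: (cmeas_comp gmeas sub_meas).
have gb x r : n1 (g x * conjc (g (x - r))) <= C * C * (4 * weight r * weight x).
  apply: (le_trans (n1M _ _)); rewrite n1J.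
  apply: (@le_trans _ _ ((C * weight x ^+ 2) * (C * weight (x - r) ^+ 2))).
    by apply: ler_pM => //; exact: n1_ge0.
  rewrite (mulrACA C) (mulrC (weight x ^+ 2)).
  by apply: ler_wpM2l; [exact: mulr_ge0|exact: weight_conv].
have fb x r : n1 (c r * (g x * conjc (g (x - r)))) <= weight x * ((B * B * (C * C) * 4) * weight r).
  apply: (le_trans (n1M _ _)).
  have -> : weight x * ((B * B * (C * C) * 4) * weight r) =
    (B * B) * (C * C * (4 * weight r * weight x)) by ring.
  by apply: ler_pM; [exact: n1_ge0..|exact: covariance_bound|exact: gb].
have K0 r : 0 <= (B * B * (C * C) * 4) * weight r.
  by apply: mulr_ge0; [rewrite !mulr_ge0|exact: weight_ge0].
have [_ _ i1 _ e] := cfubini (rintble_weight R) (rintbleZw (B * B * (C * C) * 4))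
  (@weight_ge0 R) K0 mf fb.
split; first exact: i1.
rewrite e; apply: eq_cintegral => r; apply: (@cintegralZ _ _ _ _ (c r)).
apply: (cintble_le _ (rintbleZw (C * C * (4 * weight r)))).
  have m3 : cmeas (fun x => g (x - r)) by exact: (cmeas_comp gmeas (measurable_fun_pair1 r sub_meas)).
  exact: (cmeasM gmeas (cmeasJ m3)).
by move=> x; rewrite -mulrA; exact: gb.
Qed.

(** Abstract in the field because it serves twice: for the phase field in the expected image, and
    for the centered phase field with Gaussian windows in the construction of the kernel. *)
Theorem second_moment :
  (\int[P]_w sqmod (S w))%:C =
  cintegral (@leb2 R) (fun r => c r * cintegral (@leb2 R) (fun x => g x * conjc (g (x - r)))).
Proof.
have [_ <-] := autocorrelation_swap.
rewrite -(eq_cintegral _ window_cross_moment) -cintegral_real.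
have YSM : cmeas (fun z : plane R * Omega => Y z.1 z.2 * g z.1 * conjc (S z.2)).
  by apply: cmeasM => //; apply: cmeasJ; exact: cmeas_snd.
have D0 : 0 <= D by exact: le_trans (n1_ge0 _) (window_sum_bound point).
have YSB x w : n1 (Y x w * g x * conjc (S w)) <= (B * C * weight x) * D.
  apply: (le_trans (n1M _ _)); rewrite n1J; apply: ler_pM; [exact: n1_ge0..| |exact: window_sum_bound].
  by have := YgB x w; rewrite mulr1.
have [_ _ _ _ ->] := cfubini (rintbleZw (B * C)) (rintble_cst D) BCw_ge0 (fun=> D0) YSM YSB.
apply: eq_cintegral => w; rewrite -mulc_conj /=.
transitivity (cintegral (@leb2 R) (fun x => conjc (S w) * (Y x w * g x))).
  rewrite (@cintegralZ _ _ _ _ (conjc (S w))); first by rewrite mulrC.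
  exact: window_sum_int.
by apply: eq_cintegral => x; rewrite mulrC.
Qed.

End SecondMoment.

Section Autocorrelation.
Variable R : realType.
Implicit Types (x k r : plane R) (f : plane R -> R[i]).

(** Convolution theorem: once the second transform is written out, Fubini leaves the integral over
    [x] as an inversion integral at [k], which returns [f k]. *)
Lemma autocorrelation_fourier f r : schw f ->
  cintegral (@leb2 R) (fun x => fourier f x * conjc (fourier f (x - r))) =
  ((2 * pi) ^+ 2)%:C * fourier (fun k => (sqmod (f k))%:C) r.
Proof.
move=> sf; have sF := schw_fourier sf.
have assoc (A D z z' : R[i]) : D * z' * (A * z) = A * (D * (z * z')) by ring.
have e1 x : fourier f x * conjc (fourier f (x - r)) = cintegral (@leb2 R) (fun k =>
    fourier f x * cis (dot2 x k) * (cis (- dot2 r k) * conjc (f k))).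
  rewrite (fourierE f (x - r)) -cintegralJ; last by apply: fourier_int; exact: schw_int.
  rewrite -(@cintegralZ _ _ _ _ (fourier f x)); last first.
    by apply: cintbleJ; apply: fourier_int; exact: schw_int.
  apply: eq_cintegral => k; rewrite conjcM -(@cisN R) opprK -(mulrA (fourier f x)).
  rewrite (mulrA (cis (dot2 x k))) -(@cisD R); congr (_ * (cis _ * _)).
  by rewrite /dot2 /=; ring.
have mf : cmeas (fun z : plane R * plane R =>
    fourier f z.1 * cis (dot2 z.1 z.2) * (cis (- dot2 r z.2) * conjc (f z.2))).
  apply: cmeasM; first apply: cmeasM.
  - by apply: cmeas_fst; exact: schw_meas.
  - by apply: cmeas_cis; exact: measurable_dot2.
  - apply: (cmeas_snd _ (f := fun k => cis (- dot2 r k) * conjc (f k))).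
    apply: cmeasM; last by apply: cmeasJ; exact: schw_meas.
    by apply: cmeas_cis; apply: measurable_funN; exact: measurable_dot2r.
have fb x k : n1 (fourier f x * cis (dot2 x k) * (cis (- dot2 r k) * conjc (f k))) <=
    (2 * n1 (fourier f x)) * (2 * n1 (f k)).
  apply: (le_trans (n1M _ _)); apply: ler_pM; [exact: n1_ge0..| |].
    by rewrite mulrC; exact: n1_cisM.
  by rewrite -[n1 (f k)]n1J; exact: n1_cisM.
have [_ _ _ _ e] := cfubini (rintbleZ 2 (cintble_n1 (schw_int sF)))
  (rintbleZ 2 (cintble_n1 (schw_int sf)))
  (fun x => mulr_ge0 (ler0n R 2) (n1_ge0 _)) (fun x => mulr_ge0 (ler0n R 2) (n1_ge0 _)) mf fb.
rewrite (eq_cintegral _ e1) e fourierE -(@cintegralZ _ _ _ _ ((2 * pi) ^+ 2)%:C); last first.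
  apply: fourier_int; under eq_fun do rewrite -mulc_conj.
  have [C C0 hC] := schw_bound1 sf.
  apply: (cintbleMb (C := C) (cintbleJ (schw_int sf)) (schw_meas sf)) => x.
  exact: (le_trans (hC x) (ler_piMr C0 (weight_le1 x))).
apply: eq_cintegral => k.
transitivity ((cis (- dot2 r k) * conjc (f k)) * cintegral (@leb2 R) (fun x => fourier f x * cis (dot2 x k))).
  rewrite -(@cintegralZ _ _ _ _ (cis (- dot2 r k) * conjc (f k))); last first.
    apply: (cintbleMb' (C := 2) (schw_int sF)) => [|x]; last exact: n1_cis.
    apply: cmeas_cis; have := measurable_dot2r k.
    by congr measurable_fun; apply/funext => x; exact: dot2C.
  by apply: eq_cintegral => x; rewrite mulrC.
rewrite schw_inversion; last exact: sf.
rewrite -mulc_conj; exact: assoc.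
Qed.

End Autocorrelation.

Lemma second_moment_fourier (R : realType) d (Omega : measurableType d)
    (P : probability Omega R) (Y : plane R -> Omega -> R[i]) (c f : plane R -> R[i]) (B : R) :
  cmeas (fun z : plane R * Omega => Y z.1 z.2) -> (forall x w, n1 (Y x w) <= B) ->
  (forall x x', cintegral P (fun w => Y x w * conjc (Y x' w)) = c (x - x')) -> schw f ->
  schw (fun k => (sqmod (f k))%:C) ->
  (\int[P]_w sqmod (cintegral (@leb2 R) (fun x => Y x w * fourier f x)))%:C =
  ((2 * pi) ^+ 2)%:C *
  cintegral (@leb2 R) (fun r => c r * fourier (fun k => (sqmod (f k))%:C) r).
Proof.
move=> mY YB Yc sf sf2; have sF := schw_fourier sf; have [C C0 hC] := schw_bound sF.
rewrite (second_moment mY YB Yc (schw_meas sF) hC).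
have ic : cintble (@leb2 R) (fun r => c r * fourier (fun k => (sqmod (f k))%:C) r).
  exact: (cintbleMb (schw_fourier_int sf2) (covariance_meas mY YB Yc) (covariance_bound mY YB Yc)).
rewrite -(@cintegralZ _ _ _ _ ((2 * pi) ^+ 2)%:C); last exact: ic.
by apply: eq_cintegral => r; rewrite (autocorrelation_fourier r sf) mulrCA.
Qed.

(** * Laws and mixing *)

Section NullModification.
Import HBNNSimple.
Context d (T : measurableType d) (R : realType) (mu : {measure set T -> \bar R}) (N : set T).
Hypotheses (mN : measurable N) (N0 : mu N = 0%E).
Implicit Types f g : T -> \bar R.

Let ae_out (Q : T -> Prop) : (forall x, ~ N x -> Q x) -> {ae mu, forall x, Q x}.
Proof. by move=> h; exists N; split => // x nQ; apply: contrapT => /h. Qed.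

(* [f] need not be measurable: the integral of a nonnegative function is the supremum of the
   integrals of the simple functions below it. *)
Lemma integral_null_eq f g : (forall x, 0 <= f x)%E -> (forall x, 0 <= g x)%E ->
  measurable_fun setT g -> (forall x, ~ N x -> f x = g x) ->
  (\int[mu]_x f x = \int[mu]_x g x)%E.
Proof.
move=> f0 g0 mg fg; apply/eqP; rewrite eq_le; apply/andP; split.
  rewrite ge0_integralTE//; apply: ge_ereal_sup => _ [h hf <-].
  rewrite -integralT_nnsfun; apply: ae_ge0_le_integral => //.
  - by move=> x _; rewrite lee_fin; exact: fun_ge0.
  - exact/measurable_EFinP.
  by apply: ae_out => x nx _; rewrite -fg.
rewrite (ge0_integralTE mu g0); apply: ge_ereal_sup => _ [h hg <-].
(* Setting [h] to 0 on [N] does not change its integral and places it below [f], since [f] agrees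
   with [g] off [N] and is nonnegative on [N]. *)
pose h' := proj_nnsfun h (measurableC mN).
have -> : sintegral mu h = sintegral mu h'.
  rewrite -!integralT_nnsfun; apply: ae_eq_integral => //.
  - by apply/measurable_EFinP.
  - by apply/measurable_EFinP.
  - apply: ae_out => x nx _ /=.
    by rewrite mindicE mem_set// mulr1.
rewrite ge0_integralTE//; apply: ereal_sup_ubound; exists h' => //= x.
rewrite mindicE; have [/set_mem nx|nx] := boolP (x \in ~` N).
  by rewrite mulr1 fg.
by rewrite mulr0.
Qed.

Lemma rint_null_eq (f g : T -> R) : measurable_fun setT f -> measurable_fun setT g ->
  (forall x, ~ N x -> f x = g x) -> \int[mu]_x f x = \int[mu]_x g x.
Proof.
move=> mf mg fg; congr fine; apply: ae_eq_integral => //.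
- by apply/measurable_EFinP.
- by apply/measurable_EFinP.
- by apply: ae_out => x nx _; rewrite fg.
Qed.

Lemma cint_null_eq (f g : T -> R[i]) : cmeas f -> cmeas g ->
  (forall x, ~ N x -> f x = g x) -> cintegral mu f = cintegral mu g.
Proof.
move=> [f1 f2] [g1 g2] fg; rewrite /cintegral; congr (_ +i* _); apply: rint_null_eq => // x nx;
  by rewrite fg.
Qed.

End NullModification.

Section Laws.
Context d (Omega : measurableType d) (R : realType) (P : probability Omega R).
Variable V : R * R -> {RV P >-> R}.
Implicit Types (x : R * R) (g : R * R -> R * R).

Lemma RV_meas x : measurable_fun setT (V x).
Proof. exact: measurable_funPT. Qed.

Lemma cylinder_point (A : set (R * R)) x (B : set R) : A x -> measurable B ->
  cylinder A [set f | B (f x)].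
Proof. by move=> Ax mB; apply: sub_sigma_algebra; exists x, B. Qed.

Lemma cylinder_increment x x' (B : set R) : measurable B ->
  cylinder setT [set f : R * R -> R | B (f x - f x')].
Proof.
move=> mB.
pose G : set (set (R * R -> R)) := [set C | exists x (B : set R),
  [/\ setT x, measurable B & C = [set f | B (f x)]] ].
have ev y : measurable_fun setT (fun f : g_sigma_algebraType G => (f : R * R -> R) y).
  by move=> _ D mD; rewrite setTI; apply: sub_sigma_algebra; exists y, D.
by have := measurable_funB (ev x) (ev x') measurableT mB; rewrite setTI.
Qed.

(** Equal laws on cylinder sets give equal distributions of the real functional [q] of the field.
    Only measures on the line are integrated, none on the space of functions. *)
Lemma law_Rintegral g1 g2 (q : (R * R -> R) -> R) (F : R -> R) (K : R) :
  (forall C, cylinder setT C -> law V g1 C = law V g2 C) ->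
  (forall B, measurable B -> cylinder setT [set f | B (q f)]) ->
  measurable_fun setT (fun w => q (fun x => V (g1 x) w)) ->
  measurable_fun setT (fun w => q (fun x => V (g2 x) w)) ->
  measurable_fun setT F -> (forall t, `|F t| <= K) ->
  \int[P]_w F (q (fun x => V (g1 x) w)) = \int[P]_w F (q (fun x => V (g2 x) w)).
Proof.
move=> lawE cq m1 m2 mF FK.
have [p1 e1] := pushforward_measure P m1.
have [p2 e2] := pushforward_measure P m2.
have int_ phi : measurable_fun setT phi -> P.-integrable setT (EFin \o F \o phi).
  move=> mphi; apply: (rintble_le _ (rintble_cst P K)); first exact: measurableT_comp mF mphi.
  by move=> w; exact: FK.
have mF' : measurable_fun setT (EFin \o F) by apply/measurable_EFinP.
have E (phi : Omega -> R) (pm : {measure set R -> \bar R}) : measurable_fun setT phi ->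
    (pm : set R -> \bar R) = pushforward P phi ->
    \int[P]_w F (phi w) = fine (\int[pm]_t (F t)%:E).
  move=> mphi pE; rewrite pE; congr fine.
  rewrite (@integral_pushforward _ _ _ _ _ phi mphi P setT (EFin \o F) mF') //.
    by rewrite preimage_setT; exact: int_.
rewrite (E _ p1 m1 e1) (E _ p2 m2 e2); congr fine.
apply: eq_measure_integral => B mB _.
by rewrite e1 e2; exact: lawE (cq B mB).
Qed.

Lemma law_cintegral g1 g2 (q : (R * R -> R) -> R) (tau : R) :
  (forall C, cylinder setT C -> law V g1 C = law V g2 C) ->
  (forall B, measurable B -> cylinder setT [set f | B (q f)]) ->
  measurable_fun setT (fun w => q (fun x => V (g1 x) w)) ->
  measurable_fun setT (fun w => q (fun x => V (g2 x) w)) ->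
  cintegral P (fun w => cis (tau * q (fun x => V (g1 x) w))) =
  cintegral P (fun w => cis (tau * q (fun x => V (g2 x) w))).
Proof.
move=> lawE cq m1 m2.
have mt : measurable_fun setT (fun t : R => tau * t) by exact: measurable_funM.
rewrite /cintegral; congr (_ +i* _) => /=.
  apply: (law_Rintegral (F := fun t => cos (tau * t)) (K := 1) lawE cq m1 m2).
    exact: (cmeas_cis mt).1.
  by move=> t; rewrite ler_norml cos_geN1 cos_le1.
apply: (law_Rintegral (F := fun t => sin (tau * t)) (K := 1) lawE cq m1 m2).
  exact: (cmeas_cis mt).2.
by move=> t; rewrite ler_norml sin_geN1 sin_le1.
Qed.

Lemma increment_meas x x' : measurable_fun setT (fun w => V x w - V x' w).
Proof. by apply: measurable_funB; exact: RV_meas. Qed.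

Lemma increment_shift (tau : R) x x' : stationary V ->
  cintegral P (fun w => cis (tau * (V x w - V x' w))) = char_fun_incr V tau (x - x').
Proof.
move=> st; rewrite /char_fun_incr.
have := @law_cintegral (fun y => y + x') id (fun f => f (x - x') - f (0, 0)) tau (st x')
  (cylinder_increment _ _) (increment_meas _ _) (increment_meas _ _).
rewrite subrK /= (_ : (0, 0) + x' = x') //.
by case: x' => a b; rewrite /GRing.add /= /add_pair /= !add0r.
Qed.

Lemma char_fun_shift (tau : R) x : stationary V ->
  cintegral P (fun w => cis (tau * V x w)) = char_fun V tau.
Proof.
move=> st; rewrite /char_fun.
have := @law_cintegral (fun y => y + x) id (fun f => f (0, 0)) tau (st x)
  (fun B mB => cylinder_point I mB) (RV_meas _) (RV_meas _).
rewrite (_ : (0, 0) + x = x) //.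
by case: x => a b; rewrite /GRing.add /= /add_pair /= !add0r.
Qed.

Lemma cis_increment_conj (tau : R) x x' :
  cintegral P (fun w => cis (- tau * (V x w - V x' w))) =
  conjc (cintegral P (fun w => cis (tau * (V x w - V x' w)))).
Proof.
rewrite -cintegralJ; last first.
  apply: (cintble_le _ (rintble_cst P 2)) => [|w]; last exact: n1_cis.
  by apply: cmeas_cis; apply: measurable_funM => //; exact: increment_meas.
by apply: eq_cintegral => w; rewrite mulNr cisN.
Qed.

(* Rotation by pi and translation by x exchange the end points of the increment. *)
Lemma char_fun_incrN (tau : R) x : stationary V -> isotropic V ->
  char_fun_incr V (- tau) x = char_fun_incr V tau x.
Proof.
move=> st iso.
have e0 : rotate2 (@pi R) (0, 0) = (0, 0).
  by rewrite /rotate2 /= !mulr0 subr0 addr0.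
have ex : rotate2 pi x = - x.
  by case: x => a b; rewrite /rotate2 /= cospi sinpi !mul0r add0r subr0 !mulN1r.
have := @law_cintegral (rotate2 pi) id (fun f => f x - f (0, 0)) (- tau) (iso pi)
  (cylinder_increment _ _) (increment_meas _ _) (increment_meas _ _).
rewrite -/(char_fun_incr V (- tau) x) => <-.
rewrite e0 ex cis_increment_conj (increment_shift tau (- x) (0, 0) st).
rewrite (_ : - x - (0, 0) = (0, 0) - x); last first.
  by case: (x) => a b; apply/pair_equal_spec; split; rewrite /= subr0 sub0r.
rewrite -(increment_shift tau (0, 0) x st) -cis_increment_conj.
by apply: eq_cintegral => w; rewrite mulNr -mulrN opprB.
Qed.

End Laws.

Lemma lt_set_meas d (T : measurableType d) (R : realType) (u : T -> R) (s : R) : measurable_fun setT u -> measurable [set w | s < u w].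
Proof.
move=> mu; have := measurable_fun_ltr (@measurable_cst _ _ T _ setT s) mu measurableT (Y := [set true]).
by rewrite setTI; apply.
Qed.

(** * From mixing of events to covariances of bounded functions *)

Section LayerCake.
Context d (T : measurableType d) (R : realType) (P : probability T R).
Implicit Types (u v k : T -> R).

Lemma rint_indic (mu : {measure set (measurableTypeR R) -> \bar R}) (A : set (measurableTypeR R)) :
  measurable A -> \int[mu]_s (\1_A s : R) = fine (mu A).
Proof. by move=> mA; rewrite /Rintegral integral_indic// setIT. Qed.

Lemma lebesgue_itv0 (t : R) : 0 <= t -> fine (@lebesgue_measure R `[0, t[%classic) = t.
Proof.
rewrite le_eqVlt lebesgue_measure_itv /= lte_fin => /orP[/eqP <-|t0]; first by rewrite ltxx.
by rewrite t0 sube0.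
Qed.

(* Fubini applied to [v w = \int_0^1 1_(s < v w) ds]. *)
Lemma layer_cake_bound v k (K a : R) : measurable_fun setT v -> measurable_fun setT k ->
  (forall w, 0 <= v w <= 1) -> (forall w, `|k w| <= K) ->
  (forall s, `|\int[P]_w (\1_[set w | s < v w] w * k w)| <= a) ->
  `|\int[P]_w (v w * k w)| <= a.
Proof.
move=> mv mk v01 kK h.
have K0 : 0 <= K by exact: le_trans (normr_ge0 _) (kK point).
have a0 : 0 <= a by exact: le_trans (normr_ge0 _) (h 0).
pose I : set (measurableTypeR R) := `[0, 1[%classic.
have mI : measurable I by exact: measurable_itv.
have iI : rintble (@lebesgue_measure R) (\1_I : _ -> R).
  exact: (integrable_indic_itv 0 1 true true).
pose A : set (T * measurableTypeR R) := [set z | I z.2 /\ z.2 < v z.1].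
have mA : measurable A.
  apply: measurableI.
    by have := @measurable_snd _ _ T (measurableTypeR R) measurableT I mI; rewrite setTI.
  have mv' : measurable_fun setT (fun z : T * measurableTypeR R => v z.1).
    exact: (measurableT_comp mv (@measurable_fst _ _ T (measurableTypeR R))).
  have := measurable_fun_ltr (@measurable_snd _ _ T (measurableTypeR R)) mv' measurableT (Y := [set true]).
  by rewrite setTI; apply.
pose f (z : T * measurableTypeR R) : R := \1_A z * k z.1.
have mf : measurable_fun setT f.
  apply: measurable_funM; first exact: measurable_indic.
  exact: (measurableT_comp mk (@measurable_fst _ _ T (measurableTypeR R))).
have fE w s : f (w, s) = \1_I s * (\1_[set w | s < v w] w * k w).
  rewrite /f mulrA; congr (_ * _); rewrite !indicE -natrM mulnb; congr (_%:R); congr nat_of_bool.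
  by apply/idP/andP => [/set_mem[? ?]|[/set_mem ? /set_mem ?]]; rewrite ?inE; split; rewrite ?inE.
have fb w s : `|f (w, s)| <= K * \1_I s.
  rewrite fE normrM mulrC (@ger0_norm _ (\1_I s)) ?ler_wpM2r//.
  rewrite normrM -[leRHS]mul1r; apply: ler_pM => //.
  by rewrite indicE; case: (_ \in _); rewrite ?normr1 ?normr0.
have [_ _ _ i2 e] := rfubini (rintble_cst P K) iI (fun=> K0) (fun s => ler0n R (s \in I)) mf fb.
have e1 w : \int[@lebesgue_measure R]_s f (w, s) = v w * k w.
  have /andP[v0 v1] := v01 w.
  transitivity (\int[@lebesgue_measure R]_s (k w * \1_(`[0, v w[%classic : set (measurableTypeR R)) s)).
    apply: eq_Rintegral => s _; rewrite fE mulrA mulrC; congr (_ * _).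
    rewrite !indicE -natrM mulnb; congr (_%:R); congr nat_of_bool.
    apply/andP/idP => [[/set_mem h1 /set_mem h2]|/set_mem h1].
      by apply: mem_set; move: h1 h2; rewrite /I /= !in_itv /= => /andP[-> _] ->.
    move: h1; rewrite /= in_itv /= => /andP[s0 sv].
    by split; apply: mem_set; rewrite /I /= ?in_itv /= ?s0 ?(lt_le_trans sv v1).
  rewrite RintegralZl//; last exact: (integrable_indic_itv 0 (v w) true true).
  rewrite rint_indic; last exact: measurable_itv.
  by rewrite mulrC; congr (_ * _); exact: lebesgue_itv0.
have -> : \int[P]_w (v w * k w) = \int[@lebesgue_measure R]_s \int[P]_w f (w, s).
  by rewrite -e; apply: eq_Rintegral => w _; rewrite e1.
apply: (le_trans (le_normr_Rintegral measurableT i2)).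
have iaI : rintble (@lebesgue_measure R) (fun s => a * \1_I s) by exact: rintbleZ.
apply: (@le_trans _ _ (\int[@lebesgue_measure R]_s (a * \1_I s))).
  apply: le_Rintegral => //; first exact: rintble_norm.
  move=> s _.
  have -> : \int[P]_w f (w, s) = \1_I s * \int[P]_w (\1_[set w | s < v w] w * k w).
    rewrite -RintegralZl//; first by apply: eq_Rintegral => w _; rewrite fE.
    apply: (rintble_le _ (rintble_cst P K)) => [|w].
      apply: measurable_funM => //; apply: measurable_indic.
      have := measurable_fun_ltr (@measurable_cst _ _ T _ setT s) mv measurableT (Y := [set true]).
      by rewrite setTI; apply.
    rewrite normrM -[leRHS]mul1r; apply: ler_pM => //.
    by rewrite indicE; case: (_ \in _); rewrite ?normr1 ?normr0.
  rewrite normrM (@ger0_norm _ (\1_I s)) ?ler0n// mulrC; exact: ler_wpM2r.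
rewrite RintegralZl// rint_indic//.
have e3 : fine (@lebesgue_measure R I) = 1 by exact: lebesgue_itv0.
by rewrite e3 mulr1.
Qed.

Lemma rintble_bnd (f : T -> R) (K : R) : measurable_fun setT f -> (forall w, `|f w| <= K) ->
  rintble P f.
Proof. by move=> mf fK; exact: (rintble_le mf (rintble_cst P K)). Qed.

Lemma Rintegral_prob_cst (c : R) : \int[P]_w c = c.
Proof. by rewrite /Rintegral integral_cst//= probability_setT mule1. Qed.

Lemma Rintegral_prob_indic (A : set T) : measurable A -> \int[P]_w (\1_A w : R) = fine (P A).
Proof. by move=> mA; rewrite /Rintegral integral_indic// setIT. Qed.

(** The layer cake bound is used for one function at a time: for [u] against the centered indicator
    of a superlevel set of [v], and for [v] against the centered [u]. *)
Lemma unit_covariance u v (a : R) : measurable_fun setT u -> measurable_fun setT v ->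
  (forall w, 0 <= u w <= 1) -> (forall w, 0 <= v w <= 1) ->
  (forall s t, `|fine (P ([set w | s < u w] `&` [set w | t < v w])) -
     fine (P [set w | s < u w]) * fine (P [set w | t < v w])| <= a) ->
  `|\int[P]_w (u w * v w) - (\int[P]_w u w) * (\int[P]_w v w)| <= a.
Proof.
move=> mu mv u01 v01 h.
have un w : `|u w| <= 1 by have /andP[h1 h2] := u01 w; rewrite ger0_norm.
have vn w : `|v w| <= 1 by have /andP[h1 h2] := v01 w; rewrite ger0_norm.
have iu := rintble_bnd mu un; have iv := rintble_bnd mv vn.
have n1 (A : set T) w : `|\1_A w : R| <= 1.
  by rewrite indicE; case: (_ \in _); rewrite ?normr1 ?normr0.
have iM (f g : T -> R) : measurable_fun setT f -> measurable_fun setT g ->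
    (forall w, `|f w| <= 1) -> (forall w, `|g w| <= 1) -> rintble P (fun w => f w * g w).
  move=> mf mg f1 g1; apply: (@rintble_bnd _ 1); first exact: measurable_funM.
  by move=> w; rewrite normrM -[leRHS]mul1r; apply: ler_pM.
have i1 s (f : T -> R) : measurable_fun setT f -> measurable_fun setT (\1_[set w | s < f w] : T -> R).
  by move=> mf; apply: measurable_indic; exact: lt_set_meas.
pose m := \int[P]_w u w.
have step t : `|\int[P]_w (u w * (\1_[set w | t < v w] w - fine (P [set w | t < v w])))| <= a.
  set F := [set w | t < v w]; have mF : measurable F by exact: lt_set_meas.
  have p0 : 0 <= fine (P F) by exact: fine_ge0.
  have mk : measurable_fun setT (fun w => \1_F w - fine (P F) : R).
    by apply: measurable_funB => //; exact: i1.
  apply: (@layer_cake_bound u _ (1 + fine (P F))) => // [w|s].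
    by apply: (le_trans (ler_normB _ _)); rewrite (ger0_norm p0) lerD2r.
  set E := [set w | s < u w]; have mE : measurable E by exact: lt_set_meas.
  have -> : \int[P]_w (\1_E w * (\1_F w - fine (P F))) =
      \int[P]_w (\1_(E `&` F) w - fine (P F) * \1_E w : R).
    apply: eq_Rintegral => w _; rewrite mulrBr (mulrC (fine _)); congr (_ - _).
    by rewrite indicI.
  have mEF : measurable (E `&` F) by exact: measurableI.
  have iE : rintble P (\1_E : T -> R) by apply: (@rintble_bnd _ 1) => //; exact: i1.
  have iEF : rintble P (\1_(E `&` F) : T -> R).
    by apply: (@rintble_bnd _ 1) => //; exact: measurable_indic.
  rewrite RintegralB//; last exact: rintbleZ.
  rewrite RintegralZl// !Rintegral_prob_indic// mulrC; exact: h.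
have -> : \int[P]_w (u w * v w) - m * \int[P]_w v w = \int[P]_w (v w * (u w - m)).
  have -> : \int[P]_w (v w * (u w - m)) = \int[P]_w (u w * v w - m * v w).
    by apply: eq_Rintegral => w _; ring.
  by rewrite RintegralB//; [rewrite RintegralZl|exact: iM|exact: rintbleZ].
have m0 : 0 <= m.
  by apply: Rintegral_ge0 => w _; have /andP[] := u01 w.
apply: (@layer_cake_bound v _ (1 + m)) => // [|w|t].
- exact: measurable_funB.
- by apply: (le_trans (ler_normB _ _)); rewrite (ger0_norm m0) lerD2r.
have := step t; set F := [set w | t < v w]; have mF : measurable F by exact: lt_set_meas.
have iF : rintble P (\1_F : T -> R) by apply: (@rintble_bnd _ 1) => //; exact: i1.
have iuF : rintble P (fun w => u w * \1_F w) by apply: iM => //; exact: i1.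
have -> : \int[P]_w (u w * (\1_F w - fine (P F))) =
    \int[P]_w (u w * \1_F w - fine (P F) * u w).
  by apply: eq_Rintegral => w _; ring.
have -> : \int[P]_w (\1_F w * (u w - m)) = \int[P]_w (u w * \1_F w - m * \1_F w).
  by apply: eq_Rintegral => w _; ring.
rewrite !RintegralB//; [|exact: rintbleZ..].
by rewrite !RintegralZl// Rintegral_prob_indic// -/m (mulrC m).
Qed.

(** The map [(1 + t) / 2] brings both functions into the unit interval and divides their covariance
    by 4. *)
Lemma mixing_covariance (q1 q2 : T -> R) (F1 F2 : R -> R) (a : R) :
  measurable_fun setT q1 -> measurable_fun setT q2 ->
  measurable_fun setT F1 -> measurable_fun setT F2 ->
  (forall t, `|F1 t| <= 1) -> (forall t, `|F2 t| <= 1) ->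
  (forall B1 B2, measurable B1 -> measurable B2 ->
    `|fine (P ([set w | B1 (q1 w)] `&` [set w | B2 (q2 w)])) -
      fine (P [set w | B1 (q1 w)]) * fine (P [set w | B2 (q2 w)])| <= a) ->
  `|\int[P]_w (F1 (q1 w) * F2 (q2 w)) -
    (\int[P]_w F1 (q1 w)) * (\int[P]_w F2 (q2 w))| <= 4 * a.
Proof.
move=> mq1 mq2 mF1 mF2 F1b F2b h.
have half (F : R -> R) (q : T -> R) : measurable_fun setT q -> measurable_fun setT F ->
    (forall t, `|F t| <= 1) ->
    [/\ measurable_fun setT (fun t => (1 + F t) / 2), forall w, 0 <= (1 + F (q w)) / 2 <= 1,
      rintble P (fun w => F (q w)) &
      \int[P]_w ((1 + F (q w)) / 2) = (1 + \int[P]_w F (q w)) / 2].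
  move=> mq mF Fb.
  have iF : rintble P (fun w => F (q w)).
    by apply: (@rintble_bnd _ 1) => //; exact: (measurableT_comp mF mq).
  split => //.
  - by apply: measurable_funM => //; exact: measurable_funD.
  - by move=> w; have := Fb (q w); rewrite ler_norml => /andP[h1 h2]; apply/andP; split; lra.
  - have -> : \int[P]_w ((1 + F (q w)) / 2) = \int[P]_w (2^-1 * (1 + F (q w))).
      by apply: eq_Rintegral => w _; ring.
    have i1 := rintble_cst P 1; have i2 := rintbleD i1 iF.
    by rewrite RintegralZl// RintegralD// Rintegral_prob_cst; ring.
have [mU U01 iF1 eU] := half _ _ mq1 mF1 F1b.
have [mV V01 iF2 eV] := half _ _ mq2 mF2 F2b.
have := @unit_covariance (fun w => (1 + F1 (q1 w)) / 2) (fun w => (1 + F2 (q2 w)) / 2) a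
  (measurableT_comp mU mq1) (measurableT_comp mV mq2) U01 V01
  (fun s t => h _ _ (lt_set_meas s mU) (lt_set_meas t mV)).
rewrite eU eV => hc.
have iFF : rintble P (fun w => F1 (q1 w) * F2 (q2 w)).
  apply: (@rintble_bnd _ 1) => [|w]; last by rewrite normrM -[leRHS]mul1r; apply: ler_pM.
  by apply: measurable_funM; [exact: (measurableT_comp mF1 mq1)|exact: (measurableT_comp mF2 mq2)].
have eUV : \int[P]_w ((1 + F1 (q1 w)) / 2 * ((1 + F2 (q2 w)) / 2)) =
    (1 + \int[P]_w F1 (q1 w) + \int[P]_w F2 (q2 w) + \int[P]_w (F1 (q1 w) * F2 (q2 w))) / 4.
  have -> : \int[P]_w ((1 + F1 (q1 w)) / 2 * ((1 + F2 (q2 w)) / 2)) =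
      \int[P]_w (4^-1 * (((1 + F1 (q1 w)) + F2 (q2 w)) + F1 (q1 w) * F2 (q2 w))).
    by apply: eq_Rintegral => w _; field.
  have i1 := rintble_cst P 1.
  have i2 := rintbleD i1 iF1; have i3 := rintbleD i2 iF2; have i4 := rintbleD i3 iFF.
  by rewrite RintegralZl// !RintegralD// Rintegral_prob_cst; ring.
move: hc; rewrite eUV; move: (\int[P]_w F1 _) (\int[P]_w F2 _) (\int[P]_w (F1 _ * _)) => x y z hc.
have -> : z - x * y = 4 * ((1 + x + y + z) / 4 - (1 + x) / 2 * ((1 + y) / 2)) by field.
by rewrite normrM ger0_norm// ler_wpM2l.
Qed.

End LayerCake.

Section Mixing.
Context d (Omega : measurableType d) (R : realType) (P : probability Omega R).
Variable V : R * R -> {RV P >-> R}.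
Implicit Types (x r : R * R) (tau : R).

Lemma weight_enorm2 r : (1 + r.1 ^+ 2) * (1 + r.2 ^+ 2) <= (1 + enorm2 r) ^+ 4.
Proof.
have e0 := enorm2_ge0 r; have h b : 1 + crd b r ^+ 2 <= (1 + enorm2 r) ^+ 2.
  have := crd_enorm2 b r; rewrite -(ler_sqr (normr_ge0 _) e0) real_normK ?num_real//.
  by move: (crd b r) (enorm2 r) e0 => t e e0; nra.
rewrite (exprM _ 2 2) expr2.
by apply: ler_pM; [rewrite addr_ge0// sqr_ge0..|exact: (h false)|exact: (h true)].
Qed.

(* The two regions of the mixing condition are single points. *)
Lemma char_fun_incr_mixing tau : stationary V -> rapidly_mixing V ->
  exists2 C, 0 <= C & forall r,
    n1 (char_fun_incr V tau r - (sqmod (char_fun V tau))%:C) <= C * weight r.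
Proof.
(* Points have diameter 0. The power 4 dominates the inverse of [weight], by [weight_enorm2]. The
   constant 16 counts four covariances of sines and cosines, each with the factor 4 of
   [mixing_covariance]: two in the real part and two in the imaginary part. *)
move=> st mix; have [C hC] := mix 0 4%N; exists (16 * `|C|) => [|r]; first by rewrite mulr_ge0.
set E4 := (1 + enorm2 r) ^+ 4.
have E0 : 0 < E4 by exact: enorm2_gt0.
have e0 : enorm2 (0 : R * R) = 0 by rewrite /enorm2 /sqnorm2 /dot2 /= mulr0 addr0 sqrtr0.
have cov B1 B2 : measurable B1 -> measurable B2 ->
    `|fine (P ([set w | B1 (V r w)] `&` [set w | B2 (V (0, 0) w)])) -
      fine (P [set w | B1 (V r w)]) * fine (P [set w | B2 (V (0, 0) w)])| <= `|C| / E4.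
  move=> m1 m2; rewrite ler_pdivlMr// mulrC; apply: le_trans (ler_norm C).
  apply: (hC [set r] [set (0, 0)] (enorm2 r) (enorm2_ge0 r) _ _ _
    [set f | B1 (f r)] [set f | B2 (f (0, 0))]).
  - by move=> _ _ -> ->; rewrite subrr e0.
  - by move=> _ _ -> ->; rewrite subrr e0.
  - by move=> _ _ -> ->; rewrite (_ : r - (0, 0) = r)//; exact: subr0.
  - exact: cylinder_point.
  - exact: cylinder_point.
have mt : measurable_fun setT (fun t : R => tau * t) by exact: measurable_funM.
have [mc ms] := cmeas_cis mt.
have cb t : `|cos (tau * t) : R| <= 1 by rewrite ler_norml cos_geN1 cos_le1.
have sb t : `|sin (tau * t) : R| <= 1 by rewrite ler_norml sin_geN1 sin_le1.
have mr := RV_meas V r; have m0 := RV_meas V (0, 0).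
have hcc := mixing_covariance mr m0 mc mc cb cb cov.
have hcs := mixing_covariance mr m0 mc ms cb sb cov.
have hsc := mixing_covariance mr m0 ms mc sb cb cov.
have hss := mixing_covariance mr m0 ms ms sb sb cov.
have sh := char_fun_shift tau r st.
have [shc shs] : \int[P]_w cos (tau * V r w) = \int[P]_w cos (tau * V (0, 0) w) /\
   \int[P]_w sin (tau * V r w) = \int[P]_w sin (tau * V (0, 0) w).
  by split; [have := congr1 (@complex.Re R) sh|have := congr1 (@complex.Im R) sh].
rewrite /= shc shs in hcc hcs hsc hss.
set c := \int[P]_w cos (tau * V (0, 0) w) in hcc hcs hsc hss.
set s := \int[P]_w sin (tau * V (0, 0) w) in hcc hcs hsc hss.
have iM (F G : R -> R) : measurable_fun setT F -> measurable_fun setT G ->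
    (forall t, `|F t| <= 1) -> (forall t, `|G t| <= 1) ->
    rintble P (fun w => F (V r w) * G (V (0, 0) w)).
  move=> mF mG Fb Gb; apply: (@rintble_bnd _ _ _ _ _ 1) => [|w].
    by apply: measurable_funM; [exact: (measurableT_comp mF mr)|exact: (measurableT_comp mG m0)].
  by rewrite normrM -[leRHS]mul1r; apply: ler_pM.
have icc := iM _ _ mc mc cb cb; have ics := iM _ _ mc ms cb sb.
have isc := iM _ _ ms mc sb cb; have iss := iM _ _ ms ms sb sb.
have er : re (char_fun_incr V tau r) = \int[P]_w (cos (tau * V r w) * cos (tau * V (0, 0) w)) +
    \int[P]_w (sin (tau * V r w) * sin (tau * V (0, 0) w)).
  rewrite -RintegralD//; apply: eq_Rintegral => w _ /=.
  by rewrite mulrBr cosB.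
have ei : im (char_fun_incr V tau r) = \int[P]_w (sin (tau * V r w) * cos (tau * V (0, 0) w)) -
    \int[P]_w (cos (tau * V r w) * sin (tau * V (0, 0) w)).
  rewrite -RintegralB//; apply: eq_Rintegral => w _ /=.
  by rewrite mulrBr sinB.
have eb : 16 * (`|C| / E4) <= 16 * `|C| * weight r.
  rewrite -mulrA ler_wpM2l// ler_wpM2l//; rewrite -[weight r]mul1r.
  by apply: le_weight; rewrite ler_pdivrMr// mul1r; exact: weight_enorm2.
apply: le_trans eb; rewrite /n1 !reimE er ei.
have -> : sqmod (char_fun V tau) = c ^+ 2 + s ^+ 2 by [].
rewrite /= subr0; move: hcc hcs hsc hss.
move: (\int[P]_w _) (\int[P]_w _) (\int[P]_w _) (\int[P]_w _) (`|C| / E4) => x1 x2 x3 x4 D.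
rewrite !expr2 => /ler_normlP[h1 h1'] /ler_normlP[h2 h2'] /ler_normlP[h3 h3'] /ler_normlP[h4 h4'].
have -> : 16 * D = 8 * D + 8 * D by ring.
by apply: lerD; apply/ler_normlP; split; lra.
Qed.

End Mixing.

Section JointMeasurability.
Context d (Omega : measurableType d) (R : realType).

(** The Caratheodory argument for one coordinate at a time, with the other coordinate treated as
    part of the outcome. *)
Lemma measurable_field (U : R * R -> Omega -> R) : (forall x, measurable_fun setT (U x)) ->
  (forall w b x, continuous (fun t => U (upd b x t) w)) ->
  measurable_fun setT (fun z : plane R * Omega => U z.1 z.2).
Proof.
move=> mU cU.
have m1 x1 : measurable_fun setT (fun p : measurableTypeR R * Omega => U (x1, p.1) p.2).
  exact: (measurable_caratheodory (f := fun x2 w => U (x1, x2) w) (fun x2 => mU _)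
    (fun w => cU w true (x1, 0))).
have m2 : measurable_fun setT (fun p : measurableTypeR R * (measurableTypeR R * Omega) =>
    U (p.1, p.2.1) p.2.2).
  exact: (measurable_caratheodory (f := fun x1 (p : measurableTypeR R * Omega) => U (x1, p.1) p.2)
    m1 (fun p => cU p.2 false (0, p.1))).
have h1 := @measurable_fst _ _ (plane R) Omega.
have h2 := @measurable_snd _ _ (plane R) Omega.
have c1 := @measurable_fst _ _ (measurableTypeR R) (measurableTypeR R).
have c2 := @measurable_snd _ _ (measurableTypeR R) (measurableTypeR R).
pose phi (z : plane R * Omega) : measurableTypeR R * (measurableTypeR R * Omega) :=
  (z.1.1, (z.1.2, z.2)).
have mphi : measurable_fun setT phi.
  apply/measurable_fun_pairP; split; first exact: (measurableT_comp c1 h1).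
  apply/measurable_fun_pairP; split; last exact: h2.
  exact: (measurableT_comp c2 h1).
have := measurableT_comp m2 mphi.
by congr measurable_fun; apply/funext => -[[a b] w].
Qed.

End JointMeasurability.

Section Realizations.
Context d (Omega : measurableType d) (R : realType) (P : probability Omega R).
Variable V : R * R -> {RV P >-> R}.
Implicit Types (x r : R * R) (tau : R).

Record regular_field (N : set Omega) (M : R) := RegularField {
  reg_meas : measurable N;
  reg_null : P N = 0%E;
  reg_smooth : forall w, ~ N w -> smooth2 (fun x => V x w);
  reg_second : forall w, ~ N w -> bounded_second_derivatives (fun x => V x w);
  reg_bound : forall w, ~ N w -> forall x, `|V x w| <= M }.

Lemma regular_field_ex : bounded_field V -> smooth_field V -> exists N M, regular_field N M.
Proof.
move=> [M [N1 [m1 n1 s1]]] [N2 [m2 n2 s2]]; exists (N1 `|` N2), M; split.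
- exact: measurableU.
- by rewrite measureU0.
- by move=> w /not_orP[_ nw]; have [] := contra_notP (s2 w) nw.
- by move=> w /not_orP[_ nw]; have [] := contra_notP (s2 w) nw.
- by move=> w /not_orP[nw _]; exact: contra_notP (s1 w) nw.
Qed.

Section Modification.
Variables (N : set Omega) (M : R).
Hypothesis reg : regular_field N M.

(* Vanishes on a null set containing all irregular realizations: every realization of the
   modified field is continuous, which gives joint measurability. *)
Definition modification x w : R := V x w * \1_(~` N) w.

Lemma modificationE x w : ~ N w -> modification x w = V x w.
Proof. by move=> nw; rewrite /modification indicE mem_set// mulr1. Qed.

Lemma modification_meas x : measurable_fun setT (modification x).
Proof.
apply: measurable_funM; first exact: RV_meas.
by apply: measurable_indic; apply: measurableC; exact: reg_meas reg.
Qed.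

Lemma modification_coord w b x : continuous (fun t => modification (upd b x t) w).
Proof.
have [nw|nw] := pselect (N w).
  under eq_fun do rewrite /modification indicE memNset ?mulr0//.
  by move=> t; exact: cvg_cst.
under eq_fun do rewrite modificationE//.
have dv : rder b (fun y => V y w) (partial b (fun y => V y w)).
  by apply: rder_partial => y; exact: (reg_smooth reg nw [::] y).
exact: (@rder_continuous _ b _ _ x dv).
Qed.

Lemma modification_joint : measurable_fun setT (fun z : plane R * Omega => modification z.1 z.2).
Proof. by apply: measurable_field; [exact: modification_meas|exact: modification_coord]. Qed.

Lemma modification_cvg w (x_ : nat -> R * R) x : x_ n @[n --> \oo] --> x ->
  modification (x_ n) w @[n --> \oo] --> modification x w.
Proof.
move=> cx; have [nw|nw] := pselect (N w).
  under eq_fun do rewrite /modification indicE memNset ?mulr0//.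
  by rewrite /modification indicE memNset ?mulr0//; exact: cvg_cst.
under eq_fun do rewrite modificationE//; rewrite modificationE//.
have dv : differentiable (fun y => V y w) x by exact: (reg_smooth reg nw [::] x).
exact: (cvg_comp x_ (fun y => V y w) cx (differentiable_continuous dv)).
Qed.

Definition phase_field tau (a : R) x w : R[i] := cis (tau * modification (scale2 a x) w).

Lemma phase_field_joint tau a : cmeas (fun z : plane R * Omega => phase_field tau a z.1 z.2).
Proof.
apply: cmeas_cis; apply: measurable_funM => //.
pose phi (z : plane R * Omega) : plane R * Omega := (affine2 a 0 z.1, z.2).
have mphi : measurable_fun setT phi.
  apply/measurable_fun_pairP; split; last exact: measurable_snd.
  exact: (measurableT_comp (measurable_affine2 a 0) (@measurable_fst _ _ (plane R) Omega)).
have := measurableT_comp modification_joint mphi.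
by congr measurable_fun; apply/funext => z; rewrite /= /affine2 addr0.
Qed.

Lemma phase_field_covariance tau a x x' : stationary V ->
  cintegral P (fun w => phase_field tau a x w * conjc (phase_field tau a x' w)) =
  char_fun_incr V tau (scale2 a (x - x')).
Proof.
move=> st.
have e w : phase_field tau a x w * conjc (phase_field tau a x' w) =
    cis (tau * (modification (scale2 a x) w - modification (scale2 a x') w)).
  by rewrite /phase_field -cisN -cisD mulrBr.
rewrite (eq_cintegral _ e).
have -> : scale2 a (x - x') = scale2 a x - scale2 a x'.
  by apply/pair_equal_spec; split; rewrite /= mulrBr.
rewrite -(increment_shift tau (scale2 a x) (scale2 a x') st).
apply: (cint_null_eq (reg_meas reg) (reg_null reg)) => [||w nw].
- apply: cmeas_cis; apply: measurable_funM => //.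
  by apply: measurable_funB; exact: modification_meas.
- by apply: cmeas_cis; apply: measurable_funM => //; exact: increment_meas.
- by rewrite !modificationE.
Qed.

Lemma char_fun_incr_meas tau a : stationary V ->
  cmeas (fun r : plane R => char_fun_incr V tau (scale2 a r)).
Proof.
move=> st; exact: (covariance_meas (phase_field_joint tau a) (fun x w => n1_cis _)
  (fun x x' => phase_field_covariance tau a x x' st)).
Qed.

Lemma n1_char_fun_incr tau r : n1 (char_fun_incr V tau r) <= 2.
Proof.
have im : cintble P (fun w => cis (tau * (V r w - V (0, 0) w))).
  apply: (cintble_le _ (rintble_cst P 2)) => [|w]; last exact: n1_cis.
  by apply: cmeas_cis; apply: measurable_funM => //; exact: increment_meas.
have := n1_cintegral im (rintble_cst P 2) (fun w => n1_cis _).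
by rewrite Rintegral_prob_cst.
Qed.

Lemma phase_field_mean tau x : stationary V ->
  cintegral P (phase_field tau 1 x) = char_fun V tau.
Proof.
move=> st; rewrite -(char_fun_shift tau x st).
have e1 : scale2 1 x = x by case: (x) => a b; rewrite /scale2 /= !mul1r.
apply: (cint_null_eq (reg_meas reg) (reg_null reg)) => [||w nw].
- by apply: cmeas_cis; apply: measurable_funM => //; exact: modification_meas.
- by apply: cmeas_cis; apply: measurable_funM => //; exact: RV_meas.
- by rewrite /phase_field modificationE// e1.
Qed.

(** Dominated convergence under [P]. The modified field is used because all its realizations are
    continuous, as pointwise convergence is required for every outcome. *)
Lemma char_fun_incr_cvg tau (x_ : nat -> R * R) : stationary V ->
  x_ n @[n --> \oo] --> (0 : R * R) -> ccvg (fun n => char_fun_incr V tau (x_ n)) 1.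
Proof.
move=> st cx.
have e x : char_fun_incr V tau x =
    cintegral P (fun w => cis (tau * (modification x w - modification 0 w))).
  apply: (cint_null_eq (reg_meas reg) (reg_null reg)) => [||w nw].
  - by apply: cmeas_cis; apply: measurable_funM => //; exact: increment_meas.
  - apply: cmeas_cis; apply: measurable_funM => //.
    by apply: measurable_funB; exact: modification_meas.
  - by rewrite !modificationE.
have [] := @cint_cvg _ _ _ P
  (fun n w => cis (tau * (modification (x_ n) w - modification 0 w))) (fun=> 1) (fun=> 2).
- move=> n; apply: cmeas_cis; apply: measurable_funM => //.
  by apply: measurable_funB; exact: modification_meas.
- move=> w; rewrite -(cis0 R); apply: ccvg_cis.
  rewrite -(mulr0 tau); apply: cvgM; first exact: cvg_cst.
  rewrite -(subrr (modification 0 w)); apply: cvgB; last exact: cvg_cst.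
  exact: modification_cvg.
- exact: rintble_cst.
- by move=> n w; exact: n1_cis.
move=> _ h; rewrite (_ : 1 = cintegral P (fun=> 1)).
  by apply: (ccvg_ext h) => n; rewrite e.
by rewrite (cintegral_real P (fun=> 1)) Rintegral_prob_cst.
Qed.

End Modification.

End Realizations.

(** * The expected image *)

Lemma ccvg_bound (R : realType) (u : nat -> R[i]) (l : R[i]) (b : nat -> R) :
  (forall n, n1 (u n - l) <= b n) -> b n @[n --> \oo] --> (0 : R) -> ccvg u l.
Proof.
move=> ub b0.
have h (v : nat -> R) (k : R) : (forall n, `|v n - k| <= b n) -> v n @[n --> \oo] --> k.
  move=> vb; apply/subr_cvg0; apply: (squeeze_cvgr (f := fun n => - b n) (h := b)).
  - by near=> n; rewrite -ler_norml.
  - by rewrite -oppr0; exact: cvgN.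
  - exact: b0.
split; apply: h => n; apply: (le_trans _ (ub n)).
  by rewrite -reN -reD; exact: re_le_n1.
by rewrite -imN -imD; exact: im_le_n1.
Unshelve. all: by end_near.
Qed.

Section ExpectedImage.
Context d (Omega : measurableType d) (R : realType) (P : probability Omega R).
Variables (V : R * R -> {RV P >-> R}) (N : set Omega) (M : R).
Hypotheses (reg : regular_field V N M) (Vstat : stationary V).
Variables (omega c0 c1 zint zobs zi : R).
Hypotheses (homega : 0 < omega) (hc0 : 0 < c0) (hc1 : 0 < c1)
  (hzint : 0 < zint) (hzobs : zint < zobs) (hzi : 0 < zi).
Variables (Psi : R * R -> R[i]) (y : R * R).
Hypothesis hPsi : schwartz Psi.

Let tau := omega * (c0^-1 - c1^-1).
Let m := eff_distance c0 c1 zint zobs / zi.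

Definition image_profile (k : R * R) : R :=
  sqmod (Psi (scale2 (- m) y + scale2 (c0 * zint / omega) k)).

Let dilation_neq0 : c0 * zint / omega != 0.
Proof. by rewrite gt_eqF// divr_gt0// mulr_gt0. Qed.

Lemma schwartz_image_profile : schwartz (fun k => (image_profile k)%:C).
Proof.
have := schwartz_affine (scale2 (- m) y) dilation_neq0 (schwartz_sqmod hPsi).
by congr schwartz; apply/funext => k; rewrite /image_profile addrC.
Qed.

Lemma sqmod_image_window k :
  sqmod (image_window omega c0 c1 zint zobs zi Psi y k) = image_profile k.
Proof. by rewrite /image_window sqmodM /chirp sqmod_cis mul1r /image_profile addrC. Qed.

Let S := image_window omega c0 c1 zint zobs zi Psi y.
Let sS : schw S.
Proof. exact: (schw_image_window c1 zobs zi homega hc0 hzint y (schwartz_schw hPsi)). Qed.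

(** Exact for every [eps] and [gamma]: the three regimes differ only in the dilation applied to the
    argument of [char_fun_incr]. *)
Lemma expected_image (eps gamma : R) : 0 < eps ->
  ('E_P[fun w => optical_image omega c0 c1 zint zobs zi (fun x => V x w) eps gamma Psi y] =
   (m ^+ 2 * re ((((2 * pi) ^+ 2)^-1)%:C * cintegral (@leb2 R) (fun r =>
     char_fun_incr V tau (scale2 (eps `^ (gamma - 2^-1))^-1 r) *
     fourier (fun k => (image_profile k)%:C) r)))%:E)%E.
Proof.
move=> eps0; set a := (eps `^ (gamma - 2^-1))^-1.
pose Y := phase_field V N tau a.
have Ym : cmeas (fun z : plane R * Omega => Y z.1 z.2) by exact: (phase_field_joint reg).
have YB x w : n1 (Y x w) <= 2 by exact: n1_cis.
pose Sw w := cintegral (@leb2 R) (fun x => Y x w * fourier S x).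
have [C _ hC] := schw_bound (schw_fourier sS).
have Sm : cmeas Sw by exact: (window_sum_meas P Ym YB (schw_meas (schw_fourier sS)) hC).
have SB := window_sum_bound P Ym YB (schw_meas (schw_fourier sS)) hC.
pose K := m ^+ 2 / (2 * pi) ^+ 4.
have K0 : 0 <= K by rewrite divr_ge0 ?sqr_ge0 ?exprn_ge0 ?mulr_ge0 ?pi_ge0.
have mS : measurable_fun setT (fun w => sqmod (Sw w)) by exact: cmeas_sqmod.
have iS : rintble P (fun w => sqmod (Sw w)).
  apply: (@rintble_bnd _ _ _ _ _ ((\int[@leb2 R]_x (2 * C * weight x)) ^+ 2)) => // w.
  rewrite ger0_norm ?sqmod_ge0//; apply: (le_trans (sqmod_le_n1 _)).
  by rewrite ler_sqr ?nnegrE ?n1_ge0 ?(le_trans (n1_ge0 _) (SB w))//; exact: SB.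
(* Off [N] the image is given by [optical_imageE], whose hypothesis on the phase factor holds for
   regular realizations. The measurable closed form replaces the image without measurability of the
   latter in [w]. *)
rewrite unlock (integral_null_eq (reg_meas reg) (reg_null reg)
  (g := fun w => (K * sqmod (Sw w))%:E)); first last.
- move=> w nw; congr EFin.
  have h f : schw f -> _ := realization_fourier_int tau a (reg_smooth reg nw)
    (reg_second reg nw) (reg_bound reg nw).
  rewrite (optical_imageE homega hc0 hc1 hzint hzobs hzi y h (schwartz_schw hPsi)).
  congr (_ * sqmod _); apply: eq_cintegral => x; congr (_ * _).
  by rewrite /Y /phase_field modificationE.
- by apply/measurable_EFinP; exact: measurable_funM.
- by move=> w; rewrite lee_fin mulr_ge0 ?sqmod_ge0.
- by move=> w; rewrite lee_fin sqmod_ge0.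
have iKS := rintbleZ K iS.
rewrite -(fineK (integrable_fin_num measurableT iKS)); congr EFin.
have -> : fine (\int[P]_w (K * sqmod (Sw w))%:E) = K * \int[P]_w sqmod (Sw w).
  by rewrite -/(Rintegral P setT (fun w => K * sqmod (Sw w))) RintegralZl.
have eS : (fun k => (sqmod (S k))%:C) = (fun k => (image_profile k)%:C).
  by apply/funext => k; rewrite sqmod_image_window.
have sS2 : schw (fun k => (sqmod (S k))%:C).
  by rewrite eS; exact: schwartz_schw schwartz_image_profile.
have := second_moment_fourier (c := fun r => char_fun_incr V tau (scale2 a r)) Ym YB (fun x x' => phase_field_covariance reg tau a x x' Vstat) sS sS2.
rewrite eS; set I := cintegral _ _ => /(congr1 (@complex.Re R)).
rewrite !reM /= !mul0r !subr0 => ->.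
have p0 : pi != 0 :> R by rewrite gt_eqF ?pi_gt0.
have fin (A B p : R) : p != 0 -> A / (2 * p) ^+ 4 * ((2 * p) ^+ 2 * B) = A * ((2 * p) ^- 2 * B).
  by move=> q0; field.
exact: fin.
Qed.

Let F := fourier (fun k => (image_profile k)%:C).
Let sprof : schw (fun k => (image_profile k)%:C).
Proof. exact: schwartz_schw schwartz_image_profile. Qed.
Let iF : cintble (@leb2 R) F.
Proof. exact: schw_fourier_int. Qed.
Let I (a : R) := cintegral (@leb2 R) (fun r => char_fun_incr V tau (scale2 a r) * F r).

Lemma fourier_profile_integral :
  cintegral (@leb2 R) F = ((2 * pi) ^+ 2 * sqmod (Psi (scale2 (- m) y)))%:C.
Proof.
have := schw_inversion (0 : plane R) sprof.
have -> : image_profile 0 = sqmod (Psi (scale2 (- m) y)).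
  rewrite /image_profile; congr (sqmod (Psi _)).
  by apply/pair_equal_spec; split; rewrite /= mulr0 addr0.
rewrite -(rmorphM (@real_complex R)) => <-; apply: eq_cintegral => k.
have -> : dot2 k 0 = 0 by rewrite /dot2 /= !mulr0 addr0.
by rewrite cis0 mulr1.
Qed.

Lemma frozen_limit (a : nat -> R) : a n @[n --> \oo] --> (0 : R) ->
  ccvg (fun n => I (a n)) (cintegral (@leb2 R) F).
Proof.
move=> a0; have [||||_ h] := @cint_cvg _ _ _ (@leb2 R)
  (fun n r => char_fun_incr V tau (scale2 (a n) r) * F r) F (fun r => 2 * n1 (F r)).
- by move=> n; exact: (cmeasM (char_fun_incr_meas reg tau (a n) Vstat) (cintble_meas iF)).
- move=> r; rewrite -[X in ccvg _ X]mul1r; apply: ccvgM; last exact: ccvg_cst.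
  apply: (char_fun_incr_cvg reg tau Vstat).
  rewrite -[X in _ --> X](_ : scale2 0 r = 0); last first.
    by apply/pair_equal_spec; split; rewrite /= mul0r.
  have hc t : a n * t @[n --> \oo] --> 0 * t by apply: cvgM => //; exact: cvg_cst.
  exact: (cvg_pair (hc r.1) (hc r.2)).
- by apply: rintbleZ; exact: cintble_n1.
- move=> n r; apply: (le_trans (n1M _ _)); apply: ler_wpM2r; first exact: n1_ge0.
  exact: n1_char_fun_incr.
exact: h.
Qed.

(** The decay of the centered covariance gives an explicit rate: the error is of the order of the
    area [(a n)^-1 ^+ 2] on which the dilated covariance is concentrated. *)
Lemma averaged_limit (a : nat -> R) : rapidly_mixing V -> (forall n, 0 < a n) ->
  (a n)^-1 @[n --> \oo] --> (0 : R) ->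
  ccvg (fun n => I (a n)) ((sqmod (char_fun V tau))%:C * cintegral (@leb2 R) F).
Proof.
move=> mix apos a0; have [C C0 hC] := char_fun_incr_mixing tau Vstat mix.
set p := (sqmod (char_fun V tau))%:C in hC *.
have [B B0 hB] := schw_bound1 (schw_fourier sprof).
have FB r : n1 (F r) <= B by exact: le_trans (hB r) (ler_piMr B0 (weight_le1 r)).
pose W := \int[@leb2 R]_r weight r.
have W0 : 0 <= W by apply: Rintegral_ge0 => r _; exact: weight_ge0.
(* [F] is bounded by [B], and the integral of [weight (scale2 (a n) r)] is [W] divided by the
   Jacobian [a n ^+ 2]. *)
have key n : n1 (I (a n) - p * cintegral (@leb2 R) F) <= C * B * W * (a n)^-1 ^+ 2.
  have an0 : a n != 0 by rewrite gt_eqF.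
  have [iw ew] := rint_affine 0 an0 (rintble_weight R).
  have iI : cintble (@leb2 R) (fun r => char_fun_incr V tau (scale2 (a n) r) * F r).
    exact: (cintbleMb iF (char_fun_incr_meas reg tau (a n) Vstat) (fun r => n1_char_fun_incr V tau _)).
  have ipF := cintbleZ (- p) iF.
  have -> : I (a n) - p * cintegral (@leb2 R) F = cintegral (@leb2 R) (fun r =>
      char_fun_incr V tau (scale2 (a n) r) * F r + - p * F r).
    by rewrite (cintegralD iI ipF) cintegralZ// mulNr.
  have iB := rintbleZ (C * B) iw.
  have h r : n1 (char_fun_incr V tau (scale2 (a n) r) * F r + - p * F r) <=
      C * B * weight (scale2 (a n) r + 0).
    rewrite -mulrDl addr0 mulrAC; apply: (le_trans (n1M _ _)).
    by apply: ler_pM; [exact: n1_ge0..|exact: hC|exact: FB].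
  apply: (le_trans (n1_cintegral (cintbleD iI ipF) iB h)).
  rewrite RintegralZl; [|exact: measurableT|exact: iw].
  rewrite /W ew -[leRHS]mulrA.
  rewrite ler_wpM2l ?mulr_ge0// mulrC mulrA -exprMn mulVf// expr1n mul1r.
  exact: lexx.
have lim0 : C * B * W * (a n)^-1 ^+ 2 @[n --> \oo] --> (0 : R).
  rewrite -(mulr0 (C * B * W)); apply: cvgM; first exact: cvg_cst.
  rewrite -(mulr0 0); under eq_fun do rewrite expr2.
  exact: cvgM.
have h := ccvg_bound key lim0; exact: h.
Qed.

Let G (z : R[i]) : R := m ^+ 2 * re ((((2 * pi) ^+ 2)^-1)%:C * z).

(** A limit from the right may be tested on positive sequences tending to 0, the form in which
    dominated convergence is available. *)
Lemma expected_image_cvg gamma l :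
  (forall u : nat -> R, (forall n, 0 < u n) -> u n @[n --> \oo] --> (0 : R) ->
    ccvg (fun n => I (u n `^ (gamma - 2^-1))^-1) l) ->
  ('E_P[fun w => optical_image omega c0 c1 zint zobs zi (fun x => V x w) eps gamma Psi y])%E
    @[eps --> 0^'+] --> (G l)%:E.
Proof.
move=> h.
have ne : {near (0 : R)^'+, (fun eps => (G (I (eps `^ (gamma - 2^-1))^-1))%:E) =1
    (fun eps => 'E_P[fun w => optical_image omega c0 c1 zint zobs zi (fun x => V x w) eps gamma Psi y]%E)}.
  near=> eps; have e0 : 0 < eps by near: eps; exact: nbhs_right_gt.
  by rewrite expected_image.
apply: (cvg_trans (near_eq_cvg ne)).
apply: cvg_EFin; first exact: nearW.
apply/(cvg_at_rightP (fun eps => G (I (eps `^ (gamma - 2^-1))^-1))) => u [u0 ucvg].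
apply: cvgM; first exact: cvg_cst.
have [+ _] := ccvgZ (((2 * pi) ^+ 2)^-1)%:C (h u u0 ucvg).
by [].
Unshelve. all: by end_near.
Qed.

Lemma expected_image_low gamma : gamma < 2^-1 ->
  ('E_P[fun w => optical_image omega c0 c1 zint zobs zi (fun x => V x w) eps gamma Psi y])%E
    @[eps --> 0^'+] --> (m ^+ 2 * sqmod (Psi (scale2 (- m) y)))%:E.
Proof.
move=> hg; have p2 : (2 * pi) ^+ 2 != 0 :> R by rewrite expf_neq0// mulf_neq0// gt_eqF ?pi_gt0.
have -> : m ^+ 2 * sqmod (Psi (scale2 (- m) y)) = G (cintegral (@leb2 R) F).
  by rewrite /G fourier_profile_integral -(rmorphM (@real_complex R)) /= mulKf.
apply: expected_image_cvg => u u0 ucvg; apply: frozen_limit.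
have hp : 0 < 2^-1 - gamma by rewrite subr_gt0.
have := (cvg_at_rightP (fun t : R => t `^ (2^-1 - gamma)) 0 0).1 (powR_cvg0 hp) u (conj u0 ucvg).
by under eq_fun do rewrite -(opprB gamma) powRN.
Qed.

Lemma expected_image_high gamma : rapidly_mixing V -> 2^-1 < gamma ->
  ('E_P[fun w => optical_image omega c0 c1 zint zobs zi (fun x => V x w) eps gamma Psi y])%E
    @[eps --> 0^'+] -->
  (sqmod (char_fun V tau) * m ^+ 2 * sqmod (Psi (scale2 (- m) y)))%:E.
Proof.
move=> mix hg; have p2 : (2 * pi) ^+ 2 != 0 :> R by rewrite expf_neq0// mulf_neq0// gt_eqF ?pi_gt0.
have -> : sqmod (char_fun V tau) * m ^+ 2 * sqmod (Psi (scale2 (- m) y)) =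
    G ((sqmod (char_fun V tau))%:C * cintegral (@leb2 R) F).
  rewrite /G fourier_profile_integral -!(rmorphM (@real_complex R)) /=.
  by move: ((2 * pi) ^+ 2) p2 (sqmod _) (sqmod _) (m ^+ 2) => p p0 A B D; field.
apply: expected_image_cvg => u u0 ucvg; apply: averaged_limit => //.
  by move=> n; rewrite invr_gt0 powR_gt0.
have hp : 0 < gamma - 2^-1 by rewrite subr_gt0.
have h := (cvg_at_rightP (fun t : R => t `^ (gamma - 2^-1)) 0 0).1 (powR_cvg0 hp) u (conj u0 ucvg).
by under eq_fun do rewrite invrK.
Qed.

End ExpectedImage.

(** * The scattering kernel *)

Section FiniteMeasures.
Context d (T : measurableType d) (R : realType) (m : {measure set T -> \bar R}).
Hypothesis mT : (m setT < +oo)%E.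

(** Takes the proof of finiteness as an argument, so that the finite measure structure can be
    attached to a name that carries it. *)
Definition finite_copy of (m setT < +oo)%E : set T -> \bar R := m.

HB.instance Definition _ := Measure.on (finite_copy mT).

Let finite_copy_fin : fin_num_fun (finite_copy mT).
Proof.
move=> A mA; rewrite ge0_fin_numE//; apply: le_lt_trans mT.
by apply: le_measure; rewrite ?inE.
Qed.

HB.instance Definition _ := Measure_isFinite.Build _ _ _ (finite_copy mT) finite_copy_fin.

Lemma finite_measure_ex : {m' : {finite_measure set T -> \bar R} | (m' : set T -> \bar R) = m}.
Proof. by exists (finite_copy mT : {finite_measure set T -> \bar R}). Qed.

End FiniteMeasures.

Lemma finite_rintble d (T : measurableType d) (R : realType)
    (nu : {finite_measure set T -> \bar R}) (g : T -> R) (K : R) :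
  measurable_fun setT g -> (forall x, `|g x| <= K) -> rintble nu g.
Proof.
move=> mg gK; apply/integrableP; split; first exact/measurable_EFinP.
apply: (@le_lt_trans _ _ (\int[nu]_x K%:E)%E).
  apply: ge0_le_integral => //.
  - by apply/measurable_EFinP; exact: measurableT_comp.
  - by move=> x _; rewrite lee_fin.
rewrite integral_cst//=; have := fin_num_measure nu setT measurableT.
by move=> /fineK <-; rewrite -EFinM ltry.
Qed.

Section Density.
Context d (T : measurableType d) (R : realType) (mu : {sigma_finite_measure set T -> \bar R}).
Variable h : T -> R.
Hypotheses (ih : rintble mu h) (h0 : forall x, 0 <= h x).

Definition density (A : set T) : \bar R := (\int[mu]_(x in A) (h x)%:E)%E.

Let density0 : density set0 = 0%E.
Proof. by rewrite /density integral_set0. Qed.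

Let density_ge0 A : (0 <= density A)%E.
Proof. by apply: integral_ge0 => x _; rewrite lee_fin. Qed.

Let density_sigma : semi_sigma_additive density.
Proof.
move=> F mF tF mUF; rewrite /density; apply: cvg_toP.
  apply: ereal_nondecreasing_is_cvgn => m n mn.
  by apply: lee_sum_nneg_natr => // k _ _; exact: density_ge0.
rewrite ge0_integral_bigcup//.
- by apply: measurable_funTS; apply/measurable_EFinP; exact: rintble_meas ih.
- by move=> x _; rewrite lee_fin.
Qed.

Let density_measure : {m : {measure set T -> \bar R} | (m : set T -> \bar R) = density}.
Proof.
pose F := isMeasure.Build _ _ _ density density0 density_ge0 density_sigma.
by exists (HB.pack_for {measure set T -> \bar R} density F).
Qed.

(** Uniqueness almost everywhere identifies the Radon-Nikodym derivative of the new measure with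
    [h]; the formula is then the change of variables for that derivative. *)
Lemma density_ex : exists nu : {finite_measure set T -> \bar R}, forall (g : T -> R) (K : R),
  measurable_fun setT g -> (forall x, `|g x| <= K) ->
  rintble nu g /\ \int[nu]_x g x = \int[mu]_x (g x * h x).
Proof.
have [m0 e0] := density_measure.
have [nu e1] : {m' : {finite_measure set T -> \bar R} | (m' : set T -> \bar R) = m0}.
  apply: finite_measure_ex; rewrite e0 /density.
  by rewrite -ge0_fin_numE ?integrable_fin_num//; exact: density_ge0.
exists nu => g K mg gK.
have nuE A : nu A = density A by rewrite e1 e0.
have numu : nu `<< mu.
  apply/null_content_dominatesP => A mA A0; rewrite nuE.
  apply: null_set_integral => //; apply: measurable_funTS.
  by apply/measurable_EFinP; exact: rintble_meas ih.
have ig : rintble nu g by exact: finite_rintble mg gK.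
split => //; rewrite /Rintegral -(Radon_Nikodym_change_of_variables numu measurableT ig).
congr fine.
have RNi := @Radon_Nikodym_integrable _ _ _ (charge_of_finite_measure nu) mu numu.
have mh : measurable_fun setT (EFin \o h) by apply/measurable_EFinP; exact: rintble_meas ih.
apply: ae_eq_integral => //.
- by apply: emeasurable_funM; [exact/measurable_EFinP|exact: measurable_int RNi].
- by apply/measurable_EFinP; apply: measurable_funM => //; exact: rintble_meas ih.
have RNh : ae_eq mu setT (Radon_Nikodym (charge_of_finite_measure nu) mu) (EFin \o h).
  apply: integral_ae_eq => // E _ mE.
  by rewrite -Radon_Nikodym_integral//; exact: nuE.
by apply: filterS RNh => x /= hx _; rewrite hx// EFinM.
Qed.

End Density.

Section AtomAndDensity.
Variables (R : realType) (p : R) (h : plane R -> R).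
Hypotheses (p0 : 0 <= p) (ih : rintble (@leb2 R) h) (h0 : forall x, 0 <= h x).

(* The pushforward by the identity only changes the display of the sigma-algebra, which
   differs between [plane R] and [R * R]. *)
Lemma atom_density_ex : exists kappa : {finite_measure set (R * R)%type -> \bar R},
  forall (f : R * R -> R) (K : R), measurable_fun (setT : set (plane R)) f ->
    (forall x, `|f x| <= K) ->
    rintble kappa f /\ \int[kappa]_x f x = p * f 0 + \int[@leb2 R]_x (f x * h x).
Proof.
have [nu nuE] := density_ex (mu := @leb2 R) ih h0.
pose m1 : {measure set (plane R) -> \bar R} :=
  measure_add (mscale (NngNum p0) (\d_(0 : plane R))) nu.
have mid : measurable_fun (setT : set (plane R)) (fun x : plane R => x : (R * R)%type).
  by move=> _ A mA; rewrite setTI.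
have [m2 e2] := pushforward_measure m1 mid.
have m2T : (m2 setT < +oo)%E.
  have e : m1 setT = (p%:E + nu setT)%E.
    transitivity (measure_add (mscale (NngNum p0) (\d_(0 : plane R))) nu setT); first by [].
    rewrite measure_addE; congr (_ + _)%E.
    transitivity (p%:E * \d_(0%R : plane R) (setT : set (plane R)))%E; first by [].
    by rewrite diracT mule1.
  rewrite e2 /pushforward preimage_setT e.
  by have /fineK <- := fin_num_measure nu setT measurableT; rewrite -EFinD ltry.
have [kappa ek] := finite_measure_ex m2T.
exists kappa.
have pos (f : R * R -> R) (K : R) : measurable_fun (setT : set (plane R)) f ->
    (forall x, `|f x| <= K) -> (forall x, 0 <= f x) ->
    (\int[kappa]_x (f x)%:E = (p * f 0 + \int[@leb2 R]_x (f x * h x))%:E)%E.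
  move=> mf fK f0.
  have mf' : measurable_fun (setT : set (plane R)) (EFin \o f) by exact/measurable_EFinP.
  have [inu enu] := nuE f K mf fK.
  rewrite ek e2 (@ge0_integral_pushforward _ _ (plane R) (R * R)%type R _ mid m1 setT (EFin \o f)) //;
    last by move=> x _; rewrite lee_fin.
  rewrite preimage_setT ge0_integral_measure_add//; last by move=> x _; rewrite lee_fin.
  rewrite ge0_integral_mscale//; last by move=> x _; rewrite lee_fin.
  rewrite integral_dirac// diracT mul1e EFinD -enu.
  by congr (_ + _)%E; rewrite /Rintegral fineK// integrable_fin_num.
have rint (f : R * R -> R) (K : R) : measurable_fun (setT : set (plane R)) f ->
    (forall x, `|f x| <= K) -> rintble kappa f.
  by move=> mf fK; exact: (@finite_rintble _ (R * R)%type R kappa f K mf fK).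
move=> f K mf fK; split; first exact: rint mf fK.
have K0 : 0 <= K by exact: le_trans (normr_ge0 _) (fK 0).
have ih' (g : plane R -> R) (C : R) : measurable_fun setT g -> (forall x, `|g x| <= C) ->
    rintble (@leb2 R) (fun x => g x * h x).
  move=> mg gC; apply: (rintble_le _ (rintbleZ C ih)).
    by apply: measurable_funM => //; exact: rintble_meas ih.
  by move=> x; rewrite normrM (ger0_norm (h0 x)); apply: ler_wpM2r.
have Kn (x : R * R) : `|K| <= K by rewrite ger0_norm.
(* A bounded signed [f] is reduced to the nonnegative case as the difference of [f + K] and the
   constant [K]. *)
have mfK : measurable_fun (setT : set (plane R)) (fun x => f x + K) by exact: measurable_funD.
have fKn x : `|f x + K| <= K + K by apply: (le_trans (ler_normD _ _)); apply: lerD; [exact: fK|exact: (Kn x)].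
have fK0 x : 0 <= f x + K by have := fK x; rewrite ler_norml => /andP[h1 _]; rewrite -lerBlDr sub0r.
have c1 := congr1 fine (pos (fun=> K) K (measurable_cst _) Kn (fun=> K0)).
have c2 := congr1 fine (pos (fun x => f x + K) (K + K) mfK fKn fK0).
have i1 := rint (fun=> K) K (measurable_cst _) Kn.
have i2 := rint (fun x => f x + K) (K + K) mfK fKn.
transitivity (\int[kappa]_x ((f x + K) - K)).
  by apply: eq_Rintegral => x _; rewrite addrK.
rewrite RintegralB; [|exact: measurableT|exact: i2|exact: i1].
rewrite [X in X - _]c2 [X in _ - X]c1 /=.
have -> : \int[@leb2 R]_x (f x * h x) =
    \int[@leb2 R]_x ((f x + K) * h x) - \int[@leb2 R]_x (K * h x).
  rewrite -RintegralB; [|exact: measurableT|exact: ih' mfK fKn|exact: rintbleZ].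
  by apply: eq_Rintegral => x _; ring.
by ring.
Qed.

End AtomAndDensity.

Lemma gau_real (R : realType) (D : R) (x : plane R) :
  gau D%:C x = (expR (- (D * (sqnorm2 x / 2))))%:C.
Proof. by rewrite /gau -(rmorphN (@real_complex R)) -(rmorphM (@real_complex R)) cexp_real mulNr. Qed.

Lemma fourier_swap (R : realType) (F G : plane R -> R[i]) :
  cintble (@leb2 R) F -> cintble (@leb2 R) G ->
  cintegral (@leb2 R) (fun r => F r * fourier G r) =
  cintegral (@leb2 R) (fun k => fourier F k * G k).
Proof.
move=> iF iG.
have mf : cmeas (fun z : plane R * plane R => cis (- dot2 z.1 z.2) * (F z.1 * G z.2)).
  apply: cmeasM; first by apply: cmeas_cis; apply: measurable_funN; exact: measurable_dot2.
  by apply: cmeasM; [exact: (cmeas_fst _ (cintble_meas iF))|exact: (cmeas_snd _ (cintble_meas iG))].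
have fb x y : n1 (cis (- dot2 x y) * (F x * G y)) <= (2 * n1 (F x)) * n1 (G y).
  by apply: (le_trans (n1_cisM _ _)); rewrite -mulrA ler_wpM2l// n1M.
have [_ _ _ _ e] := cfubini (rintbleZ 2 (cintble_n1 iF)) (cintble_n1 iG)
  (fun x => mulr_ge0 (ler0n R 2) (n1_ge0 _)) (fun y => n1_ge0 _) mf fb.
have e1 x : F x * fourier G x = cintegral (@leb2 R) (fun y => cis (- dot2 x y) * (F x * G y)).
  rewrite fourierE -(cintegralZ (F x) (fourier_int x iG)); apply: eq_cintegral => y.
  by rewrite mulrCA.
have e2 y : fourier F y * G y = cintegral (@leb2 R) (fun x => cis (- dot2 x y) * (F x * G y)).
  rewrite fourierE mulrC -(cintegralZ (G y) (fourier_int y iF)); apply: eq_cintegral => x.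
  by rewrite dot2C mulrC -mulrA.
by rewrite (eq_cintegral _ e1) e; apply: eq_cintegral => y; rewrite e2.
Qed.

Section CenteredCovariance.
Context d (Omega : measurableType d) (R : realType) (P : probability Omega R).
Variables (V : R * R -> {RV P >-> R}) (N : set Omega) (M tau : R).
Hypotheses (reg : regular_field V N M) (Vstat : stationary V) (Vmix : rapidly_mixing V).
Implicit Types (x r k : plane R).

Let phi := char_fun V tau.
Definition centered_covariance r : R[i] := char_fun_incr V tau r - (sqmod phi)%:C.
Let psi := centered_covariance.

Let Y x w : R[i] := phase_field V N tau 1 x w - phi.

Lemma centered_covariance_meas : cmeas psi.
Proof.
have e1 r : scale2 1 r = r by case: r => a b; rewrite /scale2 /= !mul1r.
have := char_fun_incr_meas reg tau 1 Vstat.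
have -> : (fun r : plane R => char_fun_incr V tau (scale2 1 r)) = char_fun_incr V tau.
  by apply/funext => r; rewrite e1.
move=> h; exact: (cmeasD h (cmeas_cst _ (- (sqmod phi)%:C))).
Qed.

Lemma centered_covarianceE x x' :
  cintegral P (fun w => Y x w * conjc (Y x' w)) = psi (x - x').
Proof.
have e1 r : scale2 1 r = r by case: r => a b; rewrite /scale2 /= !mul1r.
have iC (f : Omega -> R[i]) (K : R) : cmeas f -> (forall w, n1 (f w) <= K) -> cintble P f.
  by move=> mf fK; exact: (cintble_le mf (rintble_cst P K)).
have mY z : cmeas (phase_field V N tau 1 z).
  apply: cmeas_cis; apply: measurable_funM => //; exact: (modification_meas reg).
have iY z : cintble P (phase_field V N tau 1 z).
  by apply: (iC _ 2) => // w; exact: n1_cis.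
have iYY : cintble P (fun w => phase_field V N tau 1 x w * conjc (phase_field V N tau 1 x' w)).
  apply: (cintbleMb (C := 2) (cintbleJ (iY x')) (mY x)) => w; exact: n1_cis.
have e w : Y x w * conjc (Y x' w) =
   (phase_field V N tau 1 x w * conjc (phase_field V N tau 1 x' w) +
     - conjc phi * phase_field V N tau 1 x w) +
   (- phi * conjc (phase_field V N tau 1 x' w) + phi * conjc phi).
  rewrite /Y; apply: complex_eqP; rewrite !reimE; ring.
have i1 := cintbleZ (- conjc phi) (iY x).
have i2 := cintbleZ (- phi) (cintbleJ (iY x')).
have i3 : cintble P (fun=> phi * conjc phi) by apply: (iC _ (n1 (phi * conjc phi))) => //; exact: cmeas_cst.
rewrite (eq_cintegral _ e).
rewrite (cintegralD (cintbleD iYY i1) (cintbleD i2 i3)) (cintegralD iYY i1) (cintegralD i2 i3).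
rewrite (cintegralZ _ (iY x)) (cintegralZ _ (cintbleJ (iY x'))) (cintegralJ (iY x')).
rewrite !(phase_field_mean reg tau _ Vstat) -/phi (phase_field_covariance reg tau 1 x x' Vstat) e1.
have -> : cintegral P (fun=> phi * conjc phi) = phi * conjc phi.
  by rewrite mulc_conj (cintegral_real P (fun=> sqmod phi)) Rintegral_prob_cst.
rewrite /psi /centered_covariance -mulc_conj.
by move: (char_fun_incr _ _ _) (conjc phi) => A B; ring.
Qed.

Lemma centered_field_joint : cmeas (fun z : plane R * Omega => Y z.1 z.2).
Proof. by apply: cmeasD; [exact: (phase_field_joint reg)|exact: cmeas_cst]. Qed.

Lemma centered_field_bound x w : n1 (Y x w) <= 2 + n1 phi.
Proof.
apply: (le_trans (n1D _ _)); rewrite n1N; apply: lerD => //; exact: n1_cis.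
Qed.

(** Parallelogram identity: the squared norms of [x] and [x - r] add up to twice that of [x - r / 2]
    plus half that of [r]. The modulations combine into a factor that depends on [r] alone. *)
Lemma gaussian_window_autocorrelation (D : R) k r : 0 < D ->
  cintegral (@leb2 R) (fun x => gk D%:C k x * conjc (gk D%:C k (x - r))) =
  (pi / D)%:C * (cis (dot2 k r) * gau (D / 2)%:C r).
Proof.
move=> D0.
have D2 : 0 < D + D by rewrite addr_gt0.
have D2' : 0 < re ((D + D)%:C) by [].
have [iA eA] := cint_affine (- scale2 2^-1 r) (oner_neq0 R) (gau_int D2').
have e x : gk D%:C k x * conjc (gk D%:C k (x - r)) =
    (cis (dot2 k r) * gau (D / 2)%:C r) * gau (D + D)%:C (scale2 1 x + - scale2 2^-1 r).
  rewrite /gk conjcM -(@cisN R) !gau_real.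
  have cJ (a : R) : conjc a%:C = a%:C by rewrite /= oppr0.
  rewrite cJ mulrACA -(@cisD R) -(mulrA (cis (dot2 k r))) -!(rmorphM (@real_complex R)) /= -!expRD.
  congr (cis _ * (expR _)%:C); first by rewrite /dot2 /=; ring.
  by rewrite /sqnorm2 /dot2 /=; field.
rewrite (eq_cintegral _ e) cintegralZ//.
move: eA; rewrite expr1n mul1r => <-.
rewrite (cint_gau_real D2) mulrC; congr (_%:C * _); field.
by rewrite !gt_eqF.
Qed.

Lemma centered_covariance_decay : exists2 C, 0 <= C & forall r, n1 (psi r) <= C * weight r.
Proof. exact: char_fun_incr_mixing. Qed.

Lemma centered_covariance_int : cintble (@leb2 R) psi.
Proof.
have [C C0 hC] := centered_covariance_decay.
exact: (cintble_le centered_covariance_meas (rintbleZw C) hC).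
Qed.

Lemma n1_window (D : R) k r : 0 < D -> n1 (cis (dot2 k r) * gau D%:C r) <= 4.
Proof.
move=> D0; apply: (le_trans (n1_cisM _ _)); rewrite (_ : 4 = 2 * 2 :> R) -?natrM//; rewrite natrM.
by apply: ler_wpM2l => //; apply: n1_gau_le2; exact: ltW.
Qed.

(* Up to a positive factor this is the second moment of the integral of the centered phase
   field against a modulated Gaussian. *)
Lemma gaussian_window_moment (D : R) k : 0 < D ->
  exists2 a : R, 0 <= a &
    cintegral (@leb2 R) (fun r => psi r * (cis (dot2 k r) * gau D%:C r)) = a%:C.
Proof.
(* Autocorrelation halves the parameter of a Gaussian, so the window is taken with [D + D]. *)
move=> D0; have DD : 0 < D + D by rewrite addr_gt0.
have [C C0 hC] := gauss_decay DD.
have gb x : n1 (gk (D + D)%:C k x) <= (2 * C) * weight x ^+ 2.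
  apply: (le_trans (n1_cisM _ _)); rewrite -mulrA ler_wpM2l// gau_real n1_real ger0_norm ?expR_ge0//.
have e := second_moment centered_field_joint centered_field_bound centered_covarianceE
  (gk_meas _ _) gb.
have ij : cintble (@leb2 R) (fun r => psi r * (cis (dot2 k r) * gau D%:C r)).
  apply: (cintbleMb' (C := 4) centered_covariance_int).
    by apply: cmeasM; [apply: cmeas_cis; exact: measurable_dot2r|exact: gau_meas].
  by move=> r; exact: n1_window.
have e2 : cintegral (@leb2 R) (fun r => psi r * cintegral (@leb2 R) (fun x =>
    gk (D + D)%:C k x * conjc (gk (D + D)%:C k (x - r)))) =
    (pi / (D + D))%:C * cintegral (@leb2 R) (fun r => psi r * (cis (dot2 k r) * gau D%:C r)).
  rewrite -(cintegralZ _ ij); apply: eq_cintegral => r.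
  have eD : (D + D) / 2 = D by field.
  rewrite gaussian_window_autocorrelation; last exact: DD.
  by rewrite eD mulrCA.
exists ((pi / (D + D))^-1 * \int[P]_w sqmod (cintegral (@leb2 R) (fun x => Y x w * gk (D + D)%:C k x))).
  apply: mulr_ge0; first by rewrite invr_ge0 divr_ge0 ?pi_ge0// ltW.
  by apply: Rintegral_ge0 => w _; exact: sqmod_ge0.
rewrite (rmorphM (@real_complex R)) /= e e2 mulrA -(rmorphM (@real_complex R)) /= mulVf ?mul1r//.
by rewrite mulf_neq0 ?invr_eq0 ?gt_eqF ?pi_gt0.
Qed.

Definition spectral_density k : R := re (fourier psi k).

Lemma fourier_centered_covariance k :
  0 <= spectral_density k /\ fourier psi k = (spectral_density k)%:C.
Proof.
pose D (n : nat) : R := n.+1%:R^-1.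
have D0 n : 0 < D n by rewrite invr_gt0.
(* The frequency is [- k] because the windows carry the phase [cis (dot2 k r)], of opposite sign to
   the one in [fourier]. *)
pose J n := cintegral (@leb2 R) (fun r => psi r * (cis (dot2 (- k) r) * gau (D n)%:C r)).
have Jlim : ccvg J (fourier psi k).
  have [||||_ h] := @cint_cvg _ _ _ (@leb2 R)
    (fun n r => psi r * (cis (dot2 (- k) r) * gau (D n)%:C r))
    (fun r => cis (- dot2 k r) * psi r) (fun r => 4 * n1 (psi r)).
  - move=> n; apply: cmeasM; first exact: centered_covariance_meas.
    by apply: cmeasM; [apply: cmeas_cis; exact: measurable_dot2r|exact: gau_meas].
  - move=> r; rewrite mulrC; apply: ccvgM; first exact: ccvg_cst.
    rewrite -[X in ccvg _ X]mulr1; apply: ccvgM.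
      have -> : dot2 (- k) r = - dot2 k r by rewrite /dot2 /=; ring.
      exact: ccvg_cst.
    rewrite -(cexp0 R); apply: ccvg_cexp.
    rewrite -[X in ccvg _ X](mul0r (sqnorm2 r / 2)%:C); apply: ccvgM; last exact: ccvg_cst.
    have -> : 0 = (- 0)%:C :> R[i] by rewrite oppr0.
    under [X in ccvg X _]eq_fun do rewrite -(rmorphN (@real_complex R)).
    by apply: ccvg_real; apply: cvgN; exact: cvg_harmonic.
  - by apply: rintbleZ; apply: cintble_n1; exact: centered_covariance_int.
  - move=> n r; apply: (le_trans (n1M _ _)); rewrite mulrC.
    by apply: ler_wpM2r; [exact: n1_ge0|exact: n1_window].
  exact: h.
have Ja n : 0 <= re (J n) /\ im (J n) = 0.
  by have [a a0 e] := gaussian_window_moment (- k) (D0 n); rewrite /J e.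
have [c1 c2] := Jlim; split.
  rewrite /spectral_density -(cvg_lim _ c1)//; apply: limr_ge; first exact: cvgP c1.
  by apply: nearW => n; have [] := Ja n.
apply: complex_eqP; first by [].
have eJ : (fun n => im (J n)) = (fun=> 0) by apply/funext => n; have [] := Ja n.
by have := cvg_lim (@norm_hausdorff _ _) c2; rewrite eJ lim_cst// => <-.
Qed.

(** A bounded integrable function with nonnegative transform has an integrable transform: by
    [gauss_swap] at 0 the damped integrals are averages of [psi] against heat kernels of mass
    [(2 * pi) ^+ 2], hence bounded by that mass times the bound [C] on [psi], and nonnegativity
    allows [rintble_reg]. *)
Lemma spectral_density_int : rintble (@leb2 R) spectral_density.
Proof.
have [C C0 hC] := centered_covariance_decay.
pose W := \int[@leb2 R]_r (C * weight r).
have sd0 k : 0 <= spectral_density k by have [] := fourier_centered_covariance k.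
have mF := fourier_meas centered_covariance_int.
apply: (@rintble_reg _ _ (2 * W) ((2 * pi) ^+ 2 * C)).
- exact: mF.1.
- move=> k; rewrite sd0 /=; apply: (le_trans (ler_norm _)); apply: (le_trans (re_le_n1 _)).
  exact: (n1_fourier k centered_covariance_int (rintbleZw C) hC).
move=> n; pose D : R := n.+1%:R^-1.
have D0 : 0 < D by rewrite invr_gt0.
have Dre : 0 < re D%:C by [].
have [_ e] := gauss_swap (0 : plane R) Dre centered_covariance_int.
have hE x' : heat D%:C (0 - x') = (2 * pi / D * expR (- (sqnorm2 (0 - x') / 2 / D)))%:C.
  rewrite /heat -fmorphV -!(rmorphM (@real_complex R)) -(rmorphN (@real_complex R)).
  rewrite -(rmorphM (@real_complex R)) /= cexp_real -(rmorphM (@real_complex R)) /=.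
  by congr (_ * expR _)%:C; ring.
have eL k : fourier psi k * (cis (dot2 k 0) * gau D%:C k) =
    (spectral_density k * expR (- (D * (sqnorm2 k / 2))))%:C.
  have -> : dot2 k 0 = 0 by rewrite /dot2 /= !mulr0 addr0.
  rewrite cis0 mul1r gau_real (rmorphM (@real_complex R)).
  by have [_ ->] := fourier_centered_covariance k.
move: e; rewrite (eq_cintegral _ eL) cintegral_real => /(congr1 (@complex.Re R)) => e.
rewrite [leLHS]e.
have [iE EE] := cint_heat_real (0 : plane R) D0.
have hb x' : n1 (psi x' * heat D%:C (0 - x')) <=
    (C * (2 * pi / D)) * expR (- (sqnorm2 (0 - x') / 2 / D)).
  apply: (le_trans (n1M _ _)); rewrite hE n1_real ger0_norm; last first.
    by rewrite mulr_ge0 ?expR_ge0// divr_ge0 ?mulr_ge0 ?pi_ge0// ltW.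
  rewrite -(mulrA C); apply: ler_wpM2r.
    by rewrite mulr_ge0 ?expR_ge0// divr_ge0 ?mulr_ge0 ?pi_ge0// ltW.
  exact: (le_trans (hC x') (ler_piMr C0 (weight_le1 x'))).
have ipsi : cintble (@leb2 R) (fun x' => psi x' * heat D%:C (0 - x')).
  apply: (cintble_le _ (rintbleZ (C * (2 * pi / D)) iE)); last exact: hb.
  apply: (cmeasM centered_covariance_meas).
  exact: (cmeasM (cmeas_cst _ _) (heat_meas D%:C (0 : plane R))).
apply: (le_trans (ler_norm _)); apply: (le_trans (re_le_n1 _)).
apply: (le_trans (n1_cintegral ipsi (rintbleZ _ iE) hb)).
rewrite RintegralZl; [|exact: measurableT|exact: iE].
have fin (A p D' : R) : D' != 0 -> A * (2 * p / D') * (2 * p * D') = (2 * p) ^+ 2 * A.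
  by move=> q0; field.
by rewrite EE fin ?lexx ?gt_eqF.
Qed.

(** For the constant part of [char_fun_incr], inversion at 0 turns the integral of [fourier f] into
    a multiple of [f 0], which accounts for the atom. For the centered part, [fourier_swap] moves
    the transform from the test function to [psi], which accounts for the density. *)
Theorem scattering_kernel_ex : exists kappa, is_scattering_kernel V tau kappa.
Proof.
have p2 : 0 < (2 * pi) ^+ 2 :> R by rewrite exprn_gt0// mulr_gt0// pi_gt0.
pose c : R := ((2 * pi) ^+ 2)^-1.
have c0 : 0 <= c by rewrite invr_ge0 ltW.
have ih := rintbleZ c spectral_density_int.
have h0 k : 0 <= c * spectral_density k.
  by apply: mulr_ge0 => //; have [] := fourier_centered_covariance k.
have [kappa hk] := atom_density_ex (sqmod_ge0 phi) ih h0.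
exists kappa => f sf; have cf := schwartz_schw sf.
have [m1 m2] := schw_meas cf.
have if_ := schw_int cf.
have [B' fB] : exists B', forall x, n1 (f x) <= B'.
  have [C C0 hC] := schw_bound1 cf; exists C => x.
  exact: (le_trans (hC x) (ler_piMr C0 (weight_le1 x))).
have [_ e1] := hk (fun x => re (f x)) B' m1 (fun x => le_trans (re_le_n1 _) (fB x)).
have [_ e2] := hk (fun x => im (f x)) B' m2 (fun x => le_trans (im_le_n1 _) (fB x)).
have iF := schw_fourier_int cf; have mF := schw_meas (schw_fourier cf).
have [C C0 hC] := centered_covariance_decay.
have ipsiF : cintble (@leb2 R) (fun r => psi r * fourier f r).
  apply: (cintbleMb (C := C) iF centered_covariance_meas) => r.
  exact: (le_trans (hC r) (ler_piMr C0 (weight_le1 r))).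
have e3 : cintegral (@leb2 R) (fun r => char_fun_incr V tau r * fourier f r) =
    cintegral (@leb2 R) (fun k => (spectral_density k)%:C * f k) +
    (sqmod phi)%:C * (((2 * pi) ^+ 2)%:C * f 0).
  transitivity (cintegral (@leb2 R) (fun r => psi r * fourier f r + (sqmod phi)%:C * fourier f r)).
    by apply: eq_cintegral => r; rewrite -mulrDl /psi /centered_covariance subrK.
  rewrite (cintegralD ipsiF (cintbleZ _ iF)) (cintegralZ _ iF) (fourier_swap centered_covariance_int if_).
  congr (_ + _ * _).
    by apply: eq_cintegral => k; have [_ ->] := fourier_centered_covariance k.
  rewrite -(schw_inversion 0 cf); apply: eq_cintegral => k.
  have -> : dot2 k 0 = 0 by rewrite /dot2 /= !mulr0 addr0.
  by rewrite cis0 mulr1.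
have isd : cintble (@leb2 R) (fun k => (spectral_density k)%:C).
  apply: (cintble_le (cmeas_real (rintble_meas spectral_density_int)) spectral_density_int) => k.
  by rewrite n1_real ger0_norm//; have [] := fourier_centered_covariance k.
have isf := cintbleMb' isd (schw_meas cf) fB.
have e4 : cintegral kappa f = (sqmod phi)%:C * f 0 +
    cintegral (@leb2 R) (fun k => c%:C * ((spectral_density k)%:C * f k)).
  apply: complex_eqP; rewrite !reimE /= ?mul0r ?subr0 ?addr0.
    rewrite [LHS]e1; congr (_ + _); apply: eq_Rintegral => k _; rewrite !reimE /=.
    by ring.
  rewrite [LHS]e2; congr (_ + _); apply: eq_Rintegral => k _; rewrite !reimE /=.
  by ring.
rewrite e4 (cintegralZ _ isf) e3 mulrDr addrC; congr (_ + _).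
rewrite [RHS]mulrCA; congr (_ * _); rewrite mulrA -(rmorphM (@real_complex R)) /= mulVf ?mul1r//.
by rewrite gt_eqF.
Qed.

End CenteredCovariance.

Section KernelSide.
Context d (Omega : measurableType d) (R : realType) (P : probability Omega R).
Variable V : R * R -> {RV P >-> R}.

(** The kernel is a chosen witness; this property is the only access to it. *)
Lemma scattering_kernelP (tau : R) : (exists kappa, is_scattering_kernel V tau kappa) ->
  is_scattering_kernel V tau (scattering_kernel V tau).
Proof.
move=> h; rewrite /scattering_kernel; case: pselect => // h'.
exact: (svalP (cid h')).
Qed.

Lemma char_fun_incr_abs (tau : R) x : stationary V -> isotropic V ->
  char_fun_incr V `|tau| x = char_fun_incr V tau x.
Proof.
move=> st iso; have [t0|t0] := leP 0 tau; first by rewrite ger0_norm.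
by rewrite ltr0_norm// char_fun_incrN.
Qed.

Lemma char_fun_abs (tau : R) : sqmod (char_fun V `|tau|) = sqmod (char_fun V tau).
Proof.
have [t0|t0] := leP 0 tau; first by rewrite ger0_norm.
rewrite ltr0_norm// -sqmodJ /char_fun -cintegralJ; last first.
  apply: (cintble_le _ (rintble_cst P 2)) => [|w]; last exact: n1_cis.
  by apply: cmeas_cis; apply: measurable_funM => //; exact: RV_meas.
by congr sqmod; apply: eq_cintegral => w; rewrite mulNr cisN conjcK.
Qed.

End KernelSide.

Unset Implicit Arguments.

Theorem proposition4p1 (R : realType) (omega c0 c1 zint zobs zi : R)
    (homega : 0 < omega) (hc0 : 0 < c0) (hc1 : 0 < c1)
    (hzint : 0 < zint) (hzobs : zint < zobs) (hzi : 0 < zi)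
    (d : measure_display) (Omega : measurableType d) (P : probability Omega R)
    (V : R * R -> {RV P >-> R})
    (hV0 : mean_zero V) (hVstat : stationary V) (hViso : isotropic V)
    (hVbnd : bounded_field V) (hVmix : rapidly_mixing V)
    (hVsmooth : smooth_field V)
    (Psi : R * R -> complex R) (hPsi : schwartz Psi) (y : R * R) :
  let Dk := wavenumber_gap omega c0 c1 in
  let m := eff_distance c0 c1 zint zobs / zi in
  let image eps gamma w :=
    optical_image omega c0 c1 zint zobs zi (fun x => V x w) eps gamma Psi y in
  [/\ forall eps : R, 0 < eps ->
        ('E_P[image eps (2^-1)%R] =
         (m ^+ 2)%:E *
         \int[scattering_kernel V Dk]_k
           (sqmod (Psi (scale2 (- m) y + scale2 (c0 * zint / omega) k)))%:E)%E,
      forall gamma : R, gamma < 2^-1 ->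
        'E_P[image eps gamma]%E @[eps --> 0^'+] -->
        (m ^+ 2 * sqmod (Psi (scale2 (- m) y)))%:E
    & forall gamma : R, 2^-1 < gamma ->
        'E_P[image eps gamma]%E @[eps --> 0^'+] -->
        (sqmod (char_fun V Dk) * m ^+ 2 * sqmod (Psi (scale2 (- m) y)))%:E].
Proof.
move=> Dk m image.
have [N [M reg]] := regular_field_ex hVbnd hVsmooth.
pose tau := omega * (c0^-1 - c1^-1).
have eDk : Dk = `|tau| by rewrite /Dk /wavenumber_gap /tau normrM gtr0_norm.
have hK : is_scattering_kernel V Dk (scattering_kernel V Dk).
  by apply: scattering_kernelP; exact: (scattering_kernel_ex Dk reg hVstat hVmix).
split.
- move=> eps eps0.
  rewrite (expected_image reg hVstat homega hc0 hc1 hzint hzobs hzi y hPsi (2^-1) eps0).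
  set f := fun k => (image_profile omega c0 c1 zint zobs zi Psi y k)%:C.
  have sf : schwartz f by exact: schwartz_image_profile.
  rewrite subrr powRr0 invr1.
  have -> : cintegral (@leb2 R) (fun r => char_fun_incr V tau (scale2 1 r) * fourier f r) =
      cintegral (@lebesgue2 R) (fun r => char_fun_incr V Dk r * fourier f r).
    apply: eq_cintegral => r; rewrite eDk char_fun_incr_abs//.
    by congr (char_fun_incr _ _ _ * _); case: (r) => a b; rewrite /scale2 /= !mul1r.
  rewrite -(hK f sf) EFinM; congr (_ * _)%E.
  (* The profile is bounded and the kernel is finite, so the extended integral of the statement is
     finite and equals the real part of [cintegral]. *)
  have [B B0 hB] := schw_bound1 (schwartz_schw sf).
  have mf : measurable_fun (setT : set (plane R)) (fun k => re (f k)).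
    by have [] := schw_meas (schwartz_schw sf).
  have ik : rintble (scattering_kernel V Dk) (fun k => re (f k)).
    apply: (@finite_rintble _ (R * R)%type R (scattering_kernel V Dk) _ B mf) => k.
    exact: (le_trans (re_le_n1 _) (le_trans (hB k) (ler_piMr B0 (weight_le1 k)))).
  exact: (fineK (integrable_fin_num measurableT ik)).
- move=> gamma hg; exact: (expected_image_low reg hVstat homega hc0 hc1 hzint hzobs hzi hPsi hg).
- move=> gamma hg; rewrite eDk char_fun_abs.
  exact: (expected_image_high reg hVstat homega hc0 hc1 hzint hzobs hzi hPsi hVmix hg).
Qed.
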